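(* For every $\rho<1$ there exists $L>0$ such that the following holds. If $G$ is a transitive graph with spectral radius at most $\rho$ and girth at least $L$, then $p_c(G)<p_u(G)$.
   Context: Graphs are connected, locally finite and infinite. For vertices $x,y$ and $n\ge 0$, $p^n(x,y)$ is the probability that simple random walk started at $x$ is at $y$ at time $n$. The spectral radius of $G$ is $\lim_{n\to\infty} p^{2n}(0,0)^{1/(2n)}\in[0,1]$ for a fixed vertex $0$. The girth is the length of the shortest cycle. For $p\in[0,1]$, $p$-bond percolation $\mathbb{P}_p$ keeps each edge independently with probability $p$ (open) and deletes it otherwise. $p_c=\inf\{p: \mathbb{P}_p(\exists \text{ an infinite connected open component})>0\}$ and $p_u=\inf\{p:\mathbb{P}_p(\exists\text{ a unique infinite connected open component})>0\}$. *)

(* Defs.v *)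
From HB Require Import structures.
From mathcomp Require Import all_boot all_order all_algebra.
From mathcomp Require Import all_classical all_reals all_analysis.
Set Implicit Arguments. Unset Strict Implicit. Unset Printing Implicit Defensive.
Import Order.TTheory GRing.Theory Num.Theory.
Local Open Scope classical_set_scope.
Local Open Scope ring_scope.

(* A (simple, locally finite) graph on a countable vertex type V is given by the
   finite list of neighbours of each vertex. *)
Section Graph.
Variable V : countType.
Variable nb : V -> seq V.

Definition adj : rel V := fun x y => y \in nb x.

Definition connected_graph : Prop :=
  forall x y : V, exists s : seq V, path adj x s /\ last x s = y.

Definition graph_ok : Prop :=
  [/\ forall x, uniq (nb x),
      forall x, ~~ adj x x,
      forall x y, adj x y = adj y x,
      connected_graph
    & infinite_set [set: V]].

Definition transitive_graph : Prop :=
  forall x y : V, exists f : V -> V,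
    [/\ bijective f, forall u v, adj (f u) (f v) = adj u v & f x = y].

Definition girth_ge (L : nat) : Prop :=
  forall c : seq V, ucycle adj c -> (3 <= size c)%N -> (L <= size c)%N.

Variable R : realType.

Fixpoint srw (n : nat) (x y : V) : R :=
  match n with
  | 0 => (x == y)%:R
  | n'.+1 => \sum_(z <- nb x) (size (nb x))%:R^-1 * srw n' z y
  end.

Definition spectral_radius (o : V) : R :=
  limn (fun n : nat => powR (srw (2 * n) o o) (((2 * n)%:R)^-1)).

(* bond percolation: edge {x,y} is encoded by the oriented pair with smaller
   code first *)
Definition oriented_edge (e : V * V) : bool :=
  adj e.1 e.2 && (pickle e.1 < pickle e.2)%N.

Definition orient (x y : V) : V * V :=
  if (pickle x < pickle y)%N then (x, y) else (y, x).

Definition open_conn (omega : V * V -> bool) (x y : V) : Prop :=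
  exists s : seq V,
    path (fun u v => adj u v && omega (orient u v)) x s /\ last x s = y.

Definition cluster (omega : V * V -> bool) (x : V) : set V :=
  [set y | open_conn omega x y].

Definition has_infinite_cluster (omega : V * V -> bool) : Prop :=
  exists x, infinite_set (cluster omega x).

Definition has_unique_infinite_cluster (omega : V * V -> bool) : Prop :=
  has_infinite_cluster omega /\
  forall x y, infinite_set (cluster omega x) -> infinite_set (cluster omega y) ->
    open_conn omega x y.

Definition bernoulli_percolation (p : R) (d : measure_display)
  (Omega : measurableType d) (P : probability Omega R)
  (X : V * V -> Omega -> bool) : Prop :=
  (forall e, measurable [set w | X e w]) /\
  forall (s : seq (V * V)) (b : V * V -> bool),
    uniq s -> all oriented_edge s ->
    P [set w | forall e, e \in s -> X e w = b e] =
      (\prod_(e <- s) (if b e then p else 1 - p))%:E.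

(* P_p(E) > 0 (for the p-bond percolation measure, i.e. in any model of it) *)
Definition prob_pos (p : R) (E : (V * V -> bool) -> Prop) : Prop :=
  forall (d : measure_display) (Omega : measurableType d)
         (P : probability Omega R) (X : V * V -> Omega -> bool),
    bernoulli_percolation p P X ->
    (0 < P [set w | E (fun e => X e w)])%E.

Definition p_c : R :=
  inf [set p : R | 0 <= p <= 1 /\ prob_pos p has_infinite_cluster].

Definition p_u : R :=
  inf [set p : R | 0 <= p <= 1 /\ prob_pos p has_unique_infinite_cluster].

End Graph.

(* Main.v *)
Require Import Defs.
From HB Require Import structures.
From mathcomp Require Import all_boot all_order all_algebra.
From mathcomp Require Import all_classical all_reals all_analysis.
From mathcomp Require Import ring lra zify measurable_realfun.

(* Let [G] be [q+1]-regular and [t < 1] with spectral radius at most [t] and [t >= 9/10].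
   Since [t (q+1) <= t q + 1/t], a conserved quadratic form for the recursion of the
   non-backtracking operators [B_n] gives [|B_n| <= 8 (t q)^n] on [l^2].
   Hence for [p < 1 / (t q)] the two-point function tends to [0]; as the events that
   a vertex lies in a unique infinite cluster all have the same probability, the second
   Bonferroni inequality along far apart vertices shows that this probability is [0],
   so that [p_u >= 1 / (t q)].
   The same norm bound shows, by a last-exit decomposition, that for every finite set [T]
   and every [k] at least [c |T| q^(k+1)] non-backtracking walks of length [k+1] leave [T]
   and never return, with [c] depending on [t] only.  So when a cluster [T] is explored
   there is always an edge leaving [T], not yet sprinkled, behind which a positive fraction
   of the tree of depth [k] (girth!) is unexplored.  Sprinkling it with probability
   [delta / q] and then exploring this tree at [mu / q], [mu > 1], adds of order [mu^k]
   vertices with positive conditional probability, which for large [k] beats the number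
   of sprinkled edges.  Thus [p_c <= (mu + delta) / q], below [1 / (t q)]. *)
Set Implicit Arguments. Unset Strict Implicit. Unset Printing Implicit Defensive.
Import Order.TTheory GRing.Theory Num.Theory.
Import numFieldNormedType.Exports.
Local Open Scope classical_set_scope.
Local Open Scope ring_scope.

(** * Finitely supported functions and the spectral radius *)

(** The girth bound may depend on [rho] only, while the degree is unbounded; hence edge
    probabilities are scaled by [1 / q] and all remaining constants depend on [t] alone. The room
    for the argument is the interval from [1 / q] to [1 / (t q)]. The obstacle is that the girth
    controls a cluster only locally: a cluster [T] already grown is an arbitrary finite set and may
    block most continuations. The escape estimate therefore has to hold for every finite set, and
    averaging it over the boundary finds a usable edge even after many boundary edges have been
    spent. Adaptive exploration is never modelled as a random process. The probability of a monotone
    event on finitely many edges is affine in each edge parameter, so one exploration step is one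
    affine splitting, and an exponential potential plays the role of a supermartingale. Infinite
    clusters enter only at the end, through bounds uniform in the size to be reached. *)

Section InnerProduct.
Variables (V : countType) (R : realType).
Implicit Types (f g h : V -> R) (S : seq V).

(* [fins] is finite support; the finitely supported sum [ip] is junk ([0]) otherwise. *)
Definition supp f S := forall x, x \notin S -> f x = 0.
Definition fins f := exists S, supp f S.
Definition ip f g : R := \sum_(x \in [set: V]) f x * g x.

Lemma supp_sub f S S' : {subset S <= S'} -> supp f S -> supp f S'.
Proof. by move=> sS h x hx; apply: h; apply: contra hx; apply: sS. Qed.

Lemma fins_uniq f : fins f -> exists S, uniq S /\ supp f S.
Proof.
move=> [S h]; exists (undup S); split; first exact: undup_uniq.
by apply: supp_sub h => x; rewrite mem_undup.
Qed.

Lemma fins2 f g : fins f -> fins g -> exists S, [/\ uniq S, supp f S & supp g S].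
Proof.
move=> [S h] [S' h']; exists (undup (S ++ S')); split; first exact: undup_uniq.
  by apply: supp_sub h => x; rewrite mem_undup mem_cat => ->.
by apply: supp_sub h' => x; rewrite mem_undup mem_cat => ->; rewrite orbT.
Qed.

Lemma ipE f g S : uniq S -> supp f S -> ip f g = \sum_(x <- S) f x * g x.
Proof.
move=> uS sf; rewrite /ip (fsbigE S) //.
  by apply: eq_bigl => x; rewrite in_setT.
by move=> x _ /sf ->; rewrite mul0r.
Qed.

Lemma ipC f g : ip f g = ip g f.
Proof. by apply: eq_fsbigr => x _; rewrite mulrC. Qed.

Lemma finsZ a f : fins f -> fins (fun x => a * f x).
Proof. by move=> [S h]; exists S => x /h ->; rewrite mulr0. Qed.

Lemma finsD f g : fins f -> fins g -> fins (fun x => f x + g x).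
Proof.
move=> hf hg; have [S [_ h h']] := fins2 hf hg.
by exists S => x hx; rewrite h // h' // addr0.
Qed.

Lemma ipZl a f g : fins f -> ip (fun x => a * f x) g = a * ip f g.
Proof.
move=> /fins_uniq [S [uS sf]]; rewrite !(ipE _ uS) //.
  by rewrite mulr_sumr; apply: eq_bigr => x _; rewrite mulrA.
by move=> x /sf ->; rewrite mulr0.
Qed.

Lemma ipDl f g h : fins f -> fins g ->
  ip (fun x => f x + g x) h = ip f h + ip g h.
Proof.
move=> hf hg; have [S [uS sf sg]] := fins2 hf hg; rewrite !(ipE _ uS) //.
  by rewrite -big_split; apply: eq_bigr => x _; rewrite mulrDl.
by move=> x hx; rewrite sf // sg // addr0.
Qed.

Lemma ip_linl c u f g : fins u -> fins f ->
  ip (fun x => u x + c * f x) g = ip u g + c * ip f g.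
Proof. by move=> hu hf; rewrite ipDl ?ipZl //; exact: finsZ. Qed.

Lemma ip_linr c u f g : fins u -> fins f ->
  ip g (fun x => u x + c * f x) = ip g u + c * ip g f.
Proof. by move=> hu hf; rewrite ipC ip_linl // !(ipC g). Qed.

Lemma ip_ge0 f : fins f -> 0 <= ip f f.
Proof.
move=> /fins_uniq [S [uS sf]]; rewrite (ipE _ uS) //.
by apply: sumr_ge0 => x _; rewrite -expr2 sqr_ge0.
Qed.

(** With [a = ip f g] and [b = ip g g], the square norm of [b f - a g] is [b (b |f|^2 - a^2)]; if
    [b = 0], then [g] vanishes identically. *)
Lemma ip_CS f g : fins f -> fins g -> ip f g ^+ 2 <= ip f f * ip g g.
Proof.
move=> hf hg; pose a := ip f g; pose b := ip g g.
pose h x := b * f x + (- a) * g x.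
have fbf := finsZ b hf; have fag := finsZ (- a) hg.
have hE : ip h h = b * (b * ip f f - a ^+ 2).
  rewrite /h ipDl // !ipZl // !(ipC _ (fun x => _ + _)) !ipDl // !ipZl //.
  by rewrite (ipC g f) -/a -/b; ring.
have h0 : 0 <= ip h h by apply: ip_ge0; apply: finsD.
have b0 : 0 <= b by exact: ip_ge0.
have [bp|] := ltP 0 b.
  by move: h0; rewrite hE pmulr_rge0 // subr_ge0 -/a -/b mulrC.
move=> b1; have {b0 b1} b0 : b = 0 by apply/eqP; rewrite eq_le b1 b0.
have g0 x : g x = 0.
  have [S [uS sg]] := fins_uniq hg; have [xS|/sg //] := boolP (x \in S).
  move: b0; rewrite /b (ipE _ uS) // => /eqP; rewrite psumr_eq0; last first.
    by move=> y _; rewrite -expr2 sqr_ge0.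
  by move=> /allP /(_ x xS) /=; rewrite mulf_eq0 orbb => /eqP.
rewrite (_ : ip f g = 0) ?expr0n ?mulr_ge0 ?ip_ge0 //.
by rewrite ipC (ipE (S := [::]) _) ?big_nil.
Qed.

Lemma ip_sqrt f g : fins f -> fins g ->
  ip f g <= Num.sqrt (ip f f) * Num.sqrt (ip g g).
Proof.
move=> hf hg; rewrite -sqrtrM ?ip_ge0 //.
apply: le_trans (ler_norm _) _; rewrite -sqrtr_sqr.
by apply: ler_wsqrtr; apply: ip_CS.
Qed.

End InnerProduct.

Section Adjacency.
Variables (V : countType) (nb : V -> seq V) (R : realType).
Hypothesis G : graph_ok nb.
Implicit Types (f g h : V -> R) (S : seq V).

Definition adjop f x : R := \sum_(y <- nb x) f y.

Lemma adj_sym x y : (y \in nb x) = (x \in nb y).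
Proof. by case: G => _ _ + _ _ => /(_ x y). Qed.

Lemma nb_uniq x : uniq (nb x).
Proof. by case: G. Qed.

Lemma adj_neq x y : y \in nb x -> x != y.
Proof. by case: G => _ + _ _ _; move=> /(_ x) h xy; apply: contraNneq h => {2}->. Qed.

Lemma supp_adjop f S : supp f S -> supp (adjop f) (flatten (map nb S)).
Proof.
move=> sf x hx; rewrite /adjop big_seq big1 // => y yx; apply: sf.
apply: contra hx => yS; apply/flattenP; exists (nb y); first exact: map_f.
by rewrite -adj_sym.
Qed.

Lemma fins_adjop f : fins f -> fins (adjop f).
Proof. by move=> [S /supp_adjop h]; exists (flatten (map nb S)). Qed.

Lemma adjopE f S x : uniq S -> supp f S ->
  adjop f x = \sum_(y <- S) (y \in nb x)%:R * f y.
Proof.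
move=> uS sf; rewrite /adjop.
have -> : \sum_(y <- S) (y \in nb x)%:R * f y = \sum_(y <- S | y \in nb x) f y.
  rewrite [RHS]big_mkcond; apply: eq_bigr => y _.
  by case: (y \in nb x); rewrite ?mul1r ?mul0r.
have -> : \sum_(y <- nb x) f y = \sum_(y <- nb x | y \in S) f y.
  rewrite [RHS]big_mkcond; apply: eq_bigr => y _.
  by case: ifPn => // /sf ->.
rewrite -big_filter -[RHS]big_filter; apply: perm_big; apply: uniq_perm.
- exact: filter_uniq (nb_uniq x).
- exact: filter_uniq.
- by move=> y; rewrite !mem_filter andbC.
Qed.

Lemma adjop_sym f g : fins f -> fins g -> ip (adjop f) g = ip f (adjop g).
Proof.
move=> hf hg; have [S [uS sf sg]] := fins2 hf hg.
rewrite ipC !(ipE _ uS) //.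
transitivity (\sum_(x <- S) \sum_(y <- S) (y \in nb x)%:R * f y * g x).
  by apply: eq_bigr => x _; rewrite (adjopE _ uS sf) mulr_sumr;
    apply: eq_bigr => y _; rewrite mulrC.
rewrite exchange_big; apply: eq_bigr => x _.
rewrite (adjopE _ uS sg) mulr_sumr; apply: eq_bigr => y _.
by rewrite adj_sym; ring.
Qed.

End Adjacency.

(** * Log-convex sequences *)

Section Sequences.
Variable R : realType.

Lemma expr_small (x c : R) : 0 <= x < 1 -> 0 < c -> exists n, x ^+ n < c.
Proof.
move=> /andP[x0 x1] c0.
have h : (fun n => x ^+ n) @ \oo --> (0 : R) by apply: cvg_expr; rewrite ger0_norm.
have /cvgrPdist_lt /(_ c c0) [N _ /(_ N (leqnn N)) /=] := h.
rewrite sub0r normrN ger0_norm ?exprn_ge0 // => hN.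
by exists N.
Qed.

Lemma geometric_growth_le (r b c C : R) : 0 <= r -> 0 <= b -> 0 < c ->
  (forall n, r ^+ n * c <= C * b ^+ n) -> r <= b.
Proof.
move=> r0 b0 c0 h; rewrite leNgt; apply/negP => br.
have rp : 0 < r by exact: le_lt_trans br.
have C0 : 0 < C by have := h 0%N; rewrite !expr0 mul1r mulr1; apply: lt_le_trans.
have hx : 0 <= b / r < 1 by rewrite divr_ge0 //= ltr_pdivrMr // mul1r.
have hc : 0 < c / C by rewrite divr_gt0.
have [n hn] := expr_small hx hc.
have := h n; rewrite leNgt => /negP; apply.
move: hn; rewrite expr_div_n ltr_pdivrMr ?exprn_gt0 // mulrAC ltr_pdivlMr //.
by rewrite mulrC (mulrC c).
Qed.

(** Root-free form of the monotonicity of [a n ^ (1 / n)]: raise the log-convexity inequality to the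
    power [n + 1], insert the induction hypothesis and cancel a power of [a n.+1]. *)
Lemma logconvex_pow (a : nat -> R) n : (forall n, 0 <= a n) -> a 0%N = 1 ->
  (forall n, a n.+1 ^+ 2 <= a n * a n.+2) -> a n ^+ n.+1 <= a n.+1 ^+ n.
Proof.
move=> a0 a1 h; elim: n => [|n IH]; first by rewrite expr1 expr0 a1.
have [->|an] := eqVneq (a n.+1) 0; first by rewrite expr0n exprn_ge0.
have ap : 0 < a n.+1 by rewrite lt_def an a0.
have : a n.+1 ^+ (2 * n.+1) <= a n ^+ n.+1 * a n.+2 ^+ n.+1.
  by rewrite exprM -exprMn lerXn2r // ?nnegrE ?exprn_ge0 // mulr_ge0.
move=> /le_trans /(_ (ler_wpM2r (exprn_ge0 n.+1 (a0 n.+2)) IH)).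
rewrite (_ : 2 * n.+1 = n + n.+2)%N; last by rewrite mul2n -addnn addSnnS.
by rewrite exprD ler_pM2l // exprn_gt0.
Qed.

Lemma logconvex_ratio (a : nat -> R) n : (forall n, 0 <= a n) -> 0 < a 0%N ->
  (forall n, a n.+1 ^+ 2 <= a n * a n.+2) -> (a 1%N / a 0%N) ^+ n * a 0%N <= a n.
Proof.
move=> a0 ap h; set r := a 1%N / a 0%N.
have r0 : 0 <= r by rewrite divr_ge0.
have step m : r * a m <= a m.+1.
  elim: m => [|m IH]; first by rewrite /r divfK ?gt_eqF.
  have [am|am] := eqVneq (a m) 0.
    have := h m; rewrite am mul0r => h2.
    have /eqP : a m.+1 ^+ 2 == 0 by rewrite eq_le h2 sqr_ge0.
    by move=> /eqP; rewrite sqrf_eq0 => /eqP ->; rewrite mulr0.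
  have amp : 0 < a m by rewrite lt_def am a0.
  rewrite -(ler_pM2l amp); apply: le_trans (h m).
  by rewrite mulrA (mulrC _ r) expr2 ler_wpM2r.
elim: n => [|n IH]; first by rewrite expr0 mul1r.
by apply: le_trans (step n); rewrite exprS -mulrA ler_wpM2l.
Qed.

Lemma logconvex_limn (a : nat -> R) (rho : R) : (forall n, 0 <= a n <= 1) -> a 0%N = 1 ->
  (forall n, a n.+1 ^+ 2 <= a n * a n.+2) ->
  limn (fun n => powR (a n) (((2 * n)%:R)^-1)) <= rho ->
  forall n, a n <= rho ^+ (2 * n).
Proof.
move=> a01 a1 h; set u := (fun n : nat => powR _ _) => hl.
have a0 n : 0 <= a n by have /andP[] := a01 n.
have u1 n : u n <= 1.
  apply: (@le_trans _ _ (powR 1 (((2 * n)%:R)^-1))); last by rewrite powR1.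
  apply: ge0_ler_powR; rewrite ?invr_ge0 ?nnegrE //.
  by have /andP[] := a01 n.
have unn (n m : nat) : (0 < n)%N -> u n = powR (a n ^+ m.+1) ((2 * n * m.+1)%:R^-1).
  move=> n0; rewrite /u -powR_mulrn // -powRrM; congr powR.
  by rewrite [in RHS]natrM invfM mulrCA divff ?mulr1 // pnatr_eq0.
(* The shift is needed because [u 0 = powR 1 0 = 1], the inverse of [0] being [0]. From index [1]
   on, [u] increases, so each term is at most the limit. *)
have mono : {homo (fun n => u n.+1) : n m / (n <= m)%N >-> n <= m}.
  apply/nondecreasing_seqP => n.
  rewrite (unn n.+1 n.+1) // (unn n.+2 n) //.
  rewrite (_ : 2 * n.+1 * n.+2 = 2 * n.+2 * n.+1)%N; last by rewrite mulnAC.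
  apply: ge0_ler_powR; rewrite ?invr_ge0 ?nnegrE ?exprn_ge0 //.
  exact: logconvex_pow.
have cv : cvgn (fun n => u n.+1).
  by apply: nondecreasing_is_cvgn => //; exists 1 => _ [n _ <-].
have limE : limn u = limn (fun n => u n.+1).
  apply: cvg_lim => //; rewrite -cvg_shiftS; exact: cv.
case=> [|n]; first by rewrite muln0 expr0 a1.
have := nondecreasing_cvgn_le mono cv n; rewrite -limE => /le_trans /(_ hl) hu.
have -> : a n.+1 = u n.+1 ^+ (2 * n.+1).
  have n0 : (2 * n.+1)%:R != 0 :> R by rewrite pnatr_eq0.
  by rewrite /u -powR_mulrn ?powR_ge0 // -powRrM mulVf // powRr1.
have u0 : 0 <= u n.+1 by exact: powR_ge0.
by apply: lerXn2r; rewrite // nnegrE // (le_trans u0).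
Qed.

End Sequences.

(** * Norm of the adjacency operator of a transitive graph *)

Section Spectral.
Variables (V : countType) (nb : V -> seq V) (R : realType).
Hypothesis G : graph_ok nb.
Implicit Types (f g h : V -> R) (S : seq V).

Lemma nb_auto (phi : V -> V) x : bijective phi ->
  (forall u v, adj nb (phi u) (phi v) = adj nb u v) ->
  perm_eq (nb (phi x)) (map phi (nb x)).
Proof.
move=> [psi K1 K2] h; apply: uniq_perm.
- exact: nb_uniq.
- by rewrite map_inj_uniq ?nb_uniq //; exact: can_inj K1.
move=> y; rewrite -{1}(K2 y) -[_ \in nb (phi x)]/(adj nb _ _) h.
by rewrite -[in RHS](K2 y) (mem_map (can_inj K1)).
Qed.

Definition srw_op f x : R := \sum_(z <- nb x) (size (nb x))%:R^-1 * f z.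

Lemma srwE n x y : srw nb R n x y = iter n srw_op (fun z => (z == y)%:R) x.
Proof. by elim: n x => [//|n IH] x /=; apply: eq_bigr => z _; rewrite IH. Qed.

Lemma srw_auto (phi : V -> V) : bijective phi ->
  (forall u v, adj nb (phi u) (phi v) = adj nb u v) ->
  forall n x y, srw nb R n (phi x) (phi y) = srw nb R n x y.
Proof.
move=> bphi h; elim=> [|n IH] x y /=; first by rewrite (inj_eq (bij_inj bphi)).
rewrite (perm_big _ (nb_auto x bphi h)) big_map (perm_size (nb_auto x bphi h)).
by rewrite size_map; apply: eq_bigr => z _; rewrite IH.
Qed.

Hypothesis T : transitive_graph nb.

Lemma degree_const x y : size (nb x) = size (nb y).
Proof.
by have [f [bf hf <-]] := T x y; rewrite (perm_size (nb_auto x bf hf)) size_map.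
Qed.

Variable d : nat.
Hypothesis deg : forall x, size (nb x) = d.

Lemma srw_opE f : srw_op f = fun x => d%:R^-1 * adjop nb f x.
Proof. by apply/funext => x; rewrite /srw_op deg mulr_sumr. Qed.

Lemma fins_srw_op f : fins f -> fins (srw_op f).
Proof. by move=> hf; rewrite srw_opE; apply: finsZ; apply: fins_adjop. Qed.

Lemma fins_iter n f : fins f -> fins (iter n srw_op f).
Proof. by move=> hf; elim: n => //= n; exact: fins_srw_op. Qed.

Lemma srw_op_sym f g : fins f -> fins g -> ip (srw_op f) g = ip f (srw_op g).
Proof.
move=> hf hg; rewrite !srw_opE ipZl ?(ipC f) ?ipZl ?(ipC _ f) ?adjop_sym //;
 exact: fins_adjop.
Qed.

Lemma iter_sym n f g : fins f -> fins g ->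
  ip (iter n srw_op f) g = ip f (iter n srw_op g).
Proof.
move=> hf hg; elim: n g hg => [//|n IH] g hg.
by rewrite iterS srw_op_sym ?IH ?iterSr //; [exact: fins_srw_op|exact: fins_iter].
Qed.

Definition energy f n := ip (iter n srw_op f) (iter n srw_op f).

Lemma energyE f n : fins f -> energy f n = ip f (iter (2 * n) srw_op f).
Proof.
by move=> hf; rewrite /energy iter_sym -?iterD ?mul2n ?addnn //; exact: fins_iter.
Qed.

(** By self-adjointness, [energy f n.+1] is also the inner product of the iterates [n] and [n.+2];
    Cauchy-Schwarz applies. *)
Lemma energy_logconvex f n : fins f -> energy f n.+1 ^+ 2 <= energy f n * energy f n.+2.
Proof.
move=> hf; have -> : energy f n.+1 = ip (iter n srw_op f) (iter n.+2 srw_op f).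
  rewrite /energy {1}iterS srw_op_sym //; exact: fins_iter.
by apply: ip_CS; exact: fins_iter.
Qed.

Definition dirac_fun (y : V) : V -> R := fun z => (z == y)%:R.

Lemma fins_dirac y : fins (dirac_fun y).
Proof. by exists [:: y] => x; rewrite inE /dirac_fun => /negbTE ->. Qed.

Lemma ip_dirac y f : ip (dirac_fun y) f = f y.
Proof.
rewrite (ipE _ (S := [:: y])) //; first by rewrite big_seq1 /dirac_fun eqxx mul1r.
by move=> x; rewrite inE /dirac_fun => /negbTE ->.
Qed.

Lemma srw_le1 n x y : (0 < d)%N -> 0 <= srw nb R n x y <= 1.
Proof.
move=> d0; elim: n x => [|n IH] x /=; first by case: (x == y); rewrite ?lexx ler01.
rewrite deg; apply/andP; split.
  by apply: sumr_ge0 => z _; rewrite mulr_ge0 ?invr_ge0 //; have /andP[] := IH z.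
apply: (@le_trans _ _ (\sum_(z <- nb x) d%:R^-1)).
  by apply: ler_sum => z _; rewrite ler_piMr ?invr_ge0 //; have /andP[] := IH z.
by rewrite big_const_seq count_predT deg iter_addr_0 -[X in X <= _]mulr_natr mulVf // pnatr_eq0 -lt0n.
Qed.

Lemma energy_dirac n y : energy (dirac_fun y) n = srw nb R (2 * n) y y.
Proof. by rewrite energyE ?ip_dirac ?srwE //; exact: fins_dirac. Qed.

Variables (o : V) (rho : R).
Hypothesis srho : spectral_radius nb R o <= rho.
Hypothesis d0 : (0 < d)%N.

Lemma srw_return n y : srw nb R (2 * n) y y <= rho ^+ (2 * n).
Proof.
have [phi [bphi h <-]] := T o y; rewrite srw_auto //.
apply: (@logconvex_limn _ (fun n => srw nb R (2 * n) o o)) => //.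
- by move=> m; exact: srw_le1.
- by rewrite muln0 /= eqxx.
- by move=> m; rewrite -!energy_dirac; apply: energy_logconvex; exact: fins_dirac.
Qed.

Lemma rho_ge0 : 0 <= rho.
Proof.
apply: le_trans srho; rewrite /spectral_radius.
have [cv|ncv] := pselect (cvgn (fun n : nat => srw nb R (2 * n) o o `^ (2 * n)%:R^-1)); last first.
  (* Without convergence the limit is the default value, which is [0]. *)
  by rewrite dvgP.
by apply: limr_ge => //; near=> n; exact: powR_ge0.
Unshelve. all: by end_near.
Qed.

(** Cauchy-Schwarz for the [n]-th iterates of two Dirac functions, whose square norms are return
    probabilities. *)
Lemma srw_offdiag n x y : srw nb R (2 * n) x y <= rho ^+ (2 * n).
Proof.
have fin z := fins_iter n (fins_dirac z).
rewrite srwE -/(dirac_fun y) -ip_dirac mul2n -addnn iterD -iter_sym //; last exact: fins_dirac.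
apply: le_trans (ip_sqrt (fin x) (fin y)) _.
rewrite -/(energy (dirac_fun x) n) -/(energy (dirac_fun y) n) !energy_dirac addnn -mul2n.
apply: (@le_trans _ _ (Num.sqrt (rho ^+ (2 * n)) * Num.sqrt (rho ^+ (2 * n)))).
  by apply: ler_pM; rewrite ?sqrtr_ge0 // ler_wsqrtr // srw_return.
by rewrite -expr2 sqr_sqrtr // exprn_ge0 // rho_ge0.
Qed.

Lemma iter_srw_opE n f S x : uniq S -> supp f S ->
  iter n srw_op f x = \sum_(y <- S) f y * srw nb R n x y.
Proof.
move=> uS sf; elim: n x => [|n IH] x /=.
  have [xS|xS] := boolP (x \in S).
    rewrite (bigD1_seq x) //= eqxx mulr1 big1 ?addr0 // => y.
    by rewrite eq_sym => /negbTE ->; rewrite mulr0.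
  rewrite sf // big_seq big1 // => y yS.
  by rewrite eq_sym (negbTE (memPn xS _ yS)) mulr0.
transitivity (\sum_(z <- nb x) \sum_(y <- S) (size (nb x))%:R^-1 * (f y * srw nb R n z y)).
  by rewrite {1}/srw_op; apply: eq_bigr => z _; rewrite IH mulr_sumr.
rewrite exchange_big; apply: eq_bigr => y _ /=; rewrite mulr_sumr.
by apply: eq_bigr => z _; ring.
Qed.

Lemma energy_bound f : fins f -> exists C, forall n, energy f n <= C * (rho ^+ 2) ^+ n.
Proof.
move=> hf; have [S [uS sf]] := fins_uniq hf.
exists (\sum_(x <- S) \sum_(y <- S) `|f x| * `|f y|) => n.
rewrite energyE // (ipE _ uS sf) mulr_suml; apply: ler_sum => x _.
rewrite (iter_srw_opE _ _ uS sf) mulr_sumr mulr_suml; apply: ler_sum => y _.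
rewrite -exprM mulrA; apply: le_trans (ler_norm _) _.
rewrite !normrM ler_wpM2l ?mulr_ge0 ?normr_ge0 //.
have /andP[h _] := srw_le1 (2 * n) x y d0.
by rewrite ger0_norm // srw_offdiag.
Qed.

(** Return probabilities yield a norm bound without the spectral theorem: by log-convexity the
    energies grow at least like the powers of their first ratio, while [energy_bound] allows at most
    [(rho ^ 2) ^ n], up to a constant that may depend on [f]. *)
Lemma srw_op_contract f : fins f -> ip (srw_op f) (srw_op f) <= rho ^+ 2 * ip f f.
Proof.
move=> hf; have ge0 n : 0 <= energy f n by apply: ip_ge0; exact: fins_iter.
have [e0|e0] := eqVneq (energy f 0) 0.
  have := energy_logconvex 0 hf; rewrite e0 mul0r => h.
  have /eqP : energy f 1 ^+ 2 == 0 by rewrite eq_le h sqr_ge0.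
  move=> /eqP; rewrite sqrf_eq0 => /eqP e1.
  by rewrite -[X in X <= _]/(energy f 1) e1 -[ip f f]/(energy f 0) e0 mulr0.
have ep : 0 < energy f 0 by rewrite lt_def e0 ge0.
have [C hC] := energy_bound hf.
rewrite -ler_pdivrMr //.
have r0 : 0 <= ip (srw_op f) (srw_op f) / ip f f by apply: divr_ge0; [exact: (ge0 1%N)|exact: (ge0 0%N)].
have b0 : 0 <= rho ^+ 2 by rewrite exprn_ge0 // rho_ge0.
apply: (geometric_growth_le r0 b0 ep (C := C)) => n; apply: le_trans (hC n).
by apply: (logconvex_ratio (a := energy f)) => // m; exact: energy_logconvex.
Qed.

Theorem adjop_norm f : fins f ->
  ip (adjop nb f) (adjop nb f) <= (rho * d%:R) ^+ 2 * ip f f.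
Proof.
move=> hf; have := srw_op_contract hf; rewrite srw_opE.
have hA := fins_adjop G hf.
rewrite ipZl // ipC ipZl // mulrA => h.
have dp : 0 < d%:R :> R by rewrite ltr0n.
rewrite exprMn mulrAC -ler_pdivrMr ?exprn_gt0 //.
by apply: le_trans h; rewrite mulrC expr2 invfM.
Qed.

End Spectral.

(** * Degree at least three *)

Section Degree.
Variables (V : countType) (nb : V -> seq V) (R : realType).
Hypothesis G : graph_ok nb.

Lemma exists_notin (S : seq V) : exists x, x \notin S.
Proof.
case: G => _ _ _ _ inf; apply: contrapT => h; apply: inf.
apply: (@sub_finite_set _ _ [set` S]); last exact: finite_seq.
by move=> x _ /=; apply: contrapT => xS; apply: h; exists x; apply/negP.
Qed.

Lemma exists_boundary (S : seq V) x : x \in S ->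
  exists y z, [/\ y \in S, z \notin S & z \in nb y].
Proof.
move=> xS; have [w wS] := exists_notin S.
case: G => _ _ _ /(_ x w) [s [ps ls]] _.
elim: s x xS ps ls => [|y s IH] x xS /=; first by move=> _ xw; rewrite -xw xS in wS.
move=> /andP[xy ps] ls; have [yS|yS] := boolP (y \in S); first exact: (IH y).
by exists x, y.
Qed.

(** A set grown by one boundary vertex at a time spans at least [n] edges, each counted in both
    directions. *)
Lemma exists_connected_seq n : exists S : seq V, [/\ uniq S, size S = n.+1 &
  (2 * n)%:R <= \sum_(x <- S) \sum_(y <- S) (y \in nb x)%:R :> R].
Proof.
elim: n => [|n [S [uS sS hS]]].
  have [x _] := exists_notin [::]; exists [:: x]; split => //.
  by rewrite muln0; apply: sumr_ge0 => ? _; apply: sumr_ge0.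
have [x0 x0S] : exists x0, x0 \in S.
  by case: (S) sS => // x0 S' _; exists x0; exact: mem_head.
have [y [z [yS zS zy]]] := exists_boundary x0S.
exists (z :: S); split; [by rewrite /= zS|by rewrite /= sS|].
have -> : \sum_(x <- z :: S) \sum_(y0 <- z :: S) (y0 \in nb x)%:R =
    (z \in nb z)%:R + \sum_(y0 <- S) (y0 \in nb z)%:R +
    (\sum_(x <- S) (z \in nb x)%:R + \sum_(x <- S) \sum_(y0 <- S) (y0 \in nb x)%:R) :> R.
  rewrite big_cons big_cons; congr (_ + _); rewrite -big_split /=.
  by apply: eq_bigr => i _; rewrite big_cons.
rewrite mulnS natrD addrA; apply: lerD => //.
have h1 (F : V -> bool) : F y -> 1 <= \sum_(x <- S) (F x)%:R :> R.
  by move=> Fy; rewrite (bigD1_seq y) //= Fy lerDl; apply: sumr_ge0.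
have yz : y \in nb z by rewrite (adj_sym G).
have e1 := h1 (fun x => x \in nb z) yz.
have e2 := h1 (fun x => z \in nb x) zy.
by rewrite -addrA; apply: ler_wpDl => //; exact: (lerD e1 e2).
Qed.

Variables (d : nat) (rho : R).
Hypothesis rho01 : 0 <= rho < 1.
Hypothesis Anorm : forall f : V -> R, fins f ->
  ip (adjop nb f) (adjop nb f) <= (rho * d%:R) ^+ 2 * ip f f.

(** For degree at most [2], testing the norm on the indicator of a connected set of [n + 1] vertices
    would give [2 n <= 2 rho (n + 1)], false for large [n]. *)
Lemma degree_ge3 : (3 <= d)%N.
Proof.
rewrite leqNgt; apply/negP => d2; have {}d2 : d%:R <= 2 :> R by rewrite ler_nat -ltnS.
have /andP[r0 r1] := rho01.
have [n hn] : exists n : nat, (1 - rho)^-1 < n.+1%:R.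
  by exists (Num.truncn (1 - rho)^-1); exact: truncnS_gt.
have [S [uS sS hS]] := exists_connected_seq n.
pose f x : R := (x \in S)%:R.
have sf : supp f S by move=> x xS; rewrite /f (negbTE xS).
have ff : fins f by exists S.
have n0 : 0 < n.+1%:R :> R by rewrite ltr0n.
have ipff : ip f f = n.+1%:R.
  rewrite (ipE _ uS sf) big_seq (eq_bigr (fun=> 1)); last first.
    by move=> x xS; rewrite /f xS mulr1.
  by rewrite -big_seq big_const_seq count_predT iter_addr_0 sS.
have ipfA : (2 * n)%:R <= ip f (adjop nb f).
  apply: le_trans hS _; rewrite (ipE _ uS sf) big_seq [leRHS]big_seq.
  apply: ler_sum => x xS; rewrite {1}/f xS mul1r (adjopE G _ uS sf).
  rewrite big_seq [leRHS]big_seq; apply: ler_sum => y yS.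
  by rewrite /f yS mulr1.
have := ip_CS ff (fins_adjop G ff); rewrite ipff => h.
have {h} := le_trans h (ler_wpM2l (ltW n0) (Anorm ff)).
rewrite ipff => h.
have {}h : (2 * n)%:R ^+ 2 <= (rho * d%:R * n.+1%:R) ^+ 2.
  apply: (@le_trans _ _ (ip f (adjop nb f) ^+ 2)).
    by rewrite lerXn2r // nnegrE // (le_trans _ ipfA).
  by apply: le_trans h _; rewrite le_eqVlt; apply/orP; left; apply/eqP; ring.
have d0 : 0 <= d%:R :> R by [].
have {}h : (2 * n)%:R <= rho * d%:R * n.+1%:R.
  by rewrite -(ler_pXn2r (n := 2)) ?nnegrE ?mulr_ge0.
have h2 : rho * d%:R * n.+1%:R <= rho * 2 * n.+1%:R.
  by rewrite ler_wpM2r // ?ler_wpM2l // ltW.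
have h3 := le_trans h h2.
have h4 : (1 - rho) * n.+1%:R <= 1.
  move: h3; rewrite natrM -natr1; set N := n%:R.
  by move=> h3; lra.
have r1' : 0 < 1 - rho by rewrite subr_gt0.
by move: h4; rewrite mulrC -ler_pdivlMr // mul1r leNgt hn.
Qed.

End Degree.

(** * Non-backtracking walks *)

Section Nonbacktracking.
Variables (V : countType) (nb : V -> seq V) (R : realType).
Hypothesis G : graph_ok nb.
Implicit Types (f g h : V -> R) (S : seq V).

(* Sum of [f] over the endpoints of the non-backtracking walks that start with the
   step [u v] and make [m] further steps. *)
Fixpoint nbsum f m (u v : V) : R :=
  if m is m'.+1 then \sum_(w <- nb v | w != u) nbsum f m' v w else f v.

Definition nbop f n x : R :=
  if n is n'.+1 then \sum_(y <- nb x) nbsum f n' x y else f x.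

Lemma nbsumS f m u v : u \in nb v -> nbsum f m.+1 u v = nbop f m.+1 v - nbsum f m v u.
Proof.
move=> uv; rewrite /= [in RHS](bigD1_seq u) //= ?(nb_uniq G) //.
by rewrite addrAC subrr add0r.
Qed.

Variables (q : nat).
Hypothesis deg : forall x, size (nb x) = q.+1.

Lemma nbop1 f : nbop f 1 = adjop nb f.
Proof. by []. Qed.

Lemma nbop2 f x : nbop f 2 x = adjop nb (nbop f 1) x - q.+1%:R * f x.
Proof.
rewrite /nbop -/(nbop f 1) /adjop.
transitivity (\sum_(y <- nb x) (nbop f 1 y - f x)).
  by apply: eq_big_seq => y yx; rewrite nbsumS // (adj_sym G).
by rewrite sumrB big_const_seq count_predT deg iter_addr_0 mulr_natl.
Qed.

(** Walks that step to [y] and return at once to [x] must be removed. Summed over [y], a walk from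
    [x] is removed for every [y] except its own first step, hence [q] times. For two steps nothing
    follows the return, whence the [q.+1] in [nbop2]. *)
Lemma nbopSS f n x : nbop f n.+3 x = adjop nb (nbop f n.+2) x - q%:R * nbop f n.+1 x.
Proof.
rewrite [LHS]/nbop.
transitivity (\sum_(y <- nb x) (nbop f n.+2 y - (nbop f n.+1 x - nbsum f n x y))).
  apply: eq_big_seq => y yx; rewrite nbsumS //; last by rewrite (adj_sym G).
  by congr (_ - _); rewrite nbsumS.
rewrite sumrB sumrB; congr (_ - _).
rewrite big_const_seq count_predT deg iter_addr_0 -/(nbop f n.+1 x).
by rewrite mulrS addrAC subrr add0r mulr_natl.
Qed.

Lemma fins_nbop f n : fins f -> fins (nbop f n).
Proof.
move=> hf; case: n => [//|n].
elim/ltn_ind: n => -[|[|n]] IH.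
- exact: fins_adjop.
- rewrite (_ : nbop f 2 = fun x => adjop nb (nbop f 1) x + (- q.+1%:R) * f x).
    by apply: finsD; [apply: fins_adjop => //; exact: (IH 0%N)|exact: finsZ].
  by apply/funext => x; rewrite nbop2 mulNr.
- rewrite (_ : nbop f n.+3 = fun x => adjop nb (nbop f n.+2) x + (- q%:R) * nbop f n.+1 x).
    by apply: finsD; [apply: fins_adjop => //; exact: IH|apply: finsZ; apply: IH].
  by apply/funext => x; rewrite nbopSS mulNr.
Qed.

(* The recursion [v_(n+2) = A v_(n+1) - q v_n] multiplies this quadratic form by [q] at
   each step, which bounds [v_n] without any functional calculus for [A]. *)
Definition nbform f n := ip (nbop f n.+1) (nbop f n.+1)
  - ip (nbop f n.+1) (adjop nb (nbop f n)) + q%:R * ip (nbop f n) (nbop f n).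

Lemma nbform1 f : fins f ->
  nbform f 1 = q.+1%:R ^+ 2 * ip f f - ip (adjop nb f) (adjop nb f).
Proof.
move=> hf; rewrite /nbform.
have fA := fins_adjop G hf; have fAA := fins_adjop G fA.
have E : nbop f 2 = fun x => adjop nb (adjop nb f) x + (- q.+1%:R) * f x.
  by apply/funext => x; rewrite nbop2 mulNr nbop1.
have fz := finsZ (- q.+1%:R) hf.
rewrite nbop1 E !(ip_linl _ _ fAA hf) !(ip_linr _ _ fAA hf).
rewrite (ipC f) !(adjop_sym G fA hf) -natr1; ring.
Qed.

Lemma nbformS f n : fins f -> nbform f n.+2 = q%:R * nbform f n.+1.
Proof.
move=> hf; rewrite /nbform.
have fn := fins_nbop n.+1 hf; have fn1 := fins_nbop n.+2 hf.
have fA := fins_adjop G fn1; have fz := finsZ (- q%:R) fn.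
have E : nbop f n.+3 = fun x => adjop nb (nbop f n.+2) x + (- q%:R) * nbop f n.+1 x.
  by apply/funext => x; rewrite nbopSS mulNr.
rewrite E !(ip_linl _ _ fA fn) !(ip_linr _ _ fA fn).
by rewrite (ipC (nbop f n.+1) (adjop nb _)) !(adjop_sym G fn1 fn); ring.
Qed.

End Nonbacktracking.

(** * Norm of the non-backtracking operators *)

Section NonbacktrackingNorm.
Variables (V : countType) (nb : V -> seq V) (R : realType).
Hypothesis G : graph_ok nb.
Implicit Types (f g h : V -> R) (S : seq V).

Definition nrm f : R := Num.sqrt (ip f f).

Lemma nrm_ge0 f : 0 <= nrm f.
Proof. exact: sqrtr_ge0. Qed.

Lemma sqr_nrm f : fins f -> nrm f ^+ 2 = ip f f.
Proof. by move=> hf; rewrite sqr_sqrtr // ip_ge0. Qed.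

Variables (q : nat) (t : R).
Hypothesis deg : forall x, size (nb x) = q.+1.
Hypothesis q2 : (2 <= q)%N.
Hypothesis t01 : 9 / 10 <= t < 1.
Hypothesis Anorm : forall f, fins f ->
  ip (adjop nb f) (adjop nb f) <= (t * q.+1%:R) ^+ 2 * ip f f.

(* The roots of [X^2 - (t q + 1/t) X + q] are [t q] and [1/t]. *)
Lemma quadratic_growth (x y E : R) : 0 <= y -> 0 <= E ->
  x ^+ 2 + q%:R * y ^+ 2 <= t * q.+1%:R * x * y + E ^+ 2 -> 0 <= x ->
  x <= t * q%:R * y + E.
Proof.
move=> y0 E0 h x0; rewrite leNgt; apply/negP => hx.
have /andP[t9 t1] := t01.
have t0 : 0 < t by lra.
have tu : t * t^-1 = 1 by rewrite divff // gt_eqF.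
have u0 : 0 < t^-1 by rewrite invr_gt0.
have u1 : 1 <= t^-1 by rewrite invf_ge1 // ltW.
have q2' : 2 <= q%:R :> R by rewrite ler_nat.
(* Since [t^2 q >= 1], the larger root is [t q]; for [x > t q y + E] both linear factors exceed
   [E]. *)
have utq : t^-1 <= t * q%:R.
  have e : t^-1 * (t * (t * q%:R)) = t * q%:R by rewrite mulKf // gt_eqF.
  have h2 : t^-1 * 1 <= t^-1 * (t * (t * q%:R)) by rewrite ler_pM2l //; nra.
  by rewrite e mulr1 in h2.
have hx1 : E < x - t * q%:R * y by rewrite ltrBrDl.
have hx2 : E < x - t^-1 * y.
  by apply: lt_le_trans hx1 _; rewrite lerD2l lerN2 ler_wpM2r.
have : E * E < (x - t * q%:R * y) * (x - t^-1 * y) by apply: ltr_pM.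
have -> : (x - t * q%:R * y) * (x - t^-1 * y) =
  x ^+ 2 + q%:R * y ^+ 2 - (t * q%:R + t^-1) * x * y.
  rewrite -[q%:R * y ^+ 2]mul1r -tu; ring.
rewrite -expr2.
have : t * q.+1%:R * x * y <= (t * q%:R + t^-1) * x * y.
  rewrite -(mulrA (t * _)) -(mulrA (_ + _)) ler_wpM2r ?mulr_ge0 // -natr1 mulrDr mulr1 lerD2l.
  by apply: le_trans u1; exact: ltW.
by move=> h1; rewrite ltrBrDr => h2; move: (lt_le_trans h2 h); lra.
Qed.

Lemma adjop_nrm f : fins f -> nrm (adjop nb f) <= t * q.+1%:R * nrm f.
Proof.
move=> hf; have /andP[t9 t1] := t01.
have tq : 0 <= t * q.+1%:R by rewrite mulr_ge0 //; lra.
have tqf := mulr_ge0 tq (nrm_ge0 f).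
rewrite -(ler_pXn2r (n := 2)) ?nnegrE ?nrm_ge0 // exprMn !sqr_nrm //; first exact: Anorm.
exact: fins_adjop.
Qed.

Lemma nbformE f n : fins f ->
  nbform nb q f n.+1 = q%:R ^+ n * (q.+1%:R ^+ 2 * ip f f - ip (adjop nb f) (adjop nb f)).
Proof.
move=> hf; elim: n => [|n IH]; first by rewrite expr0 mul1r (nbform1 G deg).
by rewrite (nbformS G deg) // IH mulrA -exprS.
Qed.

(** The conserved form gives the hypothesis of [quadratic_growth], where [E^2] must dominate
    [q^n (q + 1)^2 |f|^2]. Here [q + 1 <= (3/2) q], and [q <= ((4/5) t q)^2] because [t >= 9/10] and
    [q >= 2]. *)
Lemma nbop_step f n : fins f ->
  nrm (nbop nb f n.+2) <= t * q%:R * nrm (nbop nb f n.+1) + 3 / 2 * (4 / 5 * t * q%:R) ^+ n.+2 * nrm f.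
Proof.
move=> hf; have fn m := fins_nbop G deg m hf.
have /andP[t9 t1] := t01.
have q2' : 2 <= q%:R :> R by rewrite ler_nat.
have b0 : 0 <= 4 / 5 * t * q%:R by rewrite !mulr_ge0 //; lra.
have E0 : 0 <= 3 / 2 * (4 / 5 * t * q%:R) ^+ n.+2 * nrm f.
  by rewrite mulr_ge0 ?nrm_ge0 // mulr_ge0 ?exprn_ge0 //; lra.
apply: quadratic_growth (nrm_ge0 _) E0 _ (nrm_ge0 _).
rewrite !(sqr_nrm (fn _)).
have hf2 := nbformE n hf; rewrite /nbform in hf2.
have hc : ip (nbop nb f n.+2) (adjop nb (nbop nb f n.+1)) <=
    t * q.+1%:R * nrm (nbop nb f n.+2) * nrm (nbop nb f n.+1).
  apply: le_trans (ip_sqrt _ _) _ => //; first exact: fins_adjop.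
  rewrite -!/(nrm _) mulrAC mulrC ler_wpM2r ?nrm_ge0 //.
  exact: adjop_nrm.
have hA := ip_ge0 (fins_adjop G hf).
rewrite -lerBlDl; apply: (@le_trans _ _ (nbform nb q f n.+1)).
  by rewrite /nbform; lra.
rewrite nbformE // (exprMn 2 _ (nrm f)) (exprMn 2 (3 / 2)) sqr_nrm //.
rewrite -(exprM _ n.+2) mulnC exprM.
apply: (@le_trans _ _ (q%:R ^+ n * (q.+1%:R ^+ 2 * ip f f))).
  by rewrite ler_wpM2l ?exprn_ge0 // lerBlDr lerDl.
rewrite mulrA ler_wpM2r ?ip_ge0 //.
have hq : q%:R <= (4 / 5 * t * q%:R) ^+ 2.
  rewrite exprMn expr2; set T := 4 / 5 * t.
  have hT : 1 <= (T * T) * 2 by rewrite /T; nra.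
  by rewrite expr2 mulrA ler_peMl //; nra.
have hqn : q%:R ^+ n.+2 <= ((4 / 5 * t * q%:R) ^+ 2) ^+ n.+2.
  by apply: lerXn2r; rewrite ?nnegrE ?exprn_ge0.
apply: (@le_trans _ _ ((3 / 2) ^+ 2 * q%:R ^+ n.+2)); last by rewrite ler_wpM2l // exprn_ge0 //; lra.
have -> : q%:R ^+ n.+2 = q%:R ^+ n * q%:R ^+ 2 :> R by rewrite -exprD addn2.
rewrite [leRHS]mulrCA ler_wpM2l ?exprn_ge0 // -exprMn ler_pXn2r ?nnegrE ?mulr_ge0 //.
  by rewrite -natr1; lra.
Qed.

Theorem nbop_nrm f n : fins f -> nrm (nbop nb f n) <= 8 * (t * q%:R) ^+ n * nrm f.
Proof.
move=> hf; have /andP[t9 t1] := t01.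
have q2' : 2 <= q%:R :> R by rewrite ler_nat.
have f0 := nrm_ge0 f; have tq0 : 0 <= t * q%:R by rewrite mulr_ge0 //; lra.
case: n => [|n]; first by rewrite expr0 mulr1 /=; lra.
(* The factor is [3/2] times the sum of [(4/5)^i] over [i <= n]: relative to the powers of [t q],
   the errors of [nbop_step] form a geometric series. *)
suff : nrm (nbop nb f n.+1) <= 15 / 2 * (1 - (4 / 5) ^+ n.+1) * ((t * q%:R) ^+ n.+1 * nrm f).
  move/le_trans; apply; rewrite -[leRHS]mulrA ler_wpM2r ?mulr_ge0 ?exprn_ge0 //.
  have : 0 <= (4 / 5) ^+ n.+1 :> R by rewrite exprn_ge0 //; lra.
  lra.
elim: n => [|n IH].
  rewrite nbop1; apply: le_trans (adjop_nrm hf) _.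
  rewrite !expr1 mulrA ler_wpM2r //.
  by rewrite -natr1; nra.
apply: le_trans (nbop_step n hf) _.
apply: le_trans (lerD (ler_wpM2l tq0 IH) (lexx _)) _.
have -> : (4 / 5 * t * q%:R) ^+ n.+2 =
    4 / 5 * (4 / 5) ^+ n.+1 * (t * q%:R * (t * q%:R) ^+ n.+1) :> R.
  by rewrite -!exprS -exprMn mulrA.
rewrite (exprS (4 / 5) n.+1) (exprS (t * q%:R) n.+1).
set X := (t * q%:R) ^+ n.+1; set F := nrm f; set Y := (4 / 5) ^+ n.+1.
have Y0 : 0 <= Y by rewrite exprn_ge0 //; lra.
have -> : t * q%:R * (15 / 2 * (1 - Y) * (X * F)) + 3 / 2 * (4 / 5 * Y * (t * q%:R * X)) * F =
  (15 / 2 * (1 - Y) + 6 / 5 * Y) * (t * q%:R * X * F) by field.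
rewrite ler_wpM2r ?mulr_ge0 ?exprn_ge0 //; lra.
Qed.

End NonbacktrackingNorm.

(** * Walks escaping from a finite set *)

Section Escape.
Variables (V : countType) (nb : V -> seq V) (R : realType).
Hypothesis G : graph_ok nb.
Variable T : seq V.

(* Number of non-backtracking walks that start with the step [u v], make [m] further
   steps and avoid [T] from [v] on. *)
Fixpoint esc m (u v : V) : R :=
  if m is m'.+1 then
    if v \in T then 0 else \sum_(w <- nb v | w != u) esc m' v w
  else (v \notin T)%:R.

Definition exits m x : R := if m is m'.+1 then \sum_(y <- nb x) esc m' x y else 1.

Definition exitsT m x : R := (x \in T)%:R * exits m x.

Variables (q : nat) (t : R).
Hypothesis deg : forall x, size (nb x) = q.+1.
Hypothesis q2 : (2 <= q)%N.

Lemma esc_ge0 m u v : 0 <= esc m u v.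
Proof.
elim: m u v => [|m IH] u v /=; first by case: (_ \notin _).
by case: ifP => // _; apply: sumr_ge0.
Qed.

Lemma exits_ge0 m x : 0 <= exits m x.
Proof. by case: m => [|m] //=; apply: sumr_ge0 => y _; exact: esc_ge0. Qed.

Lemma sum_forward u v : u \in nb v -> \sum_(w <- nb v | w != u) 1 = q%:R :> R.
Proof.
move=> uv; have := deg v; rewrite -[RHS]add1n => /(congr1 (fun n => n%:R : R)).
rewrite -sum1_size natr_sum (bigD1_seq u) ?(nb_uniq G) //= natrD => /addrI <-.
by [].
Qed.

Lemma forward_le u v (F : V -> R) c : u \in nb v ->
  (forall w, w \in nb v -> F w <= c) -> \sum_(w <- nb v | w != u) F w <= q%:R * c.
Proof.
move=> uv h; rewrite -(sum_forward uv) mulr_suml big_seq_cond [leRHS]big_seq_cond.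
by apply: ler_sum => w /andP[wv _]; rewrite mul1r h.
Qed.

Lemma escS_le m u v : u \in nb v -> esc m.+1 u v <= q%:R * esc m u v.
Proof.
elim: m u v => [|m IH] u v uv.
  rewrite /=; case: ifP => vT; first by rewrite mulr0.
  rewrite -[(~~ false)%:R]/(1 : R).
  by apply: forward_le => // w _; case: (w \notin T).
rewrite [esc m.+2 u v]/= [esc m.+1 u v in leRHS]/=; case: ifP => _; first by rewrite mulr0.
rewrite mulr_sumr big_seq_cond [leRHS]big_seq_cond; apply: ler_sum => w /andP[wv _].
by apply: IH; rewrite (adj_sym G).
Qed.

Lemma esc_le m u v : u \in nb v -> esc m u v <= q%:R ^+ m.
Proof.
move=> uv; elim: m => [|m IH]; first by rewrite /= expr0; case: (_ \notin _).
by apply: le_trans (escS_le m uv) _; rewrite exprS ler_wpM2l.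
Qed.

(** Each later step has at most [q] choices; the factor [3/2] pays for a first step, which has up to
    [q + 1]. *)
Lemma exits_le i j x : exits (i + j) x <= 3 / 2 * q%:R ^+ j * exits i x.
Proof.
have q2' : 2 <= q%:R :> R by rewrite ler_nat.
have step m : exits m.+2 x <= q%:R * exits m.+1 x.
  rewrite /= mulr_sumr big_seq [leRHS]big_seq; apply: ler_sum => y yx.
  by apply: escS_le; rewrite (adj_sym G).
have step2 m k : exits (m.+1 + k) x <= q%:R ^+ k * exits m.+1 x.
  elim: k => [|k IH]; first by rewrite addn0 expr0 mul1r.
  rewrite addnS; apply: le_trans (step (m + k)%N) _.
  by rewrite exprS -mulrA ler_wpM2l.
case: i => [|i]; last first.
  apply: le_trans (step2 i j) _; rewrite -[leRHS]mulrA.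
  have : 0 <= q%:R ^+ j * exits i.+1 x by rewrite mulr_ge0 ?exprn_ge0 ?exits_ge0.
  lra.
rewrite add0n [exits 0 x]/=; case: j => [|j]; first by rewrite /= expr0; lra.
rewrite mulr1 -[j.+1]add1n; apply: le_trans (step2 0%N j) _.
rewrite exprD expr1 mulrCA mulrA mulrC ler_wpM2r ?exprn_ge0 //.
apply: (@le_trans _ _ q.+1%:R); last by rewrite -natr1; lra.
rewrite /= -(deg x) -sum1_size natr_sum; apply: ler_sum => y _.
by case: (_ \notin _).
Qed.

(* Decomposition of a walk at its last visit to [T]. *)
Lemma last_exit_edge m u v : u \in nb v ->
  q%:R ^+ m <= esc m u v + \sum_(j < m.+1) nbsum nb (exitsT (m - j)) j u v.
Proof.
elim: m u v => [|m IH] u v uv.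
  by rewrite big_ord1 /= expr0 /exitsT mulr1; case: (v \in T); rewrite ?addr0 ?add0r.
rewrite big_ord_recl subn0 [nbsum _ _ _ _ _]/=.
apply: (@le_trans _ _ (\sum_(w <- nb v | w != u) esc m v w +
   \sum_(j < m.+1) nbsum nb (exitsT (m - j)) j.+1 u v)).
  have -> : \sum_(j < m.+1) nbsum nb (exitsT (m - j)) j.+1 u v =
     \sum_(w <- nb v | w != u) \sum_(j < m.+1) nbsum nb (exitsT (m - j)) j v w.
    by rewrite exchange_big.
  rewrite -big_split /= exprS -[X in X * _](sum_forward uv) mulr_suml.
  rewrite big_seq_cond [leRHS]big_seq_cond.
  by apply: ler_sum => w /andP[wv _]; rewrite mul1r IH // (adj_sym G).
rewrite addrA; apply: lerD.
  (* [exits] forgets the step by which [v] was reached and also counts walks going back to [u], so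
     only an inequality holds. *)
  rewrite /exitsT [esc m.+1 u v]/=; case: (v \in T); rewrite ?mul0r ?addr0 // add0r mul1r /=.
  by rewrite [leRHS](bigID (fun w => w != u)) /= lerDl; apply: sumr_ge0 => *; exact: esc_ge0.
by apply: ler_sum => j _.
Qed.

(** The left side counts all non-backtracking walks of [m + 1] steps from [z]; as [z] is in [T],
    each of them has a last visit. *)
Lemma last_exit m z : z \in T ->
  q.+1%:R * q%:R ^+ m <= \sum_(j < m.+2) nbop nb (exitsT (m.+1 - j)) j z.
Proof.
move=> zT; rewrite big_ord_recl subn0 [nbop _ _ _ _]/= /exitsT zT mul1r [exits _ _]/=.
have -> : \sum_(i < m.+1) nbop nb (fun x => (x \in T)%:R * exits (m.+1 - lift ord0 i) x) (lift ord0 i) z =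
   \sum_(y <- nb z) \sum_(i < m.+1) nbsum nb (exitsT (m - i)) i z y.
  by rewrite exchange_big.
rewrite -big_split /= -(deg z) -sum1_size natr_sum mulr_suml big_seq [leRHS]big_seq.
by apply: ler_sum => y yz; rewrite mul1r last_exit_edge // (adj_sym G).
Qed.

Hypothesis t01 : 9 / 10 <= t < 1.
Hypothesis Anorm : forall f : V -> R, fins f ->
  ip (adjop nb f) (adjop nb f) <= (t * q.+1%:R) ^+ 2 * ip f f.
Hypothesis uT : uniq T.

Lemma supp_exitsT m : supp (exitsT m) T.
Proof. by move=> x xT; rewrite /exitsT (negbTE xT) mul0r. Qed.

Lemma fins_exitsT m : fins (exitsT m).
Proof. by exists T; exact: supp_exitsT. Qed.

Lemma ip_exitsT m : ip (exitsT m) (exitsT m) = \sum_(x <- T) exits m x ^+ 2.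
Proof.
rewrite (ipE _ uT (@supp_exitsT m)) big_seq [RHS]big_seq; apply: eq_bigr => x xT.
by rewrite /exitsT xT mul1r expr2.
Qed.

Lemma nrm_exitsT0 : nrm (exitsT 0) ^+ 2 = (size T)%:R.
Proof.
rewrite sqr_nrm ?ip_exitsT; last exact: fins_exitsT.
by rewrite -sum1_size natr_sum; apply: eq_bigr => x _; rewrite expr1n.
Qed.

Lemma nrm_exitsT_le i j : nrm (exitsT (i + j)) <= 3 / 2 * q%:R ^+ j * nrm (exitsT i).
Proof.
have c0 : 0 <= 3 / 2 * q%:R ^+ j :> R by rewrite mulr_ge0 ?exprn_ge0 //; lra.
have cn := mulr_ge0 c0 (nrm_ge0 (exitsT i)).
rewrite -(ler_pXn2r (n := 2)) ?nnegrE ?nrm_ge0 //.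
rewrite exprMn !(sqr_nrm (fins_exitsT _)) !ip_exitsT mulr_sumr.
apply: ler_sum => x _; rewrite -exprMn ler_pXn2r ?nnegrE ?mulr_ge0 ?exits_ge0 //.
exact: exits_le.
Qed.

Lemma sum_nbop j g : fins g ->
  \sum_(z <- T) nbop nb g j z <= nrm (exitsT 0) * (8 * (t * q%:R) ^+ j * nrm g).
Proof.
move=> fg; have -> : \sum_(z <- T) nbop nb g j z = ip (exitsT 0) (nbop nb g j).
  rewrite (ipE _ uT (@supp_exitsT 0)) big_seq [RHS]big_seq; apply: eq_bigr => x xT.
  by rewrite /exitsT xT mulr1 mul1r.
apply: le_trans (ip_sqrt (fins_exitsT 0) (fins_nbop G deg j fg)) _.
by rewrite ler_wpM2l ?sqrtr_ge0 // (nbop_nrm G deg).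
Qed.

Lemma geometric_sum_le n : \sum_(j < n) t ^+ j <= (1 - t)^-1.
Proof.
have /andP[t9 t1] := t01.
have d0 : 0 < 1 - t by lra.
rewrite -(ler_pM2l d0) mulfV ?gt_eqF //.
have -> : (1 - t) * \sum_(j < n) t ^+ j = 1 - t ^+ n.
  by rewrite -opprB mulNr -subrX1 opprB.
by rewrite lerBlDr lerDl exprn_ge0 //; lra.
Qed.

(* Summing the last-exit decomposition of the walks of length [k + J] over [T], the
   norm bound makes last visits after time [J] negligible, for [J] depending on [t]
   only; the others are controlled by [exitsT k.+1] in [l^2]. *)
Definition escape_const : R := 2 / 3 * ((1 - t) / 24) ^+ 2.

Lemma exits_lower k : escape_const * (size T)%:R * q%:R ^+ k.+1 <=
  \sum_(x <- T) exits k.+1 x.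
Proof.
have /andP[t9 t1] := t01.
have d0 : 0 < 1 - t by lra.
have tpos : 0 < t by lra.
have q2' : 2 <= q%:R :> R by rewrite ler_nat.
have q0 : 0 < q%:R :> R by lra.
(* [12 = 8 * 3/2] combines the constants of [nbop_nrm] and [exits_le]. This [J] makes the
   contribution of last visits after time [J] at most half of the total. *)
have [J hJ] : exists J, t ^+ J < (1 - t) / 24 / t.
  apply: expr_small; first by rewrite ltW.
  by rewrite !divr_gt0.
have {}hJ : 12 * t ^+ J.+1 / (1 - t) <= 1 / 2.
  rewrite ler_pdivrMr // exprS; move: hJ; rewrite ltr_pdivlMr // mulrC => hJ; lra.
set s := nrm (exitsT 0); set F := nrm (exitsT k.+1).
have s0 : 0 <= s := nrm_ge0 _; have F0 : 0 <= F := nrm_ge0 _.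
have sE : s ^+ 2 = (size T)%:R := nrm_exitsT0.
set n := (k + J)%N.
have tq0 : 0 <= t * q%:R by rewrite mulr_ge0 // ltW.
have total : s ^+ 2 * (q.+1%:R * q%:R ^+ n) <=
    \sum_(j < n.+2) s * (8 * (t * q%:R) ^+ j * nrm (exitsT (n.+1 - j))).
  rewrite sE -sum1_size natr_sum mulr_suml.
  apply: (@le_trans _ _ (\sum_(z <- T) \sum_(j < n.+2) nbop nb (exitsT (n.+1 - j)) j z)).
    by rewrite big_seq [leRHS]big_seq; apply: ler_sum => z zT; rewrite mul1r last_exit.
  by rewrite exchange_big; apply: ler_sum => j _; apply: sum_nbop; exact: fins_exitsT.
have {total} : s ^+ 2 * q%:R ^+ n.+1 <=
    12 * s * q%:R ^+ J * F * (1 - t)^-1 + 12 * s ^+ 2 * q%:R ^+ n.+1 * t ^+ J.+1 * (1 - t)^-1.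
  apply: (@le_trans _ _ (s ^+ 2 * (q.+1%:R * q%:R ^+ n))).
    by rewrite ler_wpM2l ?sqr_ge0 // exprS ler_wpM2r ?exprn_ge0 // ler_nat.
  apply: (le_trans total).
  (* Last visits up to time [J] leave at least [k + 1] steps and are compared with [exitsT k.+1];
     later ones are compared with [exitsT 0], the indicator of [T]. *)
  rewrite (_ : n.+2 = J.+1 + k.+1)%N; last by rewrite /n addSn addnS addnC.
  rewrite big_split_ord /=; apply: lerD.
    apply: (@le_trans _ _ (12 * s * q%:R ^+ J * F * \sum_(j < J.+1) t ^+ j)); last first.
      by rewrite ler_wpM2l ?geometric_sum_le // !mulr_ge0 ?exprn_ge0.
    rewrite mulr_sumr; apply: ler_sum => j _.
    have jJ : (j <= J)%N by rewrite -ltnS.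
    have -> : (n.+1 - j = k.+1 + (J - j))%N by rewrite /n -addSn addnBA.
    apply: (@le_trans _ _ (s * (8 * (t * q%:R) ^+ j * (3 / 2 * q%:R ^+ (J - j) * F)))).
      rewrite ler_wpM2l // ler_wpM2l ?nrm_exitsT_le // mulr_ge0 ?exprn_ge0 //.
    have -> : q%:R ^+ J = q%:R ^+ j * q%:R ^+ (J - j) :> R by rewrite -exprD subnKC.
    by rewrite exprMn; lra.
  apply: (@le_trans _ _ (12 * s ^+ 2 * q%:R ^+ n.+1 * t ^+ J.+1 * \sum_(j < k.+1) t ^+ j)); last first.
    by rewrite ler_wpM2l ?geometric_sum_le // !mulr_ge0 ?exprn_ge0 // ltW.
  rewrite mulr_sumr; apply: ler_sum => j _.
  have jk : (J.+1 + j <= n.+1)%N by rewrite /n -addSn addSn ltnS addnC leq_add2r -ltnS.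
  have h := nrm_exitsT_le 0 (n.+1 - (J.+1 + j)).
  rewrite add0n -/s in h.
  apply: (@le_trans _ _ (s * (8 * (t * q%:R) ^+ (J.+1 + j) * (3 / 2 * q%:R ^+ (n.+1 - (J.+1 + j)) * s)))).
    by rewrite ler_wpM2l // ler_wpM2l // mulr_ge0 ?exprn_ge0.
  have -> : q%:R ^+ n.+1 = q%:R ^+ (J.+1 + j) * q%:R ^+ (n.+1 - (J.+1 + j)) :> R.
    by rewrite -exprD subnKC.
  by rewrite exprMn (exprD t); lra.
move=> h.
have h2 : s ^+ 2 * q%:R ^+ n.+1 <= 24 * s * q%:R ^+ J * F / (1 - t).
  set X := s ^+ 2 * q%:R ^+ n.+1 in h *.
  have X0 : 0 <= X by rewrite mulr_ge0 ?exprn_ge0.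
  have : X * (12 * t ^+ J.+1 / (1 - t)) <= X * (1 / 2) by rewrite ler_wpM2l.
  rewrite /X in h * => h3; lra.
have h4 : (1 - t) / 24 * s * q%:R ^+ k.+1 <= F.
  have [s00|sn0] := eqVneq s 0; first by rewrite s00 mulr0 mul0r.
  have sp : 0 < s by rewrite lt_def sn0.
  have qJ : 0 < q%:R ^+ J :> R by rewrite exprn_gt0.
  rewrite -(ler_pM2r (mulr_gt0 sp qJ)).
  move: h2; rewrite ler_pdivlMr // /n -addSn exprD => h2; lra.
(* From square norm back to a sum: each [exits k.+1 x] is at most [3/2 q^(k+1)]. *)
have h5 : F ^+ 2 <= 3 / 2 * q%:R ^+ k.+1 * \sum_(x <- T) exits k.+1 x.
  rewrite sqr_nrm ?ip_exitsT; last exact: fins_exitsT.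
  rewrite mulr_sumr; apply: ler_sum => x _; rewrite expr2 ler_wpM2r ?exits_ge0 //.
  by have := exits_le 0 k.+1 x; rewrite add0n mulr1.
have qk : 0 < q%:R ^+ k.+1 :> R by rewrite exprn_gt0.
have h6 : ((1 - t) / 24 * s * q%:R ^+ k.+1) ^+ 2 <= F ^+ 2.
  by rewrite ler_pXn2r ?nnegrE // !mulr_ge0 // ltW.
have h7 := le_trans h6 h5.
have c3 : 0 < 3 / 2 * q%:R ^+ k.+1 :> R by rewrite mulr_gt0 //; lra.
rewrite -(ler_pM2l c3); apply: le_trans h7.
by rewrite !(exprMn 2) sE /escape_const; lra.
Qed.


End Escape.

(** * Exploration of clusters *)

Section Girth.
Variables (V : countType) (nb : V -> seq V).
Hypothesis G : graph_ok nb.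

Fixpoint nbwalk (s : seq V) : bool :=
  if s is a :: s1 then
    if s1 is b :: s2 then
      [&& b \in nb a, (if s2 is c :: _ then a != c else true) & nbwalk s1]
    else true
  else true.

Lemma nbwalk_cat s1 a b s2 :
  nbwalk (s1 ++ a :: b :: s2) = nbwalk (s1 ++ [:: a; b]) && nbwalk (a :: b :: s2).
Proof.
elim: s1 => [|x [|y [|z s1]] IH].
- by rewrite /=; case: (b \in nb a); case: s2.
- by rewrite /=; case: (b \in nb a); rewrite /= ?andbF ?andbT -?andbA.
- by rewrite /=; case: (b \in nb a); rewrite /= ?andbF ?andbT -?andbA.
- rewrite -[LHS]/([&& y \in nb x, x != z & nbwalk ((y :: z :: s1) ++ a :: b :: s2)]).
  rewrite -[nbwalk ([:: x, y, z & s1] ++ [:: a; b])]/([&& y \in nb x, x != z &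
    nbwalk ((y :: z :: s1) ++ [:: a; b])]).
  by rewrite IH !andbA.
Qed.

Lemma nbwalk_behead a s : nbwalk (a :: s) -> nbwalk s.
Proof. by case: s => //= b s /and3P[]. Qed.

Lemma nbwalk_rev s : nbwalk (rev s) = nbwalk s.
Proof.
elim: s => [//|a [//|b [|c s]] IH]; first by rewrite /= (adj_sym G).
have revE (x y : V) l : rev (x :: y :: l) = rev l ++ [:: y; x].
  by rewrite !rev_cons -!cats1 -catA.
rewrite rev_cons revE -cats1 -catA nbwalk_cat -revE IH.
rewrite -[RHS]/([&& b \in nb a, a != c & nbwalk (b :: c :: s)]) /= !andbT.
rewrite (adj_sym G b a) (adj_sym G b c) (eq_sym c a).
by case: (b \in nb c); case: (b \in nb a); case: (a == c); rewrite /= ?andbF ?andbT.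
Qed.

Lemma nbwalk_path x s : nbwalk (x :: s) -> path (adj nb) x s.
Proof.
elim: s x => [//|y s IH] x /= /and3P[xy _ h]; rewrite /adj xy /=; exact: IH.
Qed.

Variable L : nat.
Hypothesis girth : girth_ge nb L.

(** The tail has distinct vertices by induction, so a recurring first vertex closes a cycle. Its
    length is at least [3], for lack of loops and backtracking, and less than [L]. *)
Lemma nbwalk_uniq s : nbwalk s -> (size s <= L)%N -> uniq s.
Proof.
elim: s => [//|x s IH] h hs.
have us : uniq s by apply: IH; [exact: nbwalk_behead h|exact: ltnW].
rewrite /= us andbT; apply/negP => xs.
case/splitPr: xs us h hs => p1 p2; rewrite cat_uniq /= => /and3P[u1 /norP[xp1 _] _] h hs.
have hp := nbwalk_path h.
have c3 : (3 <= size (x :: p1))%N.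
  case: (p1) h hp => [|y [|z p]] //=.
    by move=> _ /andP[]; case: G => _ /(_ x) /negbTE ->.
  by rewrite eqxx /= andbF.
have cyc : ucycle (adj nb) (x :: p1).
  apply/andP; split; last by rewrite /= xp1.
  by move: hp; rewrite cat_path /= rcons_path => /and3P[-> ->].
have := girth cyc c3; rewrite leqNgt; case/negP.
by apply: leq_trans hs; rewrite /= size_cat /= !ltnS addnS leq_addr.
Qed.

Section Tree.
Variable T : seq V.

Fixpoint tree_vertices j (u v : V) : seq V :=
  v :: if j is j'.+1 then
         flatten [seq tree_vertices j' v w | w <- nb v & (w != u) && (w \notin T)]
       else [::].

Lemma tree_verticesP j u v z : v \in nb u -> z \in tree_vertices j u v ->
  exists s, [/\ nbwalk (u :: v :: s), (size s <= j)%N & last v s = z].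
Proof.
elim: j u v => [|j IH] u v vu /=.
  by rewrite inE => /eqP ->; exists [::]; rewrite /= vu.
rewrite inE => /orP[/eqP -> |]; first by exists [::]; rewrite /= vu.
case/flattenP => l /mapP[w]; rewrite mem_filter => /andP[/andP[wu _] wv] -> {l} zl.
have [s [hs ss ls]] := IH _ _ wv zl; exists (w :: s); split=> //.
by move: hs => /= ->; rewrite vu eq_sym wu.
Qed.

Lemma tree_vertices_notin j u v z : v \notin T -> z \in tree_vertices j u v -> z \notin T.
Proof.
elim: j u v => [|j IH] u v vT /=; first by rewrite inE => /eqP ->.
rewrite inE => /orP[/eqP -> //|].
case/flattenP => l /mapP[w]; rewrite mem_filter => /andP[/andP[_ wT] wv] -> {l}.
exact: IH.
Qed.

Lemma mem_tree_root j u v : v \in tree_vertices j u v.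
Proof. by case: j => [|j]; rewrite /= mem_head. Qed.

Lemma uniq_flatten_map (A B : eqType) (F : A -> seq B) l : uniq l ->
  (forall a, a \in l -> uniq (F a)) ->
  (forall a b z, a \in l -> b \in l -> z \in F a -> z \in F b -> a = b) ->
  uniq (flatten (map F l)).
Proof.
elim: l => [//|a l IH] /= /andP[al ul] h1 h2; rewrite cat_uniq h1 ?mem_head //=.
rewrite IH // ?andbT; last 2 first.
- by move=> b bl; apply: h1; rewrite inE bl orbT.
- by move=> b c z bl cl; apply: h2; rewrite inE ?bl ?cl orbT.
apply/hasPn => z /flattenP[f /mapP[b bl ->] zb]; apply/negP => za.
have ab : a = b by apply: (h2 _ _ z) => //; rewrite ?mem_head // inE bl orbT.
by rewrite ab bl in al.
Qed.

(** Paths that reach one vertex through two children of the root, joined at the root, would be a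
    non-backtracking walk with a repeated vertex; at depth [j] it has at most [2 j + 1] vertices. *)
Lemma uniq_tree j u v : v \in nb u -> (2 * j + 1 <= L)%N -> uniq (tree_vertices j u v).
Proof.
elim: j u v => [//|j IH] u v vu jL.
have jL' : (2 * j + 1 <= L)%N by apply: leq_trans jL; rewrite leq_add2r leq_mul2l leqnSn orbT.
rewrite /=; apply/andP; split.
  apply/negP => /flattenP[l /mapP[w]]; rewrite mem_filter => /andP[_ wv] -> {l} vz.
  have [s [hs ss ls]] := tree_verticesP wv vz.
  have : uniq (v :: w :: s).
    apply: nbwalk_uniq hs _; apply: leq_trans (_ : j.+2 <= L)%N; [by rewrite /= !ltnS|lia].
  by rewrite /= -{1}ls mem_last.
apply: uniq_flatten_map.
- exact/filter_uniq/nb_uniq.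
- by move=> w; rewrite mem_filter => /andP[_ wv]; apply: IH.
move=> w1 w2 z; rewrite !mem_filter => /andP[_ w1v] /andP[_ w2v] z1 z2.
apply/eqP/negP => /negP w12.
have [s1 [h1 ss1 l1]] := tree_verticesP w1v z1.
have [s2 [h2 ss2 l2]] := tree_verticesP w2v z2.
have hw : nbwalk (rev s1 ++ w1 :: v :: w2 :: s2).
  rewrite nbwalk_cat; apply/andP; split.
    by move: h1; rewrite -nbwalk_rev !rev_cons -!cats1 -catA.
  by move: h2 => /= ->; rewrite (adj_sym G) w1v w12.
have := nbwalk_uniq hw; rewrite size_cat size_rev /=.
rewrite (_ : _ ++ _ = rev (w1 :: s1) ++ v :: w2 :: s2); last by rewrite rev_cons cat_rcons.
have sz : (size s1 + (size s2).+3 <= L)%N.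
  apply: leq_trans (_ : j + j.+3 <= L)%N; last lia.
  by apply: leq_add => //; rewrite !ltnS.
move=> /(_ sz); rewrite cat_uniq => /and3P[_ /hasPn /(_ z) hz _].
have : z \in v :: w2 :: s2 by rewrite inE -l2 mem_last orbT.
by move/hz; rewrite mem_rev -l1 mem_last.
Qed.

End Tree.
End Girth.

(** * Monotone events under finite product measures *)

Section DecisionValue.
Variables (E : eqType) (R : realType) (EV : (E -> bool) -> Prop).
Hypothesis EVmono : forall w w' : E -> bool, (forall e, w e -> w' e) -> EV w -> EV w'.
Implicit Types (Es : seq E) (q : E -> R) (w : E -> bool).

Definition upd (A : Type) (q : E -> A) e r := fun e' => if e' == e then r else q e'.

Lemma upd_same A (q : E -> A) e r : upd q e r e = r.
Proof. by rewrite /upd eqxx. Qed.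

Lemma upd_other A (q : E -> A) e r e' : e' != e -> upd q e r e' = q e'.
Proof. by rewrite /upd => /negbTE ->. Qed.

(* The probability of [EV] when the states of the edges in [Es] are independent
   Bernoulli variables of parameters [q] and the others are given by [w]. *)
Fixpoint evprob Es q w : R :=
  if Es is e :: Es' then
    q e * evprob Es' q (upd w e true) + (1 - q e) * evprob Es' q (upd w e false)
  else (`[< EV w >])%:R.

Definition prob_weights q := forall e, 0 <= q e <= 1.

Lemma prob_weights_upd q e r : prob_weights q -> 0 <= r <= 1 -> prob_weights (upd q e r).
Proof. by move=> hq hr e'; rewrite /upd; case: ifP. Qed.

Lemma evprob_ge0 Es q w : prob_weights q -> 0 <= evprob Es q w.
Proof.
move=> hq; elim: Es w => [|e Es IH] w /=; first by case: `[< _ >].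
by have /andP[? ?] := hq e; rewrite addr_ge0 // mulr_ge0 // subr_ge0.
Qed.

Lemma evprob_mono_conf Es q w w' : prob_weights q ->
  (forall e, w e -> w' e) -> evprob Es q w <= evprob Es q w'.
Proof.
move=> hq; elim: Es w w' => [|e Es IH] w w' hw /=.
  rewrite ler_nat; case: asboolP => // /(EVmono hw) h.
  by case: asboolP.
have /andP[q0 q1] := hq e.
by apply: lerD; apply: ler_wpM2l; rewrite ?subr_ge0 //;
  apply: IH => e'; rewrite /upd; case: ifP => // _; exact: hw.
Qed.

Lemma evprob_mono Es q q' w w' : prob_weights q -> prob_weights q' ->
  (forall e, q e <= q' e) -> (forall e, w e -> w' e) -> evprob Es q w <= evprob Es q' w'.
Proof.
move=> hq hq' le; elim: Es w w' => [|e Es IH] w w' hw /=.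
  rewrite ler_nat; case: asboolP => // /(EVmono hw) h.
  by case: asboolP.
have /andP[q0 q1] := hq e; have /andP[q0' q1'] := hq' e.
have h1 : evprob Es q (upd w e true) <= evprob Es q' (upd w' e true).
  by apply: IH => e'; rewrite /upd; case: ifP => // _; exact: hw.
have h2 : evprob Es q (upd w e false) <= evprob Es q' (upd w' e false).
  by apply: IH => e'; rewrite /upd; case: ifP => // _; exact: hw.
have h3 : evprob Es q' (upd w' e false) <= evprob Es q' (upd w' e true).
  by apply: evprob_mono_conf => // e'; rewrite /upd; case: ifP.
have h4 := le e.
have : 0 <= (q' e - q e) * (evprob Es q' (upd w' e true) - evprob Es q' (upd w' e false)).
  by rewrite mulr_ge0 // subr_ge0.
have h5 := ler_wpM2l q0 h1.
have q1s : 0 <= 1 - q e by rewrite subr_ge0.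
have h6 := ler_wpM2l q1s h2.
lra.
Qed.

Lemma eq_evprob Es q q' w : (forall e, e \in Es -> q e = q' e) -> evprob Es q w = evprob Es q' w.
Proof.
elim: Es w => [//|e Es IH] w h /=; rewrite h ?mem_head // !IH //;
  by move=> e' e'E; apply: h; rewrite inE e'E orbT.
Qed.

Lemma evprob_affine Es q w e r : uniq Es -> e \in Es ->
  evprob Es (upd q e r) w = r * evprob Es (upd q e 1) w + (1 - r) * evprob Es (upd q e 0) w.
Proof.
elim: Es w => [//|a Es IH] w /= /andP[aE uE]; rewrite inE => /orP[/eqP ea|eE].
  rewrite ea !upd_same.
  have h x y : evprob Es (upd q a x) y = evprob Es q y.
    by apply: eq_evprob => e' e'E; rewrite upd_other //; apply: contraNneq aE => <-.
  rewrite !h; ring.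
have ae : a != e by apply: contraNneq aE => ->.
rewrite !(upd_other _ _ ae) !(IH _ uE eE); ring.
Qed.

Lemma evprob_sure Es q w : prob_weights q -> uniq Es ->
  EV (fun e => if e \in Es then q e == 1 else w e) -> 1 <= evprob Es q w.
Proof.
move=> hq; elim: Es w => [|e Es IH] w /=.
  by move=> _ h; case: asboolP.
move=> /andP[eE uE] h; have /andP[q0 q1] := hq e.
have h1 : 1 <= evprob Es q (upd w e true).
  apply: IH => //; apply: EVmono h => e'; rewrite inE /upd.
  by case: eqVneq => [->|_] //=; rewrite (negbTE eE).
have [q1e|qe] := eqVneq (q e) 1; first by rewrite q1e subrr mul0r addr0 mul1r.
have h2 : 1 <= evprob Es q (upd w e false).
  apply: IH => //; apply: EVmono h => e'; rewrite inE /upd.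
  by case: eqVneq => [->|_] //=; rewrite (negbTE qe).
have := ler_wpM2l q0 h1; have q1s : 0 <= 1 - q e by rewrite subr_ge0.
have := ler_wpM2l q1s h2; lra.
Qed.

Variable ok : pred E.

(** Edges outside [Es] are closed. Requiring the bound for every large enough [Es] lets branches of
    an exploration that inspect different edges be combined over a common list. *)
Definition secures q (c : R) := exists Es0, all ok Es0 /\
  forall Es, uniq Es -> {subset Es0 <= Es} -> c <= evprob Es q (fun=> false).

Lemma secures_le0 q c : prob_weights q -> c <= 0 -> secures q c.
Proof. by move=> hq c0; exists [::]; split=> // Es _ _; apply: le_trans c0 _; exact: evprob_ge0. Qed.

Lemma secures_sure q c D : prob_weights q -> c <= 1 -> all ok D ->
  (forall e, e \in D -> q e = 1) -> EV (fun e => e \in D) -> secures q c.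
Proof.
move=> hq c1 okD qD h; exists D; split=> // Es uE sE; apply: le_trans c1 _.
apply: evprob_sure => //; apply: EVmono h => e eD.
by rewrite (sE _ eD) qD.
Qed.

Lemma secures_mono q c c' : c' <= c -> secures q c -> secures q c'.
Proof.
move=> cc [Es0 [ok0 h]]; exists Es0; split=> // Es uE sE.
by apply: le_trans cc _; exact: h.
Qed.

(* An edge of parameter at least [s + (1 - s) r] may be opened with probability
   [s] and otherwise keeps the parameter [r]: multi-affinity of [evprob]. *)
Lemma secures_split q e s r c1 c2 : prob_weights q -> ok e ->
  0 <= s <= 1 -> 0 <= r <= 1 -> s + (1 - s) * r <= q e ->
  secures (upd q e 1) c1 -> secures (upd q e r) c2 ->
  secures q (s * c1 + (1 - s) * c2).
Proof.
move=> hq oke /andP[s0 s1] /andP[r0 r1] hs [E1 [ok1 h1]] [E2 [ok2 h2]].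
exists (e :: E1 ++ E2); split; first by rewrite /= oke all_cat ok1.
move=> Es uE sE.
have eE : e \in Es by apply: sE; rewrite mem_head.
have {}h1 : c1 <= evprob Es (upd q e 1) (fun=> false).
  by apply: h1 => // x xE; apply: sE; rewrite inE mem_cat xE orbT.
have {}h2 : c2 <= evprob Es (upd q e r) (fun=> false).
  by apply: h2 => // x xE; apply: sE; rewrite inE mem_cat xE !orbT.
have sr : 0 <= s + (1 - s) * r <= 1.
  have sb : 0 <= 1 - s by rewrite subr_ge0.
  have := mulr_ge0 sb r0; have := ler_wpM2l sb r1; rewrite mulr1 => ? ?.
  by apply/andP; split; lra.
apply: (@le_trans _ _ (evprob Es (upd q e (s + (1 - s) * r)) (fun=> false))); last first.
  apply: evprob_mono => // [|e']; first exact: prob_weights_upd.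
  by rewrite /upd; case: eqVneq => [->|].
rewrite evprob_affine // in h2; rewrite evprob_affine //.
have sb : 0 <= 1 - s by rewrite subr_ge0.
have := ler_wpM2l s0 h1; have := ler_wpM2l sb h2; lra.
Qed.

End DecisionValue.

(** * Leaves of percolation on a tree *)

Section TreeGeneratingFunction.
Variable R : realType.

(** Second Bonferroni bound; its quadratic term is the source of the loss factor in [treegf_le]. *)
Lemma prod_sub_le (I : Type) (l : seq I) (P : pred I) (x : I -> R) :
  (forall i, P i -> 0 <= x i <= 1) ->
  \prod_(i <- l | P i) (1 - x i) <=
  1 - \sum_(i <- l | P i) x i + (\sum_(i <- l | P i) x i) ^+ 2 / 2.
Proof.
move=> h; elim: l => [|a l IH]; first by rewrite !big_nil; lra.
rewrite !big_cons; case: ifP => // Pa.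
have /andP[x0 x1] := h _ Pa; set S := \sum_(j <- l | P j) x j in IH *.
have x1' : 0 <= 1 - x a by rewrite subr_ge0.
have S0 : 0 <= S by apply: sumr_ge0 => i /h /andP[].
have h1 := ler_wpM2l x1' IH; have h2 := mulr_ge0 x0 (sqr_ge0 S); have h3 := sqr_ge0 (x a).
apply: le_trans h1 _; rewrite !expr2 in h2 h3 *; lra.
Qed.

Variables (V : countType) (nb : V -> seq V).
Hypothesis G : graph_ok nb.
Variable T : seq V.

(* Generating function [E z^(number of leaves)] of the open cluster of [v] in the
   tree of non-backtracking walks of length [j] from the edge [uv] avoiding [T]. *)
Fixpoint treegf (z p : R) j (u v : V) : R :=
  if j is j'.+1 then
    \prod_(w <- nb v | (w != u) && (w \notin T)) (1 - p + p * treegf z p j' v w)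
  else z.

Lemma treegf01 z p j u v : 0 <= z <= 1 -> 0 <= p <= 1 -> 0 <= treegf z p j u v <= 1.
Proof.
move=> hz /andP[p0 p1]; elim: j u v => [//|j IH] u v /=.
have h w : 0 <= 1 - p + p * treegf z p j v w <= 1.
  have /andP[g0 g1] := IH v w; have := mulr_ge0 p0 g0; have := ler_wpM2l p0 g1.
  by rewrite mulr1 => ? ?; apply/andP; split; lra.
rewrite prodr_ge0 /=; last by move=> w _; have /andP[] := h w.
by apply: prodr_ile1 => w _; exact: h.
Qed.

Variables (q : nat) (mu s K z : R).
Hypothesis deg : forall x, size (nb x) = q.+1.
Hypothesis q2 : (2 <= q)%N.
Hypothesis mu1 : 1 < mu <= q%:R.
Hypothesis s0 : 0 <= s.
Hypothesis KE : K * (mu - 1) = mu / 2.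
Hypothesis K1 : 1 <= K.
Hypothesis hz : z <= 1 - s + s ^+ 2.
Hypothesis z01 : 0 <= z <= 1.

(** The product of [esc] and [(mu / q)^j] is the expected number of leaves, at most [mu^j]; the last
    factor is the loss from second-order terms. One more generation adds [mu^(j+1) / 2] to this
    loss, and [K] is chosen so that [K mu^j + mu^(j+1) / 2 = K mu^(j+1)]. *)
Lemma treegf_le j u v : u \in nb v -> v \notin T -> s * (K * mu ^+ j) <= 1 ->
  treegf z (mu / q%:R) j u v <=
  1 - s * (esc nb R T j u v * (mu / q%:R) ^+ j) * (1 - s * (K * mu ^+ j)).
Proof.
have /andP[m1 mq] := mu1; have m0 : 0 < mu by lra.
have q0 : 0 < q%:R :> R by rewrite ltr0n; case: q q2.
have p0 : 0 < mu / q%:R by rewrite divr_gt0.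
have p1 : mu / q%:R <= 1 by rewrite ler_pdivrMr // mul1r.
have pq : mu / q%:R * q%:R = mu by rewrite divfK ?gt_eqF.
set p := mu / q%:R in p0 p1 pq *.
elim: j u v => [|j IH] u v uv vT hs.
  rewrite [treegf _ _ _ _ _]/= [esc _ _ _ _ _ _]/= vT /= !expr0 !mulr1.
  apply: le_trans hz _; have := sqr_ge0 s; rewrite expr2 => s2.
  by have := ler_wpM2l s2 K1; lra.
have hKj : K * mu ^+ j + mu ^+ j.+1 / 2 = K * mu ^+ j.+1.
  have -> : mu ^+ j.+1 / 2 = mu / 2 * mu ^+ j by rewrite exprS mulrAC.
  by rewrite -KE exprS; ring.
have hsj : s * (K * mu ^+ j) <= 1.
  apply: le_trans hs; rewrite ler_wpM2l // -hKj lerDl.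
  by rewrite divr_ge0 ?exprn_ge0 // ltW.
set c := 1 - s * (K * mu ^+ j).
have c01 : 0 <= c <= 1.
  have K0 : 0 <= K by exact: le_trans K1.
  have := mulr_ge0 s0 (mulr_ge0 K0 (exprn_ge0 j (ltW m0))).
  by rewrite /c => ?; apply/andP; split; lra.
have /andP[c0 c1] := c01.
pose Q w := (w != u) && (w \notin T).
pose x w := if w \in nb v then p * (s * (esc nb R T j v w * p ^+ j) * c) else 0.
have escp w : w \in nb v -> esc nb R T j v w * p ^+ j <= mu ^+ j.
  move=> wv; apply: (@le_trans _ _ (q%:R ^+ j * p ^+ j)).
    by rewrite ler_wpM2r ?exprn_ge0 ?(ltW p0) // (esc_le R G T deg) // (adj_sym G).
  by rewrite -exprMn mulrC pq.
have x01 w : 0 <= x w <= 1.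
  rewrite /x; case: ifPn => wv; last by rewrite lexx ler01.
  have e0 : 0 <= esc nb R T j v w * p ^+ j by rewrite mulr_ge0 ?esc_ge0 ?exprn_ge0 ?(ltW p0).
  have h1 : s * (esc nb R T j v w * p ^+ j) <= 1.
    apply: le_trans hsj; rewrite ler_wpM2l //; apply: le_trans (escp w wv) _.
    by rewrite ler_peMl // exprn_ge0 // ltW.
  have h2 : 0 <= s * (esc nb R T j v w * p ^+ j) by exact: mulr_ge0.
  have h3 := mulr_ge0 h2 c0; have h4 := mulr_ile1 h2 c0 h1 c1.
  by rewrite (mulr_ge0 (ltW p0) h3) (mulr_ile1 (ltW p0) h3 p1 h4).
have le1 : treegf z p j.+1 u v <= \prod_(w <- nb v | Q w) (1 - x w).
  rewrite /= big_seq_cond [leRHS]big_seq_cond; apply: ler_prod => w /and3P[wv wu wT].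
  have /andP[g0 g1] : 0 <= treegf z p j v w <= 1 by apply: treegf01; rewrite // (ltW p0).
  have vw : v \in nb w by rewrite (adj_sym G).
  apply/andP; split.
    by have := mulr_ge0 (ltW p0) g0; lra.
  rewrite /x wv.
  have := ler_wpM2l (ltW p0) (IH v w vw wT hsj); rewrite -/c; lra.
apply: le_trans le1 _; apply: le_trans (prod_sub_le _ (fun w _ => x01 w)) _.
set X := \sum_(w <- nb v | Q w) x w.
set u1 := esc nb R T j.+1 u v * p ^+ j.+1.
have XE : X = s * u1 * c.
  rewrite /u1 [esc _ _ _ _ _ _]/= (negbTE vT) !(mulr_suml, mulr_sumr).
  rewrite /X (bigID (fun w => w \in T)) /= [X in X + _ = _]big1 ?add0r; last first.
    move=> w /andP[/andP[_ /negbTE ->]] //.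
  rewrite [RHS](bigID (fun w => w \in T)) /= [X in _ = X + _]big1 ?add0r; last first.
    by move=> w /andP[_ wT]; case: (j) => [|j'] /=; rewrite wT !(mul0r, mulr0).
  rewrite big_seq_cond [RHS]big_seq_cond; apply: eq_big => [w|w].
    by rewrite /Q -!andbA; congr (_ && (_ && _)); rewrite andbb.
  by move=> /andP[wv _]; rewrite /x wv exprS; ring.
have u10 : 0 <= u1 by rewrite mulr_ge0 ?esc_ge0 ?exprn_ge0 ?(ltW p0).
have u1m : u1 <= mu ^+ j.+1.
  apply: (@le_trans _ _ (q%:R ^+ j.+1 * p ^+ j.+1)).
    by rewrite ler_wpM2r ?exprn_ge0 ?(ltW p0) // (esc_le R G T deg).
  by rewrite -exprMn mulrC pq.
have X0 : 0 <= X by apply: sumr_ge0 => w _; have /andP[] := x01 w.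
have su0 : 0 <= s * u1 by exact: mulr_ge0.
have Xle : X <= s * u1 by rewrite XE ler_piMr.
have X2 : X ^+ 2 <= s * u1 * (s * mu ^+ j.+1).
  rewrite expr2; apply: le_trans (ler_wpM2l X0 Xle) _; rewrite mulrC.
  by rewrite ler_wpM2l // (le_trans Xle) // ler_wpM2l.
rewrite -hKj {1}XE /c; lra.
Qed.

End TreeGeneratingFunction.

(** * Boundary edges with many escaping walks *)

Section GoodEdge.
Variables (V : countType) (nb : V -> seq V) (R : realType).
Hypothesis G : graph_ok nb.
Variables (T : seq V) (q : nat) (t : R).
Hypothesis deg : forall x, size (nb x) = q.+1.
Hypothesis q2 : (2 <= q)%N.
Hypothesis t01 : 9 / 10 <= t < 1.
Hypothesis Anorm : forall f : V -> R, fins f ->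
  ip (adjop nb f) (adjop nb f) <= (t * q.+1%:R) ^+ 2 * ip f f.
Hypothesis uT : uniq T.

Lemma orient_inj_boundary x y x' y' : x \in T -> y \notin T -> x' \in T -> y' \notin T ->
  orient x y = orient x' y' -> x = x' /\ y = y'.
Proof.
move=> xT yT xT' yT'; rewrite /orient.
by case: ifP => _; case: ifP => _ [e1 e2] //; move: yT yT'; rewrite ?e1 ?e2 ?xT ?xT' // -?e1 -?e2 ?xT ?xT'.
Qed.

(** A boundary edge has exactly one endpoint in [T], so no element of [F] is counted twice. *)
Lemma sum_boundary_le (F : seq (V * V)) :
  \sum_(x <- T) \sum_(y <- nb x) ((y \notin T) && (orient x y \in F))%:R <= (size F)%:R :> R.
Proof.
pose l := [seq (x, y) | x <- T, y <- nb x].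
have ul : uniq l.
  apply: allpairs_uniq_dep => //; first by move=> x _; exact: nb_uniq.
  by move=> [x y] [x' y'] _ _ /= [-> ->].
pose l' := [seq e <- l | (e.2 \notin T) && (orient e.1 e.2 \in F)].
have -> : \sum_(x <- T) \sum_(y <- nb x) ((y \notin T) && (orient x y \in F))%:R = (size l')%:R :> R.
  rewrite -(big_allpairs_dep (h := pair) (F := fun e => ((e.2 \notin T) && (orient e.1 e.2 \in F))%:R)).
  rewrite size_filter -sum1_count natr_sum [RHS]big_mkcond /=.
  by apply: eq_bigr => e _; case: (_ && _).
rewrite ler_nat -(size_map (fun e => orient e.1 e.2) l'); apply: uniq_leq_size.
  rewrite map_inj_in_uniq ?filter_uniq // => -[x y] [x' y'].
  rewrite !mem_filter /= => /andP[/andP[yT _] /allpairsPdep[a [b [aT _ [ex ey]]]]].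
  move=> /andP[/andP[yT' _] /allpairsPdep[a' [b' [aT' _ [ex' ey']]]]] e.
  by subst; have [-> ->] := orient_inj_boundary aT yT aT' yT' e.
by move=> e /mapP[[x y]]; rewrite mem_filter => /andP[/andP[_ h] _] ->.
Qed.

(** Averaging against [exits_lower], with [c = escape_const t]: otherwise boundary edges outside [F]
    carry at most [c/3 q^k] walks each, those in [F] at most [q^k] each. As [q + 1 <= (3/2) q], each
    group accounts for at most half of [c |T| q^(k+1)], the second one for strictly less. *)
Lemma good_edge k (F : seq (V * V)) :
  (size F)%:R < escape_const t / 3 * q.+1%:R * (size T)%:R ->
  exists x y, [/\ x \in T, y \notin T, y \in nb x, orient x y \notin F &
    escape_const t / 3 * q%:R ^+ k <= esc nb R T k x y].
Proof.
move=> hF; apply: contrapT => hno.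
have q2' : 2 <= q%:R :> R by rewrite ler_nat.
have qk : 0 < q%:R ^+ k :> R by rewrite exprn_gt0 //; lra.
have c0 : 0 <= escape_const t by rewrite /escape_const mulr_ge0 ?sqr_ge0 //; lra.
have h x y : x \in T -> y \in nb x -> esc nb R T k x y <=
   escape_const t / 3 * q%:R ^+ k + q%:R ^+ k * ((y \notin T) && (orient x y \in F))%:R.
  move=> xT yx.
  have e0 : 0 <= escape_const t / 3 * q%:R ^+ k by rewrite mulr_ge0 ?(ltW qk) // divr_ge0.
  have [yT|yT] := boolP (y \in T).
    by rewrite mulr0 addr0; case: (k) e0 => [|k'] /= ; rewrite yT.
  have [eF|eF] := boolP (orient x y \in F).
    by rewrite mulr1 ler_wpDl // (esc_le R G T deg) // (adj_sym G).
  rewrite mulr0 addr0 leNgt; apply/negP => hlt; apply: hno.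
  by exists x, y; split=> //; exact: ltW.
have := exits_lower G deg q2 t01 Anorm uT k; rewrite leNgt; case/negP.
apply: (@le_lt_trans _ _ (\sum_(x <- T) \sum_(y <- nb x)
   (escape_const t / 3 * q%:R ^+ k + q%:R ^+ k * ((y \notin T) && (orient x y \in F))%:R))).
  rewrite big_seq [leRHS]big_seq; apply: ler_sum => x xT.
  by rewrite /exits big_seq [leRHS]big_seq; apply: ler_sum => y yx; exact: h.
rewrite (eq_bigr (fun x => q.+1%:R * (escape_const t / 3 * q%:R ^+ k) +
   q%:R ^+ k * \sum_(y <- nb x) ((y \notin T) && (orient x y \in F))%:R)); last first.
  move=> x _; rewrite big_split /=; congr (_ + _); last by rewrite mulr_sumr.
  by rewrite big_const_seq count_predT deg iter_addr_0 mulr_natl.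
rewrite big_split /= big_const_seq count_predT iter_addr_0 -[in X in X + _]mulr_natl -[X in _ + X]mulr_sumr.
have h1 := ler_wpM2l (ltW qk) (sum_boundary_le F).
have h2 : q%:R ^+ k * (size F)%:R < q%:R ^+ k * (escape_const t / 3 * q.+1%:R * (size T)%:R).
  by rewrite ltr_pM2l.
apply: (lt_le_trans (ler_ltD (lexx _) (le_lt_trans h1 h2))).
have h3 : q.+1%:R <= 3 / 2 * q%:R :> R by rewrite -natr1; lra.
have h4 := mulr_ge0 (mulr_ge0 c0 (ler0n R (size T))) (ltW qk).
have := ler_wpM2l h4 h3. rewrite (exprS q%:R k); lra.
Qed.

End GoodEdge.

Section Orientation.
Variables (V : countType) (nb : V -> seq V).
Hypothesis G : graph_ok nb.

Lemma orientP (x y : V) : orient x y = (x, y) \/ orient x y = (y, x).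
Proof. by rewrite /orient; case: ifP => _; [left|right]. Qed.

Lemma orient_sym (x y : V) : orient x y = orient y x.
Proof.
rewrite /orient; case: ltngtP => // /(pcan_inj pickleK) -> //.
Qed.

Lemma oriented_orient x y : y \in nb x -> oriented_edge nb (orient x y).
Proof.
move=> yx; have := adj_neq G yx.
rewrite /oriented_edge /orient; case: ltngtP => /=; rewrite /adj.
- by rewrite yx => ->.
- by rewrite -(adj_sym G) yx => ->.
- by move=> /(pcan_inj pickleK) ->; rewrite eqxx.
Qed.

Lemma orient_eq (x y x' y' : V) : orient x y = orient x' y' -> (x' == x) || (x' == y).
Proof.
by case: (orientP x y) => ->; case: (orientP x' y') => -> [-> ->]; rewrite eqxx ?orbT.
Qed.

Lemma open_conn_mono (w w' : V * V -> bool) x y :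
  (forall e, w e -> w' e) -> open_conn nb w x y -> open_conn nb w' x y.
Proof.
move=> h [s [ps ls]]; exists s; split=> //.
by apply: sub_path ps => a b /andP[-> /h].
Qed.

Lemma open_conn_refl w x : open_conn nb w x x.
Proof. by exists [::]. Qed.

Lemma open_conn_rcons (w : V * V -> bool) x y z : open_conn nb w x y -> z \in nb y ->
  w (orient y z) -> open_conn nb w x z.
Proof.
move=> [s [ps ls]] zy hw; exists (rcons s z); rewrite last_rcons; split=> //.
by rewrite rcons_path ps ls /= /adj zy.
Qed.

Definition reach (o : V) M (w : V * V -> bool) :=
  exists s : seq V, [/\ uniq s, (M <= size s)%N & forall y, y \in s -> open_conn nb w o y].

Lemma reach_mono o M (w w' : V * V -> bool) : (forall e, w e -> w' e) -> reach o M w -> reach o M w'.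
Proof.
move=> h [s [us ss hs]]; exists s; split=> // y /hs; exact: open_conn_mono.
Qed.

End Orientation.

(** * Exploring a forest of pending trees *)

Section Exploration.
Variables (V : countType) (nb : V -> seq V) (R : realType).
Hypothesis G : graph_ok nb.
Variables (o : V) (M : nat) (p p1 p2 : R).
Hypothesis p1_01 : 0 <= p1 <= 1.
Hypothesis p2_01 : 0 <= p2 <= 1.
Hypothesis pE : p1 + (1 - p1) * p2 <= p.
Implicit Types (q : V * V -> R) (T : seq V) (D F : seq (V * V)).

Notation Reach := (reach nb o M).
Notation ok := (oriented_edge nb).

(* State of the exploration: [T] is the set of vertices found connected to [o] through
   the open edges [D], and the unexplored edges have independent states of parameters
   [q].  An edge found closed keeps a parameter [p2] for one later sprinkling attempt;
   after a failed attempt it joins [F] and its parameter drops to [0]. *)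
Record explored T D q : Prop := Explored {
  explored_weights : prob_weights q;
  explored_oriented : all ok D;
  explored_open : forall e, e \in D -> [/\ q e = 1, e.1 \in T & e.2 \in T];
  explored_conn : forall y, y \in T -> open_conn nb (fun e => e \in D) o y;
  explored_fresh : forall e, ok e -> e.1 \notin T -> e.2 \notin T -> p <= q e }.

Definition kept F q := forall e, ok e -> e \notin F -> p2 <= q e.

Lemma explored_close T D q x y r : explored T D q -> x \in T -> y \notin T ->
  0 <= r <= 1 -> explored T D (upd q (orient x y) r).
Proof.
move=> [h1 h2 h3 h4 h5] xT yT r01; split=> //.
- exact: prob_weights_upd.
- move=> e eD; have [qe e1 e2] := h3 e eD; split=> //; rewrite upd_other //.
  apply: contraNneq yT => ee; move: e1 e2; rewrite ee.
  by case: (orientP x y) => ->.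
- move=> e oe e1 e2; rewrite upd_other; first exact: h5.
  apply/eqP => ee; move: e1 e2; rewrite ee.
  by case: (orientP x y) => -> /=; rewrite xT.
Qed.

Lemma explored_step T D q x y : explored T D q -> x \in T -> y \notin T -> y \in nb x ->
  explored (y :: T) (orient x y :: D) (upd q (orient x y) 1).
Proof.
move=> h xT yT yx; have one01 : 0 <= (1 : R) <= 1 by rewrite ler01 lexx.
have [h1 h2 h3 h4 h5] := explored_close h xT yT one01; split=> //.
- by rewrite /= oriented_orient.
- move=> e; rewrite inE => /orP[/eqP ->|eD].
    split; first exact: upd_same.
      by case: (orientP x y) => -> /=; rewrite ?in_cons ?eqxx ?xT ?orbT.
    by case: (orientP x y) => -> /=; rewrite ?in_cons ?eqxx ?xT ?orbT.
  by have [? e1 e2] := h3 e eD; split=> //; rewrite /= ?in_cons ?e1 ?e2 orbT.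
- have hm e : e \in D -> e \in orient x y :: D by rewrite inE => ->; rewrite orbT.
  move=> z; rewrite inE => /orP[/eqP ->|zT]; last exact: open_conn_mono hm (h4 z zT).
  apply: open_conn_rcons (open_conn_mono hm (h4 x xT)) yx _.
  exact: mem_head.
- move=> e oe; rewrite !inE !negb_or => /andP[_ e1] /andP[_ e2]; exact: h5.
Qed.

Lemma kept_close T F q x y : kept F q -> kept (orient x y :: F) (upd q (orient x y) 0).
Proof.
move=> h e oe; rewrite inE negb_or => /andP[ee eF]; rewrite upd_other //; exact: h.
Qed.

Lemma kept_upd F q e r : p2 <= r -> kept F q -> kept F (upd q e r).
Proof.
move=> hr h e' oe eF; rewrite /upd; case: ifP => // _; exact: h.
Qed.

Section Forest.
Variables (T0 : seq V) (z A : R) (n0 : nat) (F : seq (V * V)).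
Hypothesis z01 : 0 <= z <= 1.
Hypothesis A0 : 0 <= A.
Hypothesis final : forall T D q, uniq T -> explored T D q -> kept F q ->
  (n0 <= size T)%N -> secures Reach ok q (1 - A * z ^+ size T).

Definition root_vertices (x : V * V * nat) := tree_vertices nb T0 x.2 x.1.1 x.1.2.
Definition root_gf (x : V * V * nat) := 1 - p1 + p1 * treegf nb T0 z p1 x.2 x.1.1 x.1.2.
Definition pending T q (x : V * V * nat) :=
  [/\ x.1.1 \in T, x.1.2 \in nb x.1.1 & p <= q (orient x.1.1 x.1.2)].

Lemma root_gf_ge0 x : 0 <= root_gf x.
Proof.
rewrite /root_gf; have /andP[g0 g1] := treegf01 nb T0 x.2 x.1.1 x.1.2 z01 p1_01.
by have /andP[a b] := p1_01; have := mulr_ge0 a g0; lra.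
Qed.

Lemma pending_upd T q x y r (P : V * V * nat) : x \in T -> y \notin T ->
  P.1.2 \notin T -> P.1.2 != y -> pending T q P -> pending T (upd q (orient x y) r) P.
Proof.
move=> xT yT PT Py [h1 h2 h3]; split=> //; rewrite upd_other //.
apply/eqP; rewrite (orient_sym _ P.1.2) => /esym /orient_eq /orP[] /eqP e.
  by rewrite e xT in PT.
by rewrite e eqxx in Py.
Qed.

(** Each pending tree enters the potential through its generating function, averaged over its root
    edge. Testing that edge either removes the tree or moves its root to [T] and leaves the children
    pending, so the potential does not increase on average. Disjointness of the vertex lists keeps
    pending edges unrevealed. *)
Lemma explore_forest n : forall L T D q, (size (flatten (map root_vertices L)) <= n)%N ->
  uniq (T ++ flatten (map root_vertices L)) -> explored T D q -> kept F q ->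
  (n0 <= size T)%N -> (forall x, x \in L -> pending T q x) ->
  secures Reach ok q (1 - A * z ^+ size T * \prod_(x <- L) root_gf x).
Proof.
elim: n => [|n IH] L T D q.
  case: L => [|[[u v] j] L] hn uT he hk hs _; last by move: hn => /=; rewrite /root_vertices /=; case: (j).
  by rewrite big_nil mulr1; apply: final he hk hs; move: uT; rewrite cats0.
case: L => [|[[u v] j] L] hn uT he hk hs hL.
  by rewrite big_nil mulr1; apply: final he hk hs; move: uT; rewrite cats0.
have /andP[z0 z1] := z01; have /andP[p10 p11] := p1_01.
have [/= uinT vu pq] := hL _ (mem_head _ _).
have vT : v \notin T.
  apply/negP => vT; move: uT; rewrite cat_uniq => /and3P[_ /hasPn h _].
  by have := h v; rewrite /= mem_cat mem_tree_root vT => /(_ isT).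
have restv x : x \in L -> x.1.2 \in flatten (map root_vertices L).
  move=> xL; apply/flattenP; exists (root_vertices x); first exact: map_f.
  by rewrite /root_vertices mem_tree_root.
have notv x : x \in L -> x.1.2 \notin T /\ x.1.2 != v.
  move=> /restv h; move: uT; rewrite /= catA cat_uniq => /and3P[_ /hasPn /(_ _ h)].
  by rewrite mem_cat negb_or => /andP[-> hv] _; split=> //; apply: contraNneq hv => ->;
    rewrite mem_tree_root.
(* The edge opens with probability [p1]; otherwise it keeps [p2] for a later sprinkling, which [pE]
   makes affordable. *)
have closed : secures Reach ok (upd q (orient u v) p2)
    (1 - A * z ^+ size T * \prod_(x <- L) root_gf x).
  apply: (IH L T D) => //.
  - apply: leq_trans (_ : (size (flatten (map root_vertices ((u, v, j) :: L)))).-1 <= n)%N;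
      last by move: hn; case: (size _).
    by rewrite /= size_cat; case: (j) => [|j'] /=; rewrite ?addSn /= ?leq_addl.
  - move: uT; rewrite /= catA cat_uniq => /and3P[u1 h u2]; rewrite cat_uniq u2.
    move: u1; rewrite cat_uniq => /and3P[-> _ _]; rewrite andbT /=; apply: contra h.
    by move=> /hasP[x xL xT]; apply/hasP; exists x => //; rewrite mem_cat [x \in T]xT.
  - exact: explored_close.
  - by apply: kept_upd.
  - move=> x xL; have [n1 n2] := notv x xL; apply: pending_upd => //.
    by apply: hL; rewrite inE xL orbT.
pose children := if j is j'.+1 then [seq (v, w, j') | w <- nb v & (w != u) && (w \notin T0)] else [::].
have vert : root_vertices (u, v, j) = v :: flatten (map root_vertices children).
  rewrite /root_vertices /children; case: (j) => [//|j'] /=; congr (_ :: _).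
  by rewrite -map_comp.
have perm : perm_eq (T ++ flatten (map root_vertices ((u, v, j) :: L)))
    ((v :: T) ++ flatten (map root_vertices (children ++ L))).
  rewrite [map root_vertices (_ :: _)]/= [flatten (_ :: _)]/= vert map_cat flatten_cat.
  by rewrite /= perm_catC /= perm_cons perm_catC.
have opened : secures Reach ok (upd q (orient u v) 1)
    (1 - A * z ^+ (size T).+1 * \prod_(x <- children ++ L) root_gf x).
  apply: (IH (children ++ L) (v :: T) (orient u v :: D)) => //.
  - have := perm_size perm.
    rewrite size_cat (size_cat (v :: T)) -[size (v :: T)]/(size T).+1 addSnnS => /addnI e.
    by rewrite -ltnS -e.
  - by rewrite -(perm_uniq perm).
  - exact: explored_step.
  - by apply: kept_upd => //; case/andP: p2_01.
  - exact: leqW.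
  move=> x; rewrite mem_cat => /orP[xc|xL].
    have xf : x.1.2 \in flatten (map root_vertices (children ++ L)).
      apply/flattenP; exists (root_vertices x); last by rewrite /root_vertices mem_tree_root.
      by apply: map_f; rewrite mem_cat xc.
    have : x.1.2 \notin v :: T.
      apply/negP => xT; move: uT; rewrite (perm_uniq perm) cat_uniq => /and3P[_ /hasPn /(_ _ xf)].
      by rewrite /= xT.
    move: xc; rewrite /children; case: (j) => [//|j'] /mapP[w].
    rewrite mem_filter => /andP[_ wv] -> /=; rewrite inE negb_or => /andP[wv' wT].
    split; rewrite /= ?mem_head // upd_other.
      apply: (explored_fresh he); first exact: oriented_orient.
        by case: (orientP v w) => ->.
      by case: (orientP v w) => ->.
    apply/eqP => /orient_eq /orP[] /eqP e; first by rewrite -e uinT in vT.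
    by rewrite -e uinT in wT.
  have [n1 n2] := notv x xL.
  have := pending_upd 1 uinT vT n1 n2 (hL x _); rewrite inE xL orbT => /(_ isT) [h1 h2 h3].
  by split=> //; rewrite inE h1 orbT.
set P := \prod_(x <- L) root_gf x in closed *.
have P0 : 0 <= P by apply: prodr_ge0 => x _; exact: root_gf_ge0.
set X := A * z ^+ size T in closed *.
have X0 : 0 <= X by rewrite mulr_ge0 ?exprn_ge0.
pose g := treegf nb T0 z p1 j u v.
(* [treegf] counts leaves only, so the factor [z <= 1] of an interior vertex is dropped. *)
have hg : A * z ^+ (size T).+1 * \prod_(x <- children ++ L) root_gf x <= X * (g * P).
  rewrite big_cat /= -/P exprSr mulrA -/X -mulrA ler_wpM2l // mulrA ler_wpM2r //.
  rewrite /g /children; case: (j) => [|j'] /=; first by rewrite big_nil mulr1.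
  rewrite big_map big_filter /=; apply: ler_piMl => //.
  by apply: prodr_ge0 => w _; exact: (root_gf_ge0 (v, w, j')).
have {}opened := secures_mono (lerB (lexx 1) hg) opened.
have oe := oriented_orient G vu.
have := secures_split (@reach_mono _ nb o M) (explored_weights he) oe p1_01 p2_01
  (le_trans pE pq) opened closed.
apply: secures_mono; rewrite big_cons -/P /root_gf /= -/g; lra.
Qed.

End Forest.
End Exploration.

(** * Growth of a cluster to any prescribed size *)

Section Growth.
Variables (V : countType) (nb : V -> seq V) (R : realType).
Hypothesis G : graph_ok nb.
Variables (o : V) (M q k L : nat) (t mu s K p p2 : R).
Hypothesis deg : forall x, size (nb x) = q.+1.
Hypothesis q2 : (2 <= q)%N.
Hypothesis t01 : 9 / 10 <= t < 1.
Hypothesis Anorm : forall f : V -> R, fins f ->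
  ip (adjop nb f) (adjop nb f) <= (t * q.+1%:R) ^+ 2 * ip f f.
Hypothesis girth : girth_ge nb L.
Hypothesis kL : (2 * k + 1 <= L)%N.
Hypothesis mu1 : 1 < mu <= q%:R.
Hypothesis KE : K * (mu - 1) = mu / 2.
Hypothesis K1 : 1 <= K.
Hypothesis sE : s * (K * mu ^+ k) = 1 / 2.
Hypothesis p2_01 : 0 <= p2 <= 1.
Hypothesis p01 : 0 <= p <= 1.
Hypothesis pE : mu / q%:R + (1 - mu / q%:R) * p2 <= p.

Let c1 : R := escape_const t / 3.
(** By [sE] the loss factor in [treegf_le] is [1/2], and [gain] is [s c1 mu^k / 2]. The rate in [y]
    is such that [y^|F| z^|T| >= 1] exactly when [|F| >= c1 (q + 1) |T|]. *)
Let gain : R := c1 / (4 * K).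
Let z := expR (- s).
Let y := expR (s / (c1 * q.+1%:R)).
Hypothesis gainE : p2 * (1 - gain) + (1 - p2) * y <= 1.

Lemma escape_const_gt0 : 0 < escape_const t.
Proof.
have /andP[a b] := t01; rewrite /escape_const mulr_gt0 ?exprn_gt0 //.
by rewrite divr_gt0 // subr_gt0.
Qed.

Lemma edge_const_gt0 : 0 < c1.
Proof. by rewrite divr_gt0 // escape_const_gt0. Qed.

Lemma leaf_rate_gt0 : 0 < s.
Proof.
have /andP[m1 _] := mu1.
have h : 0 < K * mu ^+ k by rewrite mulr_gt0 ?exprn_gt0 //; [exact: lt_le_trans K1|lra].
by rewrite -(pmulr_lgt0 _ h) sE.
Qed.

Lemma expRN_le (x : R) : 0 <= x -> expR (- x) <= 1 - x + x ^+ 2.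
Proof.
move=> x0; have h1 : 1 + x <= expR x by exact: expR_ge1Dx.
have x1 : 0 < 1 + x by lra.
rewrite expRN; apply: (@le_trans _ _ (1 + x)^-1); first by rewrite lef_pV2 ?posrE ?expR_gt0.
rewrite -(ler_pM2l x1) divff ?gt_eqF // !expr2.
by have := mulr_ge0 x0 (sqr_ge0 x); rewrite expr2; lra.
Qed.

Lemma leaf_weight01 : 0 <= z <= 1.
Proof. by rewrite expR_ge0 -expR0 ler_expR oppr_le0 ltW // leaf_rate_gt0. Qed.

Lemma open_prob01 : 0 <= mu / q%:R <= 1.
Proof.
have /andP[m1 mq] := mu1.
have q0 : 0 < q%:R :> R by rewrite ltr0n; case: (q) q2.
by rewrite divr_ge0 ?ler_pdivrMr ?mul1r //; lra.
Qed.

Lemma treegf_gain T x v : v \in nb x -> v \notin T ->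
  c1 * q%:R ^+ k <= esc nb R T k x v -> treegf nb T z (mu / q%:R) k x v <= 1 - gain.
Proof.
move=> vx vT he; have /andP[m1 mq] := mu1.
have q0 : 0 < q%:R :> R by rewrite ltr0n; case: (q) q2.
have /andP[p0 _] := open_prob01; have s0 := leaf_rate_gt0.
have xv : x \in nb v by rewrite (adj_sym G).
have K0 : 0 < K by exact: lt_le_trans K1.
apply: le_trans (treegf_le G deg q2 mu1 (ltW s0) KE K1 (expRN_le (ltW s0)) leaf_weight01 xv vT _) _.
  by rewrite sE; lra.
rewrite sE lerD2l lerN2.
have h : gain <= s * (c1 * q%:R ^+ k * (mu / q%:R) ^+ k) * (1 - 1 / 2).
  have -> : c1 * q%:R ^+ k * (mu / q%:R) ^+ k = c1 * mu ^+ k.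
    by rewrite -mulrA -exprMn mulrC (mulrC q%:R) divfK ?gt_eqF // mulrC.
  rewrite /gain ler_pdivrMr ?mulr_gt0 //.
  have -> : s * (c1 * mu ^+ k) * (1 - 1 / 2) * (4 * K) = c1 * (2 * (s * (K * mu ^+ k))).
    by field.
  by rewrite sE; lra.
apply: le_trans h _; apply: ler_wpM2r; first by lra.
by rewrite ler_pM2l // ler_wpM2r ?exprn_ge0.
Qed.

(* [y ^ |F| z ^ |T|] is a supermartingale along the exploration, and it is at least [1]
   when [F] is so large that [good_edge] no longer applies. *)
Lemma explored_secures m : forall l T D qf F, (M - size T <= m)%N ->
  c1 * q.+1%:R * M%:R <= (size F + l)%:R -> uniq T -> explored nb o p T D qf ->
  kept nb p2 F qf ->
  secures (reach nb o M) (oriented_edge nb) qf (1 - y ^+ size F * z ^+ size T).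
Proof.
have Emono := @reach_mono _ nb o M.
have large T D qf (F : seq (V * V)) : uniq T -> explored nb o p T D qf -> (M <= size T)%N ->
    secures (reach nb o M) (oriented_edge nb) qf (1 - y ^+ size F * z ^+ size T).
  move=> uT he MT; apply: (secures_sure Emono (D := D)).
  - exact: explored_weights he.
  - by rewrite lerBlDr lerDl mulr_ge0 // exprn_ge0 // expR_ge0.
  - exact: explored_oriented he.
  - by move=> e /(explored_open he) [].
  - by exists T; split=> //; exact: explored_conn he.
have stuck T D qf (F : seq (V * V)) : explored nb o p T D qf ->
    c1 * q.+1%:R * (size T)%:R <= (size F)%:R ->
    secures (reach nb o M) (oriented_edge nb) qf (1 - y ^+ size F * z ^+ size T).
  move=> he hF; apply: secures_le0; first exact: explored_weights he.
  rewrite subr_le0 /y /z -!expRM_natl -expRD -[leLHS]expR0 ler_expR.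
  have cq : 0 < c1 * q.+1%:R by rewrite mulr_gt0 // edge_const_gt0.
  rewrite mulrN subr_ge0 mulrA ler_pdivlMr //.
  by apply: le_trans (ler_wpM2r (ltW leaf_rate_gt0) hF); rewrite mulrC mulrA.
(* Outer induction on the number of vertices missing from [M]; the inner one is on the failures left
   before [F] is too large for every [T] with fewer than [M] vertices. *)
elim: m => [|m IHm] l T D qf F hm hl uT he hk; first by apply: large _ _ _ _ uT he _ => //; rewrite -subn_eq0 -leqn0.
have [MT|TM] := leqP M (size T); first exact: large _ _ _ _ uT he MT.
elim: l D qf F hl he hk => [|l IHl] D qf F hl he hk.
  rewrite addn0 in hl; apply: (stuck _ _ _ _ he); apply: le_trans hl.
  by rewrite ler_wpM2l ?ler_nat ?(ltnW TM) // mulr_ge0 // ltW // edge_const_gt0.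
have [hF|hF] := leP (c1 * q.+1%:R * (size T)%:R) (size F)%:R; first exact: stuck _ _ _ _ he hF.
have [x [v [xT vT vx eF hesc]]] := good_edge G deg q2 t01 Anorm uT k hF.
have oe := oriented_orient G vx.
have closed : secures (reach nb o M) (oriented_edge nb) (upd qf (orient x v) 0)
    (1 - y ^+ (size F).+1 * z ^+ size T).
  apply: (IHl D _ (orient x v :: F)).
  - by rewrite /= addSnnS.
  - by apply: explored_close => //; rewrite lexx ler01.
  - exact: kept_close.
(* The tree behind [v] is explored with the obstacle [T] frozen. Whatever its outcome, the cluster
   has gained [v], so the outer induction hypothesis serves as continuation. *)
have opened : secures (reach nb o M) (oriented_edge nb) (upd qf (orient x v) 1)
    (1 - y ^+ size F * z ^+ size T * (1 - gain)).
  pose children := if k is k'.+1 then [seq (v, w, k') | w <- nb v & (w != x) && (w \notin T)] else [::].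
  have vert : tree_vertices nb T k x v = v :: flatten (map (root_vertices nb T) children).
    rewrite /children; case: (k) => [//|j'] /=; congr (_ :: _).
    by rewrite -map_comp.
  have final T' D' q' : uniq T' -> explored nb o p T' D' q' -> kept nb p2 F q' ->
      (size (v :: T) <= size T')%N ->
      secures (reach nb o M) (oriented_edge nb) q' (1 - y ^+ size F * z ^+ size T').
    move=> uT' he' hk' hT'; apply: (IHm l.+1 T' D') => //.
    apply: leq_trans (leq_sub2l M hT') _ => /=.
    by rewrite subnS -ltnS prednK // subn_gt0.
  have he' := explored_step G he xT vT vx.
  have uv : uniq ((v :: T) ++ flatten (map (root_vertices nb T) children)).
    rewrite /= mem_cat negb_or vT /=.
    have := uniq_tree G girth T vx kL; rewrite vert /= => /andP[-> uf].
    rewrite cat_uniq uT uf andbT /=; apply/hasPn => w wf.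
    by apply: (@tree_vertices_notin _ nb T k x v) => //; rewrite vert inE wf orbT.
  have pend w : w \in children -> pending nb p (v :: T) (upd qf (orient x v) 1) w.
    rewrite /children => wc.
    have : w.1.2 \notin v :: T.
      apply/negP => wT; move: uv; rewrite cat_uniq => /and3P[_ /hasPn h _].
      have wf : w.1.2 \in flatten (map (root_vertices nb T) children).
        apply/flattenP; exists (root_vertices nb T w); first exact: map_f.
        by rewrite /root_vertices mem_tree_root.
      by have := h _ wf; rewrite /= wT.
    move: wc; case: (k) => [//|j'] /mapP[a].
    rewrite mem_filter => /andP[_ av] -> /=; rewrite inE negb_or => /andP[av' aT].
    split; rewrite /= ?mem_head // upd_other.
      apply: (explored_fresh he); first exact: oriented_orient.
        by case: (orientP v a) => ->.
      by case: (orientP v a) => ->.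
    apply/eqP => /orient_eq /orP[] /eqP e; first by rewrite -e xT in vT.
    by rewrite -e xT in aT.
  have /andP[p20 p21] := p2_01; have /andP[z0 z1] := leaf_weight01.
  have Y0 : 0 <= y ^+ size F by rewrite exprn_ge0 // expR_ge0.
  have hx := explore_forest G open_prob01 p2_01 pE leaf_weight01 Y0 final (leqnn _) uv he'
    (kept_upd _ p21 hk) (leqnn _) pend.
  apply: secures_mono hx.
  rewrite lerD2l lerN2 -!mulrA ler_wpM2l // [size (_ :: _)]/= exprSr -mulrA.
  rewrite ler_wpM2l ?exprn_ge0 //.
  apply: le_trans (treegf_gain vx vT hesc).
  rewrite /children; case: (k) => [|j'] /=; first by rewrite big_nil mulr1.
  rewrite big_map big_filter /=; apply: ler_piMl => //.
  by apply: prodr_ge0 => w _; exact: (root_gf_ge0 nb open_prob01 T leaf_weight01 (v, w, j')).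
(* A failed sprinkling leaves parameter [0]; [gainE] states that success and failure balance. *)
have := secures_split Emono (explored_weights he) oe p2_01 (_ : 0 <= 0 <= 1) _ opened closed.
rewrite mulr0 addr0 lexx ler01 => /(_ isT (hk _ oe eF)).
apply: secures_mono; rewrite exprS; set X := y ^+ size F; set Z := z ^+ size T.
have XZ : 0 <= X * Z by rewrite mulr_ge0 ?exprn_ge0 ?expR_ge0.
by have := ler_wpM2l XZ gainE; lra.
Qed.

(** The exploration starts from [[:: o]] with no failures, where the potential is [expR (- s)]
    whatever [M] is. *)
Theorem cluster_secures :
  secures (reach nb o M) (oriented_edge nb) (fun=> p) (1 - expR (- s)).
Proof.
have [l hl] : exists l : nat, c1 * q.+1%:R * M%:R <= (size (Nil (V * V)) + l)%:R.
  by exists (Num.truncn (c1 * q.+1%:R * M%:R)).+1; rewrite ltW // truncnS_gt.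
have /andP[a b] := open_prob01; have /andP[c e] := p2_01.
have := @explored_secures M l [:: o] [::] (fun=> p) [::] (leq_subr _ _) hl isT.
rewrite expr0 expr1 mul1r; apply; first split => //.
- by move=> v; rewrite inE => /eqP ->; exact: open_conn_refl.
- move=> f _ _; apply: le_trans pE.
  have e' : 0 <= 1 - p2 by rewrite subr_ge0.
  by have := mulr_ge0 a e'; lra.
Qed.

End Growth.

(** * Percolation probabilities *)

Section MeasurablePredicates.
Context d (T : measurableType d).
Implicit Types Q : T -> Prop.

Lemma measurable_conj Q Q' : measurable [set w | Q w] -> measurable [set w | Q' w] ->
  measurable [set w | Q w /\ Q' w].
Proof. exact: measurableI. Qed.

Lemma measurable_not Q : measurable [set w | Q w] -> measurable [set w | ~ Q w].
Proof. exact: measurableC. Qed.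

Lemma measurable_prop (B : Prop) : measurable [set w : T | B].
Proof.
have [b|b] := pselect B.
  by rewrite (_ : [set _ | _] = setT) //; apply/seteqP; split.
by rewrite (_ : [set _ | _] = set0) //; apply/seteqP; split.
Qed.

Lemma measurable_ex (I : countType) (Q : I -> T -> Prop) :
  (forall i, measurable [set w | Q i w]) -> measurable [set w | exists i, Q i w].
Proof.
move=> h; rewrite (_ : [set _ | _] = \bigcup_i [set w | Q i w]).
  by apply: countable_bigcupT_measurable => //; exact: countableP.
by apply/seteqP; split=> [w [i ?]|w [i _ ?]]; exists i.
Qed.

Lemma measurable_all (I : countType) (Q : I -> T -> Prop) :
  (forall i, measurable [set w | Q i w]) -> measurable [set w | forall i, Q i w].
Proof.
move=> h; rewrite (_ : [set _ | _] = [set w | ~ exists i, ~ Q i w]).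
  by apply: measurable_not; apply: measurable_ex => i; exact: measurable_not.
apply/seteqP; split=> w /=; first by move=> hw [i]; apply.
by move=> hw i; apply: contrapT => hi; apply: hw; exists i.
Qed.

Lemma measurable_imply Q Q' : measurable [set w | Q w] -> measurable [set w | Q' w] ->
  measurable [set w | Q w -> Q' w].
Proof.
move=> h h'; rewrite (_ : [set _ | _] = [set w | ~ (Q w /\ ~ Q' w)]).
  by apply: measurable_not; apply: measurable_conj => //; exact: measurable_not.
apply/seteqP; split=> w /=; first by move=> hw [/hw].
by move=> hw q; apply: contrapT => q'; apply: hw.
Qed.

End MeasurablePredicates.

Section PercolationEvents.
Variables (V : countType) (nb : V -> seq V).
Hypothesis G : graph_ok nb.

Lemma infinite_setP (A : set V) : infinite_set A <-> forall s : seq V, exists y, y \notin s /\ A y.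
Proof.
split=> [inf s|h /finite_seqP [s As]].
  apply: contrapT => h; apply: inf; apply: (@sub_finite_set _ _ [set` s]).
    by move=> x Ax /=; apply: contrapT => xs; apply: h; exists x; split=> //; apply/negP.
  exact: finite_seq.
by have [y [ys]] := h s; rewrite As /= (negbTE ys).
Qed.

Lemma infinite_reach w x : (forall M, reach nb x M w) -> infinite_set (Defs.cluster nb w x).
Proof.
move=> h; apply/infinite_setP => s; have [l [ul sl hl]] := h (size s).+1.
have : ~~ all (fun y => y \in s) l.
  apply/negP => /allP ls; have := uniq_leq_size ul ls.
  by rewrite leqNgt sl.
by move=> /allPn [y yl ys]; exists y; split=> //; exact: hl.
Qed.

Context d (Omega : measurableType d).
Variable X : V * V -> Omega -> bool.
Hypothesis mX : forall e, oriented_edge nb e -> measurable [set w | X e w].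

(** Paths consult oriented edges only, so measurability of these suffices; this covers the
    coordinate maps on the sigma-algebra of [cylinders] too. *)
Lemma measurable_open_conn x y : measurable [set w | open_conn nb (X^~ w) x y].
Proof.
apply: measurable_ex => s; apply: measurable_conj; last exact: measurable_prop.
elim: s x => [|z s IH] x /=; first exact: (measurable_prop _ true).
rewrite (_ : [set _ | _] = [set w | (adj nb x z /\ X (orient x z) w) /\
    path (fun u v => adj nb u v && X (orient u v) w) z s]); last first.
  apply/seteqP; split=> w /=; first by move=> /andP[/andP[]].
  by move=> [[-> ->] ->].
apply: measurable_conj => //.
have [xz|xz] := boolP (adj nb x z); last first.
  by rewrite (_ : [set _ | _] = set0) //; apply/seteqP; split=> w //= [].
rewrite (_ : [set _ | _] = [set w | X (orient x z) w]).
  by apply: mX; exact: oriented_orient.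
by apply/seteqP; split=> w //= [].
Qed.

Lemma measurable_infinite_cluster x :
  measurable [set w | infinite_set (Defs.cluster nb (X^~ w) x)].
Proof.
rewrite (_ : [set _ | _] = [set w | forall s : seq V, exists y, y \notin s /\ open_conn nb (X^~ w) x y]).
  apply: measurable_all => s; apply: measurable_ex => y; apply: measurable_conj.
    exact: measurable_prop.
  exact: measurable_open_conn.
by apply/seteqP; split=> w /= /infinite_setP.
Qed.

Lemma measurable_has_infinite : measurable [set w | has_infinite_cluster nb (X^~ w)].
Proof. by apply: measurable_ex => x; exact: measurable_infinite_cluster. Qed.

Lemma measurable_has_unique : measurable [set w | has_unique_infinite_cluster nb (X^~ w)].
Proof.
apply: measurable_conj; first exact: measurable_has_infinite.
apply: measurable_all => x; apply: measurable_all => y.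
apply: measurable_imply; first exact: measurable_infinite_cluster.
apply: measurable_imply; first exact: measurable_infinite_cluster.
exact: measurable_open_conn.
Qed.

Lemma measurable_reach x M : measurable [set w | reach nb x M (X^~ w)].
Proof.
apply: measurable_ex => s.
rewrite (_ : [set _ | _] = [set w | (uniq s /\ (M <= size s)%N) /\
    (forall y, y \in s -> open_conn nb (X^~ w) x y)]).
  apply: measurable_conj; first exact: measurable_prop.
  apply: measurable_all => y; apply: measurable_imply; first exact: measurable_prop.
  exact: measurable_open_conn.
by apply/seteqP; split=> w /=; [move=> []|move=> [[]]].
Qed.

End PercolationEvents.

(** * From finite products to an arbitrary model *)

Section ValueProbability.
Variables (V : countType) (nb : V -> seq V) (R : realType) (p : R).
Context d (Omega : measurableType d).
Variables (P : probability Omega R) (X : V * V -> Omega -> bool).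
Hypothesis perc : bernoulli_percolation nb p P X.
Variable EV : (V * V -> bool) -> Prop.

Let E := (V * V)%type.

(** [pre] holds the edges already revealed, [Es] those to come, and the rest is closed; moving an
    edge from [Es] to [pre] mirrors one level of [evprob]. *)
Definition partial_event (pre : seq E) (b : E -> bool) (Es : seq E) := [set w |
  (forall e, e \in pre -> X e w = b e) /\
  EV (fun e => if e \in pre then b e else (e \in Es) && X e w)].

Lemma partial_event_split pre b e Es : e \notin pre -> e \notin Es ->
  partial_event pre b (e :: Es) =
  partial_event (e :: pre) (upd b e true) Es `|` partial_event (e :: pre) (upd b e false) Es.
Proof.
move=> epre eEs; have ne e' : e' \in pre -> e' != e by move=> h; apply: contraNneq epre => <-.
have key v w : X e w = v ->
  (partial_event pre b (e :: Es) w <-> partial_event (e :: pre) (upd b e v) Es w).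
  move=> hv; rewrite /partial_event /=.
  have -> : (fun e' => if e' \in e :: pre then upd b e v e' else (e' \in Es) && X e' w) =
      (fun e' => if e' \in pre then b e' else (e' \in e :: Es) && X e' w).
    apply/funext => e'; rewrite !inE; have [->|e'e] := eqVneq e' e.
      by rewrite (negbTE epre) upd_same /= hv.
    by rewrite upd_other.
  split=> -[h1 h2]; split=> // e'.
    by rewrite inE => /orP[/eqP ->|he']; [rewrite upd_same|rewrite upd_other ?ne // h1].
  by move=> he'; rewrite h1 ?inE ?he' ?orbT // upd_other // ne.
apply/seteqP; split=> w.
  by move=> hw; case hX : (X e w); [left|right]; apply/(key _ _ hX).
by move=> [] hw; have [h1 _] := hw; have := h1 e (mem_head _ _); rewrite upd_same => hX;
  apply/(key _ _ hX).
Qed.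

Lemma measurable_cylinder (s : seq E) (b : E -> bool) :
  measurable [set w | forall e, e \in s -> X e w = b e].
Proof.
apply: measurable_all => e; apply: measurable_imply; first exact: measurable_prop.
case: perc => mX _.
case: (b e); first exact: mX.
rewrite (_ : [set _ | _] = [set w | ~ X e w]); first exact: measurable_not.
by apply/seteqP; split=> w /=; [move=> ->|move=> /negP/negbTE].
Qed.

Lemma partial_event_evprob Es : forall pre b, uniq (pre ++ Es) -> all (oriented_edge nb) (pre ++ Es) ->
  measurable (partial_event pre b Es) /\
  P (partial_event pre b Es) = ((\prod_(e <- pre) (if b e then p else 1 - p)) *
    evprob EV Es (fun=> p) (fun e => (e \in pre) && b e))%:E.
Proof.
elim: Es => [|e Es IH] pre b; rewrite ?cats0 => upre opre.
  have fE w : (fun e => if e \in pre then b e else (e \in [::]) && X e w) =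
      (fun e => (e \in pre) && b e).
    by apply/funext => e; case: ifP.
  have [ev|nev] := pselect (EV (fun e => (e \in pre) && b e)).
    have -> : partial_event pre b [::] = [set w | forall e, e \in pre -> X e w = b e].
      by apply/seteqP; split=> w /=; rewrite /partial_event /= (fE w) // => -[].
    split; first exact: measurable_cylinder.
    by case: perc => _ ->; rewrite //= asboolT // mulr1.
  have -> : partial_event pre b [::] = set0.
    by apply/seteqP; split=> w //=; rewrite /partial_event /= (fE w) => -[_ /nev].
  by rewrite measure0 /= asboolF // mulr0.
have perm : perm_eq (pre ++ e :: Es) ((e :: pre) ++ Es).
  by rewrite -cat1s perm_catCA.
have u2 : uniq ((e :: pre) ++ Es) by rewrite -(perm_uniq perm).
have o2 : all (oriented_edge nb) ((e :: pre) ++ Es) by rewrite -(perm_all _ perm).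
have /andP[+ _] := u2; rewrite mem_cat negb_or => /andP[epre eEs].
have [m1 P1] := IH (e :: pre) (upd b e true) u2 o2.
have [m2 P2] := IH (e :: pre) (upd b e false) u2 o2.
have sub v : \prod_(e' <- pre) (if upd b e v e' then p else 1 - p) =
    \prod_(e' <- pre) (if b e' then p else 1 - p).
  by apply: eq_big_seq => e' he'; rewrite upd_other //; apply: contraNneq epre => <-.
have fE v : (fun e' => (e' \in e :: pre) && upd b e v e') =
    upd (fun e' => (e' \in pre) && b e') e v.
  by apply/funext => e'; rewrite inE /upd; case: eqVneq.
rewrite (partial_event_split b epre eEs); split; first exact: measurableU.
rewrite measureU //; last first.
  apply/seteqP; split=> w //= -[[h1 _] [h2 _]].
  have := h1 e (mem_head _ _); rewrite h2 ?mem_head //.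
  by rewrite /upd eqxx.
rewrite [X in (X + _)%E]P1 [X in (_ + X)%E]P2 -EFinD !fE !big_cons !upd_same !sub /=.
by congr (_%:E); ring.
Qed.

Lemma evprob_probability Es : uniq Es -> all (oriented_edge nb) Es ->
  measurable [set w | EV (fun e => (e \in Es) && X e w)] /\
  P [set w | EV (fun e => (e \in Es) && X e w)] = (evprob EV Es (fun=> p) (fun=> false))%:E.
Proof.
move=> uE oE; have := @partial_event_evprob Es [::] (fun=> false) uE oE.
rewrite big_nil mul1r (_ : partial_event _ _ _ = [set w | EV (fun e => (e \in Es) && X e w)]) //.
by apply/seteqP; split=> w /=; [case|split].
Qed.

Lemma secures_probability c : (forall w w' : E -> bool, (forall e, w e -> w' e) -> EV w -> EV w') ->
  measurable [set w | EV (X^~ w)] ->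
  secures EV (oriented_edge nb) (fun=> p) c -> (c%:E <= P [set w | EV (X^~ w)])%E.
Proof.
move=> emono mE [Es0 [hE0 h]].
have o1 : all (oriented_edge nb) (undup Es0).
  by apply/allP => e; rewrite mem_undup; exact: (allP hE0).
have [m1 P1] := evprob_probability (undup_uniq Es0) o1.
have := h _ (undup_uniq Es0) (fun e => _); rewrite -lee_fin -P1 => hc.
apply: (le_trans (hc _)); first by move=> e; rewrite mem_undup.
apply: le_measure; rewrite ?inE; [exact: m1|exact: mE|].
by move=> w; apply: emono => e /andP[].
Qed.

End ValueProbability.

(** * Upper bound on the percolation threshold *)

Section CriticalProbability.
Variable R : realType.

Lemma expR_le_1D2x (x : R) : 0 <= x <= 1 / 2 -> expR x <= 1 + 2 * x.
Proof.
move=> /andP[x0 x1]; have h1 : 1 - x <= expR (- x) by exact: expR_ge1Dx.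
have x2 : 0 < 1 - x by lra.
rewrite -[x in expR x]opprK expRN; apply: (@le_trans _ _ (1 - x)^-1).
  by rewrite lef_pV2 ?posrE ?expR_gt0.
rewrite -(ler_pM2l x2) divff ?gt_eqF //.
by have := mulr_ge0 x0 (_ : 0 <= 1 - 2 * x); rewrite subr_ge0 => /(_ _); nra.
Qed.

(* Strictly between [1 / q] and [1 / (t q)]. *)
Definition supercritical (t : R) (q : nat) : R := (1 + 2 / 3 * (t^-1 - 1)) / q%:R.

(** Continuity from above along the decreasing events [reach nb o M]. *)
Lemma reach_infinite (V : countType) (nb : V -> seq V) (o : V) (p c : R) :
  graph_ok nb -> 0 < c ->
  (forall M, secures (reach nb o M) (oriented_edge nb) (fun=> p) c) ->
  prob_pos nb p (has_infinite_cluster nb).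
Proof.
move=> G c0 h d Omega P X perc.
have mX e : oriented_edge nb e -> measurable [set w | X e w] by move=> _; case: perc.
pose A M := [set w | reach nb o M (X^~ w)].
have mA M : measurable (A M) by exact: measurable_reach.
have hA M : (c%:E <= P (A M))%E.
  by apply: (secures_probability perc) (h M); [exact: reach_mono|exact: mA].
have mI : measurable (\bigcap_M A M) by exact: bigcapT_measurable.
have A_noninc : {homo A : n m / (n <= m)%N >-> (m <= n)%O}.
  by move=> n m nm; apply/subsetPset => w [s [us ss hs]]; exists s; split=> //; exact: leq_trans ss.
have cvA := nonincreasing_cvg_mu (_ : (P (A 0%N) < +oo)%E) mA mI A_noninc.
have hI : (c%:E <= P (\bigcap_M A M))%E.
  rewrite -(cvg_lim _ (cvA _)) //; last by rewrite -ge0_fin_numE // fin_num_measure.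
  by apply: lime_ge; [apply/cvg_ex; exists (P (\bigcap_M A M)); apply: cvA; rewrite -ge0_fin_numE // fin_num_measure|near=> n; exact: hA].
apply: (lt_le_trans (_ : (0 < c%:E)%E)); first by rewrite lte_fin.
apply: le_trans hI _; apply: le_measure; rewrite ?inE //.
  exact: (measurable_has_infinite G mX).
by move=> w hw; exists o; apply: infinite_reach => M; exact: hw.
Unshelve. all: by end_near.
Qed.

Theorem infinite_cluster_large_girth (t : R) : 9 / 10 <= t < 1 ->
  exists k : nat, forall (V : countType) (nb : V -> seq V) (q : nat),
    graph_ok nb -> (forall x, size (nb x) = q.+1) -> (2 <= q)%N ->
    (forall f : V -> R, fins f ->
      ip (adjop nb f) (adjop nb f) <= (t * q.+1%:R) ^+ 2 * ip f f) ->
    girth_ge nb (2 * k + 1) ->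
    prob_pos nb (supercritical t q) (has_infinite_cluster nb).
Proof.
move=> t01; have /andP[t9 t1] := t01.
have t0 : 0 < t by lra.
pose gam := t^-1 - 1.
have tV : t * t^-1 = 1 by rewrite divff // gt_eqF.
have gam0 : 0 < gam by rewrite subr_gt0 invf_gt1.
have gam1 : gam <= 1 / 9.
  rewrite lerBlDr -(ler_pM2l t0) tV; lra.
(* One third of the gap [gam] is for branching and one third for sprinkling; the last keeps their
   sum below [1 / t]. *)
pose mu := 1 + gam / 3; pose del := gam / 3.
have del0 : 0 < del by rewrite /del; lra.
have mu_gt1 : 1 < mu by rewrite /mu; lra.
pose K := mu / 2 / del.
have KE : K * (mu - 1) = mu / 2.
  have -> : mu - 1 = del by rewrite /mu /del; ring.
  by rewrite /K divfK // gt_eqF.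
have K1 : 1 <= K by rewrite /K ler_pdivlMr // /mu /del; lra.
have K0 : 0 < K by exact: lt_le_trans K1.
have ec0 := escape_const_gt0 t01.
have ec1 : escape_const t <= 1.
  have : ((1 - t) / 24) ^+ 2 <= 1 by rewrite expr_le1 //; lra.
  by rewrite /escape_const; lra.
pose c1 := escape_const t / 3; have c10 : 0 < c1 by rewrite /c1; lra.
pose gain := c1 / (4 * K).
have K40 : 0 < 4 * K by rewrite mulr_gt0.
have gain0 : 0 < gain by rewrite divr_gt0.
have gain1 : gain <= 1.
  by apply: mulr_ile1; rewrite ?invr_ge0 ?invf_le1 ?(ltW c10) ?(ltW K40) //; rewrite /c1; lra.
have K20 : 0 < 2 * K by rewrite mulr_gt0.
have eta0 : 0 < c1 * del * gain / 2 * (2 * K).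
  apply: mulr_gt0 => //; apply: divr_gt0 => //; apply: mulr_gt0 => //.
  exact: mulr_gt0.
(* [k] and [s] depend on [t] only. A small [s] makes the cost [y - 1] of a failure small against the
   gain of a success. *)
have [k hk] : exists k, (mu^-1) ^+ k < c1 * del * gain / 2 * (2 * K).
  apply: expr_small => //; rewrite invr_ge0 invf_lt1; lra.
pose s := mu^-1 ^+ k / (2 * K).
have muk : 0 < mu ^+ k by rewrite exprn_gt0 //; lra.
have s0 : 0 < s by rewrite /s exprVn divr_gt0 ?invr_gt0 // mulr_gt0.
have sE : s * (K * mu ^+ k) = 1 / 2.
  by rewrite /s exprVn; field; rewrite !gt_eqF.
have sle : s <= c1 * del * gain / 2 by rewrite /s ler_pdivrMr // ltW.
exists k => V nb q G deg q2 Anorm girth.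
have [v0 _] := exists_notin G [::].
have q2' : 2 <= q%:R :> R by rewrite ler_nat.
have q0 : 0 < q%:R :> R by lra.
have pD : supercritical t q = mu / q%:R + del / q%:R.
  by rewrite /supercritical -/gam -mulrDl; congr (_ / _); rewrite /mu /del; field.
have c : 0 < 1 - expR (- s).
  by rewrite subr_gt0 -expR0 ltr_expR oppr_lt0.
apply: (reach_infinite (o := v0) G c) => M.
have mq : mu <= q%:R by rewrite /mu; lra.
have p2_01 : 0 <= del / q%:R <= 1.
  by rewrite divr_ge0 ?(ltW del0) ?(ltW q0) //= ler_pdivrMr // mul1r /del; lra.
apply: (@cluster_secures _ nb R G v0 M q k (2 * k + 1)%N t mu s K _ (del / q%:R)) => //.
- by rewrite mu_gt1.
- rewrite pD -mulrDl divr_ge0 ?(ltW q0) //=; last by rewrite addr_ge0 // ltW //; lra.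
  by rewrite ler_pdivrMr // mul1r /mu /del; lra.
- rewrite pD lerD2l; apply: ler_piMl; first by case/andP: p2_01.
  by rewrite gerBl divr_ge0 ?(ltW q0) // ltW //; lra.
rewrite -/c1 -/gain.
have q1 : 0 < q.+1%:R :> R by rewrite ltr0n.
have qq : q%:R <= q.+1%:R :> R by rewrite ler_nat.
set x := s / (c1 * q.+1%:R).
have cq0 : 0 < c1 * q.+1%:R by exact: mulr_gt0.
have x0 : 0 <= x by rewrite divr_ge0 // ltW.
have dg : 0 <= del * gain by rewrite mulr_ge0 // ltW.
have xle : x <= del * gain / 2 / q%:R.
  apply: (@le_trans _ _ (del * gain / 2 / q.+1%:R)).
    rewrite /x ler_pdivrMr //.
    have -> : del * gain / 2 / q.+1%:R * (c1 * q.+1%:R) = c1 * del * gain / 2.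
      by field; rewrite gt_eqF.
    by [].
  by rewrite ler_wpM2l ?lef_pV2 ?posrE // divr_ge0.
have xle2 : x <= del / q%:R * gain / 2.
  by apply: le_trans xle _; rewrite le_eqVlt; apply/orP; left; apply/eqP; ring.
have /andP[d0 d1] := p2_01.
set D := del / q%:R in d0 d1 xle2 *.
have Dg0 : 0 <= D * gain by rewrite mulr_ge0 // ltW.
have Dg1 : D * gain <= 1 by rewrite mulr_ile1 // ltW.
have x01 : 0 <= x <= 1 / 2 by rewrite x0 /=; lra.
have hy := expR_le_1D2x x01.
have D1 : 0 <= 1 - D by rewrite subr_ge0.
(* With [y <= 1 + D gain], the mean [D (1 - gain) + (1 - D) y] is at most [1 - D^2 gain]. *)
have := ler_wpM2l D1 (le_trans hy (_ : 1 + 2 * x <= 1 + D * gain)).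
have -> : (1 + 2 * x <= 1 + D * gain) by lra.
move=> /(_ isT); have := mulr_ge0 d0 Dg0; lra.
Qed.

End CriticalProbability.

(** * A percolation model on the unit interval *)

Section BernoulliSequence.
Variables (R : realType) (p : R).
Hypothesis p01 : 0 <= p < 1.

Let one_gt0 : 0 < (1 : R). Proof. exact: ltr01. Qed.
Let P : probability (measurableTypeR R) R := uniform_prob one_gt0.

(* Expansion of [w] in [0, 1[ with respect to repeated subdivision of intervals in
   the ratio [p : 1 - p]; under the uniform law its digits are independent. *)
Definition digit_shift (w : R) : R := if w < p then w / p else (w - p) / (1 - p).
Definition digit n (w : R) : bool := iter n digit_shift w < p.

Lemma digitS n w : digit n.+1 w = digit n (digit_shift w).
Proof. by rewrite /digit iterSr. Qed.

Lemma digit_shift01 w : 0 <= w < 1 -> 0 <= digit_shift w < 1.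
Proof.
have /andP[p0 p1] := p01; move=> /andP[w0 w1]; rewrite /digit_shift.
have p1' : 0 < 1 - p by rewrite subr_gt0.
case: ltP => wp.
  have pp : 0 < p by exact: le_lt_trans wp.
  by rewrite divr_ge0 //= ltr_pdivrMr // mul1r.
by rewrite divr_ge0 ?subr_ge0 ?(ltW p1) //= ltr_pdivrMr // mul1r ltrD2r.
Qed.

Definition bweight (v : bool) : R := if v then p else 1 - p.

(** [digit_shift] is affine on either side of [p], so intervals pull back to intervals, scaled by
    the weight of the digit. *)
Lemma digit_interval n (b : nat -> bool) : exists a, [/\ 0 <= a,
  0 <= \prod_(i < n) bweight (b i), a + \prod_(i < n) bweight (b i) <= 1 &
  forall w, 0 <= w < 1 -> ((forall i, (i < n)%N -> digit i w = b i) <->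
    a <= w < a + \prod_(i < n) bweight (b i))].
Proof.
have /andP[p0 p1] := p01; have p1' : 0 < 1 - p by rewrite subr_gt0.
elim: n b => [|n IH] b.
  by exists 0; rewrite big_ord0; split; rewrite ?add0r.
have [a [a0 l0 al h]] := IH (fun i => b i.+1).
rewrite big_ord_recl /=; set l := \prod_(i < n) _ in a0 l0 al h.
rewrite -[\prod_(i < n) _]/l.
have step w : (forall i, (i < n.+1)%N -> digit i w = b i) <->
    (w < p) = b 0%N /\ (forall i, (i < n)%N -> digit i (digit_shift w) = b i.+1).
  split=> [hw|[h0 h1]].
    by split=> [|i hi]; [exact: (hw 0%N)|rewrite -digitS hw].
  by case=> [_|i hi]; [exact: h0|rewrite digitS h1].
case b0 : (b 0%N); rewrite /bweight.
  exists (p * a); rewrite -mulrDr; split; try by rewrite mulr_ge0.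
    by rewrite mulr_ile1 // ?addr_ge0 // ltW.
  move=> w w01; rewrite step b0; have [w0 w1] := andP w01.
  have h01 := h _ (digit_shift01 w01); rewrite h01 /digit_shift.
  have [wp|wp] := ltP w p.
    have pp : 0 < p by exact: le_lt_trans wp.
    by rewrite ler_pdivlMr // ltr_pdivrMr // !(mulrC p); split=> [[]|].
  split=> [[]//|/andP[_ hw]]; exfalso; move: hw; rewrite ltNge => /negP; apply.
  by apply: le_trans wp; rewrite ler_piMr.
exists (p + (1 - p) * a); rewrite -addrA -mulrDr; split.
- by rewrite addr_ge0 // mulr_ge0 // ltW.
- by rewrite mulr_ge0 // ltW.
- by rewrite -[leRHS](subrK p) addrC lerD2r ler_piMr // ltW.
move=> w w01; rewrite step b0; have [w0 w1] := andP w01.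
have h01 := h _ (digit_shift01 w01); rewrite h01 /digit_shift.
have [wp|wp] := ltP w p.
  split=> [[]//|/andP[hw _]]; exfalso; move: hw; rewrite leNgt => /negP; apply.
  by apply: lt_le_trans wp _; rewrite lerDl mulr_ge0 // ltW.
rewrite ler_pdivlMr // ltr_pdivrMr // lerBrDl ltrBlDl !(mulrC (1 - p)).
by split=> [[]|].
Qed.

Lemma measurable_digit_shift : measurable_fun setT digit_shift.
Proof.
apply: measurable_fun_ifT.
- exact: measurable_fun_ltr.
- exact: measurable_funM.
- apply: measurable_funM => //; exact: measurable_funB.
Qed.

Lemma measurable_digit n : measurable [set w | digit n w].
Proof.
have h : measurable_fun setT (iter n digit_shift).
  elim: n => [|n IH]; first exact: measurable_id.
  exact: (measurableT_comp measurable_digit_shift IH).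
rewrite (_ : [set _ | _] = iter n digit_shift @^-1` `]-oo, p[).
  by rewrite -[X in measurable X]setTI; apply: h.
by apply/seteqP; split=> w /=; rewrite in_itv.
Qed.

Lemma uniform_interval (a b : R) : 0 <= a -> a <= b -> b <= 1 -> P `[a, b[%classic = (b - a)%:E.
Proof.
move=> a0 ab b1; rewrite /P /= /uniform_prob.
rewrite (eq_integral (fun=> 1%:E)); last first.
  move=> x; rewrite inE /= in_itv /= => /andP[ax xb].
  rewrite /uniform_pdf subr0 invr1 ifT // (le_trans a0 ax) /=.
  by rewrite ltW // (lt_le_trans xb).
rewrite integral_cst //= mul1e lebesgue_measure_itv /= lte_fin.
case: ltP => [_|ba]; first by rewrite EFinB.
by have -> : a = b; [apply/eqP; rewrite eq_le ab|rewrite subrr].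
Qed.

Lemma uniform_restrict (A : set R) : measurable A -> P A = P (A `&` `[0, 1[%classic).
Proof.
move=> mA; have m1 : measurable (`[0, 1[%classic : set R) by exact: measurable_itv.
have P1 : P `[0, 1[%classic = 1%:E by rewrite uniform_interval // subr0.
have PC : P (~` `[0, 1[%classic) = 0%E by rewrite probability_setC // P1 subee.
have mD : measurable (A `\` `[0, 1[%classic) by exact: measurableD.
suff h0 : P (A `\` `[0, 1[%classic) = 0%E.
  by rewrite (measureDI P mA m1) [X in (X + _)%E]h0 add0e.
apply/eqP; rewrite eq_le measure_ge0 andbT -PC; apply: le_measure; rewrite ?inE //.
exact: measurableC.
Qed.

Lemma digit_prefix_prob n (b : nat -> bool) :
  P [set w | forall i, (i < n)%N -> digit i w = b i] = (\prod_(i < n) bweight (b i))%:E.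
Proof.
have mA : measurable [set w | forall i, (i < n)%N -> digit i w = b i].
  apply: measurable_all => i; apply: measurable_imply; first exact: measurable_prop.
  case: (b i); first exact: measurable_digit.
  rewrite (_ : [set _ | _] = [set w | ~ digit i w]).
    by apply: measurable_not; exact: measurable_digit.
  by apply/seteqP; split=> w /=; [move=> ->|move=> /negP/negbTE].
have [a [a0 l0 al h]] := digit_interval n b.
rewrite (uniform_restrict mA).
rewrite (_ : _ `&` _ = `[a, a + \prod_(i < n) bweight (b i)[%classic).
  by rewrite uniform_interval ?lerDl // addrAC subrr add0r.
apply/seteqP; split=> w /=; rewrite !in_itv /=.
  by move=> [hw w01]; apply/h.
move=> hw; have w01 : 0 <= w < 1.
  by have /andP[h1 h2] := hw; rewrite (le_trans a0 h1) (lt_le_trans h2 al).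
by split=> //; apply/h.
Qed.

(** An index below [N] missing from [s] is added by summing over its two digit values, until [s] is
    a whole prefix. *)
Lemma digit_prob (s : seq nat) (b : nat -> bool) : uniq s ->
  P [set w | forall i, i \in s -> digit i w = b i] = (\prod_(i <- s) bweight (b i))%:E.
Proof.
have mA t c : measurable [set w | forall i, i \in t -> digit i w = c i].
  apply: measurable_all => i; apply: measurable_imply; first exact: measurable_prop.
  case: (c i); first exact: measurable_digit.
  rewrite (_ : [set _ | _] = [set w | ~ digit i w]).
    by apply: measurable_not; exact: measurable_digit.
  by apply/seteqP; split=> w /=; [move=> ->|move=> /negP/negbTE].
have [N hN] : exists N, {subset s <= iota 0 N}.
  exists (\max_(i <- s) i).+1 => i si; rewrite mem_iota /= add0n ltnS.
  by rewrite (big_rem i) //= leq_maxl.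
move: {2}(N - size s)%N (leqnn (N - size s)%N) => m.
elim: m s b hN => [|m IH] s b hN hm us.
  have sN : perm_eq s (iota 0 N).
    apply: uniq_perm => //; first exact: iota_uniq.
    have sz : (size (iota 0 N) <= size s)%N by rewrite size_iota -subn_eq0 -leqn0.
    exact: (uniq_min_size us hN sz).2.
  rewrite (perm_big _ sN) /= -{1}(subn0 N) -[iota 0 (N - 0)]/(index_iota 0 N) big_mkord -digit_prefix_prob.
  congr (P _); apply/seteqP; split=> w /= hw i hi; apply: hw.
    by rewrite (perm_mem sN) mem_iota.
  by rewrite (perm_mem sN) mem_iota in hi.
have [sub|] := boolP (all (fun i => i \in s) (iota 0 N)).
  apply: IH => //; have := uniq_leq_size (iota_uniq 0 N) (allP sub).
  by rewrite size_iota -subn_eq0 => /eqP ->.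
move=> /allPn [j jN js].
have rec v : P [set w | forall i, i \in j :: s -> digit i w = upd b j v i] =
    (bweight v * \prod_(i <- s) bweight (b i))%:E.
  rewrite IH; last 3 first.
  - by move=> i; rewrite inE => /orP[/eqP ->|/hN].
  - rewrite /= subnS -ltnS prednK //; last first.
    by rewrite subn_gt0 -(size_iota 0 N); apply: (uniq_leq_size (s1 := j :: s)) => /=;
      [rewrite js|move=> i; rewrite inE => /orP[/eqP ->|/hN]].
  - by rewrite /= js.
  rewrite big_cons upd_same; congr (_ * _)%:E; apply: eq_big_seq => i si.
  by rewrite upd_other //; apply: contraNneq js => <-.
have -> : [set w | forall i, i \in s -> digit i w = b i] =
    [set w | forall i, i \in j :: s -> digit i w = upd b j true i] `|`
    [set w | forall i, i \in j :: s -> digit i w = upd b j false i].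
  have ne i : i \in s -> i != j by move=> si; apply: contraNneq js => <-.
  apply/seteqP; split=> w /=.
    move=> hw; case hj : (digit j w); [left|right] => i; rewrite inE => /orP[/eqP ->|si];
      by rewrite ?upd_same // upd_other ?ne // hw.
  by move=> [] hw i si; have := hw i; rewrite inE si orbT upd_other ?ne // => /(_ isT).
rewrite measureU; [|exact: mA|exact: mA|]; last first.
  apply/seteqP; split=> w //= -[h1 h2]; have := h1 j (mem_head _ _).
  by rewrite h2 ?mem_head // !upd_same.
by rewrite [X in (X + _)%E](rec true) [X in (_ + X)%E](rec false) -EFinD -mulrDl /= addrC subrK mul1r.
Qed.

End BernoulliSequence.

(** [prob_pos] quantifies over all models, so refuting it requires one. *)
Lemma percolation_model (V : countType) (nb : V -> seq V) (R : realType) (p : R) :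
  0 <= p < 1 -> exists (P : probability (measurableTypeR R) R) (X : V * V -> R -> bool),
    bernoulli_percolation nb p P X.
Proof.
move=> p01; exists (uniform_prob ltr01), (fun e w => digit p (pickle e) w); split.
  by move=> e; exact: measurable_digit.
move=> s b us _.
pose c n := if unpickle n is Some e then b e else false.
have us' : uniq (map pickle s) by rewrite map_inj_uniq //; exact: pcan_inj pickleK.
have := digit_prob p01 c us'; rewrite big_map /c => h.
transitivity ((\prod_(e <- s) bweight p (c (pickle e)))%:E : \bar R); last first.
  by congr (_%:E); apply: eq_bigr => e _; rewrite /c pickleK.
rewrite /c -h; congr (_ _); apply/seteqP; split=> w /= hw.
  by move=> i /mapP[e es ->]; rewrite pickleK hw.
by move=> e es; rewrite hw ?map_f // pickleK.
Qed.

(** * Uniqueness of the percolation law *)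

Section LawUniqueness.
Variables (V : countType) (nb : V -> seq V) (R : realType) (p : R).
Hypothesis G : graph_ok nb.
Let E := (V * V)%type.

(* The empty set is added for stability under intersection. *)
Definition cylinders : set (set (E -> bool)) := [set A |
  A = set0 \/ exists (s : seq E) (b : E -> bool), [/\ uniq s, all (oriented_edge nb) s &
    A = [set f | forall e, e \in s -> f e = b e]]].

Lemma cylinders_setI : setI_closed cylinders.
Proof.
move=> A B [->|[s [b [us os ->]]]]; first by rewrite set0I; left.
move=> [->|[s' [b' [us' os' ->]]]]; first by rewrite setI0; left.
have [h|h] := pselect (forall e, e \in s -> e \in s' -> b e = b' e); last first.
  left; apply/seteqP; split=> f //= -[hf hf']; apply: h => e es es'.
  by rewrite -hf // hf'.
right; exists (undup (s ++ s')), (fun e => if e \in s then b e else b' e); split.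
- exact: undup_uniq.
- apply/allP => e; rewrite mem_undup mem_cat => /orP[] he; [exact: (allP os)|exact: (allP os')].
apply/seteqP; split=> f /=.
  move=> [hf hf'] e; rewrite mem_undup mem_cat.
  by have [es _|es /= es'] := boolP (e \in s); [exact: hf|exact: hf'].
move=> hf; split=> e es.
  by rewrite hf ?es // mem_undup mem_cat es.
rewrite hf ?mem_undup ?mem_cat ?es ?orbT //; case: ifP => // es'.
exact: h.
Qed.

Context d (Omega : measurableType d).
Variable P : probability Omega R.

Lemma law_measure (X : E -> Omega -> bool) : bernoulli_percolation nb p P X ->
  exists m : {measure set (g_sigma_algebraType cylinders) -> \bar R},
    forall A, m A = P [set w | A (X^~ w)].
Proof.
move=> perc; pose f (w : Omega) : g_sigma_algebraType cylinders := X^~ w.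
have mf : measurable_fun setT f.
  apply: (@measurability _ _ Omega (g_sigma_algebraType cylinders) setT f cylinders) => //.
  move=> A [B [->|[s [b [us os ->]]]]] <-.
    by rewrite preimage_set0 setI0.
  by rewrite setTI; exact: (measurable_cylinder perc).
by exists (measure_function_pushforward__canonical__measure_function_Measure P mf).
Qed.

(** Cylinders are closed under intersection and generate the sigma-algebra, and both laws give them
    the same mass. *)
Lemma law_unique (X X' : E -> Omega -> bool) (EV : (E -> bool) -> Prop) :
  bernoulli_percolation nb p P X -> bernoulli_percolation nb p P X' ->
  measurable ([set f | EV f] : set (g_sigma_algebraType cylinders)) ->
  P [set w | EV (X^~ w)] = P [set w | EV (X'^~ w)].
Proof.
move=> perc perc' mEV.
have [m hm] := law_measure perc; have [m' hm'] := law_measure perc'.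
have cT : cylinders setT.
  by right; exists [::], (fun=> false); split=> //; apply/seteqP; split.
have bT : \bigcup_(k in [set: nat]) ([set: g_sigma_algebraType cylinders]) = setT.
  by rewrite bigcup_const //; exists 0%N.
have eqm A : cylinders A -> m A = m' A.
  move=> [->|[s [b [us os ->]]]]; first by rewrite !measure0.
  by rewrite hm hm' [LHS](proj2 perc s b us os) [RHS](proj2 perc' s b us os).
have fT : (m setT < +oo)%E.
  by rewrite hm -ge0_fin_numE // fin_num_measure // (_ : [set _ | _] = setT).
by rewrite -hm -hm'; exact: (@measure_unique _ R (g_sigma_algebraType cylinders) cylinders
  (fun=> setT) erefl cylinders_setI (fun=> cT) bT m m' eqm (fun=> fT)).
Qed.

Lemma measurable_coordinate e : oriented_edge nb e ->
  measurable ([set f | f e] : set (g_sigma_algebraType cylinders)).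
Proof.
move=> oe; apply: sub_sigma_algebra; right; exists [:: e], (fun=> true); split=> //.
  by rewrite /= oe.
apply/seteqP; split=> f /=; first by move=> fe e'; rewrite inE => /eqP ->.
by apply; exact: mem_head.
Qed.

Definition in_unique_infinite (f : E -> bool) (x : V) : Prop :=
  has_unique_infinite_cluster nb f /\ infinite_set (Defs.cluster nb f x).

Lemma measurable_unique_infinite x :
  measurable ([set f | in_unique_infinite f x] : set (g_sigma_algebraType cylinders)).
Proof.
pose X (e : E) (f : g_sigma_algebraType cylinders) : bool := f e.
have mX e : oriented_edge nb e -> measurable [set w | X e w] by exact: measurable_coordinate.
apply: measurable_conj; first exact: (measurable_has_unique G mX).
exact: (measurable_infinite_cluster G mX).
Qed.

End LawUniqueness.

(** * Invariance under automorphisms *)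

Section Automorphism.
Variables (V : countType) (nb : V -> seq V) (R : realType) (p : R).
Hypothesis G : graph_ok nb.
Let E := (V * V)%type.
Variables (phi psi : V -> V).
Hypothesis phiK : cancel phi psi.
Hypothesis psiK : cancel psi phi.
Hypothesis phi_adj : forall u v, adj nb (phi u) (phi v) = adj nb u v.

(** An automorphism need not respect the order of codes, so the image is reoriented. *)
Definition edge_map (f : V -> V) (e : E) : E := orient (f e.1) (f e.2).

Lemma orient_oriented (e : E) : oriented_edge nb e -> orient e.1 e.2 = e.
Proof. by case: e => x y /andP[_ /= h]; rewrite /orient h. Qed.

Lemma edge_map_orient f x y : edge_map f (orient x y) = orient (f x) (f y).
Proof. by rewrite /edge_map; case: (orientP x y) => -> //=; rewrite orient_sym. Qed.

Lemma edge_mapK e : oriented_edge nb e -> edge_map psi (edge_map phi e) = e.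
Proof. by move=> oe; rewrite {2}/edge_map edge_map_orient !phiK orient_oriented. Qed.

Lemma oriented_edge_map e : oriented_edge nb e -> oriented_edge nb (edge_map phi e).
Proof. by move=> /andP[h _]; apply: oriented_orient => //; rewrite -[_ \in _]/(adj _ _ _) phi_adj. Qed.

Context d (Omega : measurableType d).
Variables (P : probability Omega R) (X : E -> Omega -> bool).
Hypothesis perc : bernoulli_percolation nb p P X.

Lemma percolation_auto : bernoulli_percolation nb p P (fun e => X (edge_map phi e)).
Proof.
case: perc => mX hX; split=> [e|s b us os]; first exact: mX.
have inj : {in s &, injective (edge_map phi)}.
  move=> e e' es es' /(congr1 (edge_map psi)).
  by rewrite !edge_mapK //; apply: (allP os).
have us' : uniq (map (edge_map phi) s) by rewrite map_inj_in_uniq.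
have os' : all (oriented_edge nb) (map (edge_map phi) s).
  by apply/allP => _ /mapP[e es ->]; apply: oriented_edge_map; exact: (allP os).
have := hX _ (fun e => b (edge_map psi e)) us' os'; rewrite big_map => h.
transitivity ((\prod_(e <- s) (if b (edge_map psi (edge_map phi e)) then p else 1 - p))%:E : \bar R).
  rewrite -h; congr (P _); apply/seteqP; split=> w /= hw.
    by move=> _ /mapP[e es ->]; rewrite hw // edge_mapK //; exact: (allP os).
  by move=> e es; rewrite hw ?map_f // edge_mapK //; exact: (allP os).
by congr (_%:E); apply: eq_big_seq => e es; rewrite edge_mapK //; exact: (allP os).
Qed.

Lemma open_conn_auto (f : E -> bool) x y :
  open_conn nb (fun e => f (edge_map phi e)) x y <-> open_conn nb f (phi x) (phi y).
Proof.
split=> [[s [ps ls]]|[s [ps ls]]].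
  exists (map phi s); rewrite last_map ls; split=> //.
  elim: s x ps {ls} => [//|z s IH] x /= /andP[/andP[xz fz] ps].
  by rewrite phi_adj xz -edge_map_orient fz /= IH.
exists (map psi s); rewrite -{2}(phiK x) last_map ls phiK; split=> //.
have : path (fun u v => adj nb u v && f (orient u v)) (phi x) s by [].
elim: s (x) {ps ls} => [//|z s IH] x' /= /andP[/andP[xz fz] ps].
rewrite -(phi_adj x') psiK xz /= edge_map_orient psiK fz /=.
by apply: IH; rewrite psiK.
Qed.

Lemma infinite_cluster_auto (f : E -> bool) x :
  infinite_set (Defs.cluster nb (fun e => f (edge_map phi e)) x) <->
  infinite_set (Defs.cluster nb f (phi x)).
Proof.
split=> /infinite_setP h; apply/infinite_setP => s.
  have [y [ys hy]] := h (map psi s); exists (phi y); split; last exact/open_conn_auto.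
  by apply: contra ys => /(map_f psi); rewrite phiK.
have [y [ys hy]] := h (map phi s); exists (psi y); split.
  by apply: contra ys => /(map_f phi); rewrite psiK.
by apply/open_conn_auto; rewrite psiK.
Qed.

Lemma has_unique_auto (f : E -> bool) :
  has_unique_infinite_cluster nb (fun e => f (edge_map phi e)) <->
  has_unique_infinite_cluster nb f.
Proof.
split=> -[[x hx] h]; split.
- by exists (phi x); exact/infinite_cluster_auto.
- move=> y z hy hz; rewrite -(psiK y) -(psiK z); apply/open_conn_auto.
  by apply: h; apply/infinite_cluster_auto; rewrite psiK.
- by exists (psi x); apply/infinite_cluster_auto; rewrite psiK.
- move=> y z /infinite_cluster_auto hy /infinite_cluster_auto hz.
  by apply/open_conn_auto; exact: h.
Qed.

(** Relabelling edges by [phi] gives another model on the same space, and [law_unique] compares the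
    two. *)
Lemma unique_infinite_invariant x :
  P [set w | in_unique_infinite nb (X^~ w) (phi x)] =
  P [set w | in_unique_infinite nb (X^~ w) x].
Proof.
rewrite [RHS](law_unique perc percolation_auto (measurable_unique_infinite G x)).
have hu w := has_unique_auto (X^~ w); have hi w := infinite_cluster_auto (X^~ w) x.
by congr (P _); apply/seteqP; split=> w /= -[/hu h1 /hi h2].
Qed.

End Automorphism.

Section RealProbability.
Context d (Omega : measurableType d) (R : realType).
Variable P : probability Omega R.
Implicit Types A B : set Omega.

Definition pr A : R := fine (P A).

Lemma prE A : measurable A -> P A = (pr A)%:E.
Proof. by move=> mA; rewrite /pr fineK // fin_num_measure. Qed.

Lemma pr_ge0 A : 0 <= pr A.
Proof. by rewrite /pr fine_ge0. Qed.

Lemma pr_le1 A : measurable A -> pr A <= 1.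
Proof. by move=> mA; rewrite -lee_fin -prE // probability_le1. Qed.

Lemma pr_le A B : measurable A -> measurable B -> A `<=` B -> pr A <= pr B.
Proof. by move=> mA mB AB; rewrite -lee_fin -!prE //; apply: le_measure; rewrite ?inE. Qed.

Lemma pr_setU A B : measurable A -> measurable B ->
  pr (A `|` B) = pr A + pr B - pr (B `&` A).
Proof.
move=> mA mB; have mD : measurable (B `\` A) by exact: measurableD.
have mI : measurable (B `&` A) by exact: measurableI.
have e1 : pr B = pr (B `\` A) + pr (B `&` A).
  by apply: EFin_inj; rewrite EFinD -!prE // (measureDI P mB mA).
have e2 : pr (A `|` B) = pr A + pr (B `\` A).
  have eU : A `|` B = A `|` (B `\` A).
    apply/seteqP; split=> w /=; last by move=> [a|[b _]]; [left|right].
    by move=> [a|b]; [left|have [a|na] := pselect (A w); [left|right]].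
  apply: EFin_inj; rewrite EFinD -!prE //; last exact: measurableU.
  by rewrite eU measureU // setDE setICA setICr setI0.
by rewrite e2 e1; ring.
Qed.

Lemma pr_union_le (I : eqType) (l : seq I) (A : I -> set Omega) :
  (forall i, measurable (A i)) ->
  measurable [set w | exists2 i, i \in l & A i w] /\
  pr [set w | exists2 i, i \in l & A i w] <= \sum_(i <- l) pr (A i).
Proof.
move=> mA; elim: l => [|a l [mI IH]].
  rewrite (_ : [set _ | _] = set0); last by apply/seteqP; split=> w //= [].
  by rewrite big_nil /pr measure0.
have -> : [set w | exists2 i, i \in a :: l & A i w] =
    A a `|` [set w | exists2 i, i \in l & A i w].
  apply/seteqP; split=> w /=.
    by move=> [i]; rewrite inE => /orP[/eqP -> ?|il ?]; [left|right; exists i].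
  by move=> [Aa|[i il Ai]]; [exists a => //; exact: mem_head|exists i => //; rewrite inE il orbT].
split; first exact: measurableU.
rewrite big_cons pr_setU // -addrA lerD2l; apply: le_trans IH.
by rewrite gerBl pr_ge0.
Qed.

End RealProbability.

(** * Decay of the two-point function *)

Section TwoPoint.
Variables (V : countType) (nb : V -> seq V) (R : realType).
Hypothesis G : graph_ok nb.

Fixpoint nbwalks m (u v : V) : seq (seq V) :=
  if m is m'.+1 then
    flatten [seq map (cons w) (nbwalks m' v w) | w <- nb v & w != u]
  else [:: [::]].

Lemma mem_nbwalks s u v : nbwalk nb (u :: v :: s) -> s \in nbwalks (size s) u v.
Proof.
elim: s u v => [//|w s IH] u v /and3P[uv uw h] /=.
apply/flattenP; exists (map (cons w) (nbwalks (size s) v w)); last by rewrite map_f // IH.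
apply/mapP; exists w => //; rewrite mem_filter eq_sym uw /=.
by move: h => /and3P[].
Qed.

Lemma nbwalks_size m u v s : s \in nbwalks m u v -> size s = m.
Proof.
elim: m u v s => [|m IH] u v s /=; first by rewrite inE => /eqP ->.
by case/flattenP => l /mapP[w _ ->] /mapP[s' /IH h ->] /=; rewrite h.
Qed.

Lemma count_nbwalks m u v y :
  (count (fun s => last v s == y) (nbwalks m u v))%:R = nbsum nb (dirac_fun R y) m u v.
Proof.
elim: m u v => [|m IH] u v /=; first by rewrite addn0.
rewrite count_flatten -map_comp sumnE big_map big_filter natr_sum.
apply: eq_bigr => w _; rewrite -IH /= count_map.
by [].
Qed.

Lemma uniq_path_nbwalk s x : path (adj nb) x s -> uniq (x :: s) -> nbwalk nb (x :: s).
Proof.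
elim: s x => [//|y s IH] x /andP[xy ps] /andP[xs us].
apply/and3P; split; [exact: xy| |exact: IH].
by case: s xs {ps us IH} => // z s; rewrite !inE !negb_or => /and3P[].
Qed.

Fixpoint path_edges (x : V) (s : seq V) : seq (V * V) :=
  if s is y :: s' then orient x y :: path_edges y s' else [::].

Lemma path_openE (w : V * V -> bool) x s :
  path (fun u v => adj nb u v && w (orient u v)) x s =
  path (adj nb) x s && all w (path_edges x s).
Proof.
elim: s x => [//|y s IH] x /=; rewrite IH.
by rewrite -!andbA; congr (_ && _); rewrite andbCA.
Qed.

Lemma path_edges_mem x s e : e \in path_edges x s -> (e.1 \in x :: s) && (e.2 \in x :: s).
Proof.
elim: s x => [//|y s IH] x /=; rewrite inE => /orP[/eqP ->|/IH].
  by case: (orientP x y) => -> /=; rewrite !inE !eqxx ?orbT.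
by rewrite !inE => /andP[/orP[->|->] /orP[->|->]]; rewrite ?orbT.
Qed.

Lemma path_edges_uniq x s : uniq (x :: s) -> uniq (path_edges x s).
Proof.
elim: s x => [//|y s IH] x /= /andP[xs us]; rewrite IH // andbT.
apply/negP => /path_edges_mem; move: xs.
by case: (orientP x y) => -> /= /negbTE xs /andP[]; rewrite ?xs.
Qed.

Lemma path_edges_oriented x s : path (adj nb) x s -> all (oriented_edge nb) (path_edges x s).
Proof. by elim: s x => [//|y s IH] x /= /andP[xy ps]; rewrite oriented_orient // IH. Qed.

Lemma size_path_edges x s : size (path_edges x s) = size s.
Proof. by elim: s x => //= y s IH x; rewrite IH. Qed.

Variables (q : nat) (t p : R).
Hypothesis deg : forall x, size (nb x) = q.+1.
Hypothesis q2 : (2 <= q)%N.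
Hypothesis t01 : 9 / 10 <= t < 1.
Hypothesis Anorm : forall f : V -> R, fins f ->
  ip (adjop nb f) (adjop nb f) <= (t * q.+1%:R) ^+ 2 * ip f f.
Hypothesis p0 : 0 <= p.
Hypothesis ptq : t * q%:R * p < 1.

Lemma nrm_dirac (x : V) : nrm (dirac_fun R x) = 1.
Proof. by rewrite /nrm ip_dirac /dirac_fun eqxx sqrtr1. Qed.

Lemma nbop_dirac_le n x y : nbop nb (dirac_fun R y) n x <= 8 * (t * q%:R) ^+ n.
Proof.
have fd (z : V) := fins_dirac R z.
have h := ip_sqrt (fd x) (fins_nbop G deg n (fd y)).
rewrite ip_dirac in h; apply: (le_trans h).
rewrite -/(nrm (dirac_fun R x)) nrm_dirac mul1r.
by apply: le_trans (nbop_nrm G deg q2 t01 Anorm n (fd y)) _; rewrite nrm_dirac mulr1.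
Qed.

Context d (Omega : measurableType d).
Variables (P : probability Omega R) (X : V * V -> Omega -> bool).
Hypothesis perc : bernoulli_percolation nb p P X.

Definition open_path_event (x : V) (s : seq V) := [set w |
  [/\ path (adj nb) x s, uniq (x :: s) & all (fun e => X e w) (path_edges x s)]].

Lemma open_path_event_pr x s : measurable (open_path_event x s) /\
  pr P (open_path_event x s) <= p ^+ size s.
Proof.
have pn0 : 0 <= p ^+ size s by rewrite exprn_ge0.
have [ps|nps] := boolP (path (adj nb) x s && uniq (x :: s)); last first.
  rewrite (_ : open_path_event _ _ = set0); first by rewrite /pr measure0.
  by apply/seteqP; split=> w //= [h1 h2 _]; move: nps; rewrite h1 h2.
have /andP[h1 h2] := ps.
have -> : open_path_event x s = [set w | forall e, e \in path_edges x s -> X e w = (fun=> true) e].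
  apply/seteqP; split=> w /=; first by move=> [_ _ /allP h] e /h.
  by move=> h; split=> //; apply/allP.
split; first exact: (measurable_cylinder perc _ (fun=> true)).
rewrite /pr (proj2 perc _ (fun=> true)) ?path_edges_uniq ?path_edges_oriented //=.
by rewrite big_const_seq count_predT iter_mulr_1 size_path_edges.
Qed.

(** The length bound keeps the union bound finite; [open_conn_pr] lets [n] tend to infinity. *)
Definition conn_event x y n := [set w | exists2 s, (size s <= n)%N /\ last x s = y & open_path_event x s w].

Lemma open_conn_event x y : [set w | open_conn nb (X^~ w) x y] = \bigcup_n conn_event x y n.
Proof.
apply/seteqP; split=> w /=.
  move=> [s [ps ls]]; case: (shortenP ps) ls => s' ps' us' _ ls'.
  move: ps'; rewrite (path_openE (X^~ w)) => /andP[p1 p2].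
  by exists (size s') => //; exists s'.
move=> [n _ [s [_ ls] [p1 p2 p3]]]; exists s; split=> //.
by rewrite (path_openE (X^~ w)) p1.
Qed.

Variable D : nat.

(** Union bound over self-avoiding paths, which are non-backtracking: at most [8 (t q)^(m+1)] of
    length [m + 1] join [x] to [y], each open with probability [p^(m+1)]. *)
Lemma conn_event_pr x y n : (forall s, path (adj nb) x s -> last x s = y -> (D < size s)%N) ->
  measurable (conn_event x y n) /\ pr P (conn_event x y n) <= 8 * (t * q%:R * p) ^+ D / (1 - t * q%:R * p).
Proof.
move=> far; set r := t * q%:R * p.
have /andP[t9 t1] := t01.
have q0 : 0 <= q%:R :> R by [].
have r0 : 0 <= r by rewrite !mulr_ge0 //; lra.
(* [m] counts the steps after the first one, so [D <= m] means length greater than [D]. *)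
pose l := flatten [seq flatten [seq [seq v :: s | s <- nbwalks m x v & last v s == y] | v <- nb x]
  | m <- index_iota D n].
have -> : conn_event x y n = [set w | exists2 s, s \in l & open_path_event x s w].
  apply/seteqP; split=> w /=.
    move=> [s [sn ls] [p1 p2 p3]]; exists s => //.
    have hs := far s p1 ls; case: s sn ls p1 p2 p3 hs => [//|v s] sn ls p1 p2 p3 hs.
    apply/flattenP; exists (flatten [seq [seq v' :: s' | s' <- nbwalks (size s) x v' & last v' s' == y] | v' <- nb x]).
      by apply: (map_f (fun m => _)); rewrite mem_index_iota -ltnS hs /= -ltnS.
    apply/flattenP; exists [seq v :: s' | s' <- nbwalks (size s) x v & last v s' == y].
      by apply: (map_f (fun v => _)); case/andP: p1.
    apply: map_f; rewrite mem_filter /=; apply/andP; split; first exact/eqP.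
    by apply: mem_nbwalks; exact: uniq_path_nbwalk.
  move=> [s sl hw]; exists s => //.
  move: sl => /flattenP[_ /mapP[m mi ->] /flattenP[_ /mapP[v vx ->] /mapP[s' ]]].
  rewrite mem_filter => /andP[/eqP ls sm] -> /=; split=> //.
  by rewrite (nbwalks_size sm); move: mi; rewrite mem_index_iota => /andP[].
have [mU pU] := pr_union_le P l (fun s => (open_path_event_pr x s).1).
split=> //; apply: le_trans pU _.
rewrite big_flatten big_map /=.
apply: (@le_trans _ _ (\sum_(m <- index_iota D n) 8 * r ^+ m.+1)).
  apply: ler_sum => m _; rewrite big_flatten big_map /=.
  apply: (@le_trans _ _ (\sum_(v <- nb x) nbsum nb (dirac_fun R y) m x v * p ^+ m.+1)).
    apply: ler_sum => v _; rewrite -count_nbwalks big_map -size_filter -sum1_size natr_sum mulr_suml.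
    rewrite big_seq [leRHS]big_seq; apply: ler_sum => s.
    rewrite mem_filter => /andP[_ sm]; rewrite mul1r.
    by apply: le_trans (open_path_event_pr x (v :: s)).2 _; rewrite /= (nbwalks_size sm).
  rewrite -mulr_suml -[\sum_(_ <- _) _]/(nbop nb (dirac_fun R y) m.+1 x).
  by rewrite /r (exprMn _ _ p) mulrA ler_wpM2r ?exprn_ge0 // nbop_dirac_le.
have r1 : 0 < 1 - r by rewrite subr_gt0.
rewrite -mulr_sumr -mulrA ler_wpM2l // ler_pdivlMr //.
have [Dn|nD] := leqP D n; last by rewrite /index_iota (eqP (ltnW nD)) big_nil mul0r exprn_ge0.
have tel k : \sum_(m <- index_iota D (D + k)) r ^+ m.+1 * (1 - r) = r ^+ D.+1 - r ^+ (D + k).+1.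
  elim: k => [|k IH]; first by rewrite addn0 /index_iota subnn big_nil subrr.
  by rewrite addnS big_nat_recr ?leq_addr //= IH !exprS; ring.
rewrite mulr_suml -(subnKC Dn) tel; apply: (@le_trans _ _ (r ^+ D.+1)).
  by rewrite gerBl exprn_ge0.
by rewrite exprS ler_piMl ?exprn_ge0 // ltW.
Qed.

Lemma open_conn_pr x y : (forall s, path (adj nb) x s -> last x s = y -> (D < size s)%N) ->
  pr P [set w | open_conn nb (X^~ w) x y] <= 8 * (t * q%:R * p) ^+ D / (1 - t * q%:R * p).
Proof.
move=> far; have mC n : measurable (conn_event x y n) by have [] := conn_event_pr n far.
have mU : measurable (\bigcup_n conn_event x y n) by exact: bigcupT_measurable.
rewrite open_conn_event -lee_fin -prE //.
have mono : {homo conn_event x y : n m / (n <= m)%N >-> (n <= m)%O}.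
  move=> n m nm; apply/subsetPset => w [s [sn ls] hs]; exists s => //; split=> //.
  exact: leq_trans nm.
have cv : (P \o conn_event x y) n @[n --> \oo] --> P (\bigcup_n conn_event x y n).
  exact: nondecreasing_cvg_mu.
rewrite -(cvg_lim _ cv) //; apply: lime_le; first by apply/cvg_ex; eexists; exact: cv.
by near=> n; rewrite /= prE // lee_fin; have [] := conn_event_pr n far.
Unshelve. all: by end_near.
Qed.

End TwoPoint.

(** * Thresholds *)

Section NonUniqueness.
Variables (V : countType) (nb : V -> seq V) (R : realType).
Hypothesis G : graph_ok nb.
Hypothesis trans : transitive_graph nb.

Definition thicken (S : seq V) : seq V := S ++ flatten (map nb S).

Lemma path_in_thicken S x s : x \in S -> path (adj nb) x s -> last x s \in iter (size s) thicken S.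
Proof.
elim: s S x => [//|y s IH] S x xS /= /andP[xy ps].
rewrite -iterS iterSr; apply: IH ps.
by rewrite mem_cat; apply/orP; right; apply/flattenP; exists (nb x) => //; exact: map_f.
Qed.

Lemma thicken_mono m n S : (m <= n)%N -> {subset iter m thicken S <= iter n thicken S}.
Proof.
move=> /subnKC <-; elim: (n - m)%N => [|k IH] x; first by rewrite addn0.
by move=> /IH h; rewrite addnS /= mem_cat h.
Qed.

(** A finite list contains all vertices within distance [D] of [S], and the graph is infinite. *)
Lemma exists_far (S : seq V) D : exists y, forall x s, x \in S -> path (adj nb) x s -> last x s = y -> (D < size s)%N.
Proof.
have [y hy] := exists_notin G (iter D thicken S); exists y => x s xS ps ls.
rewrite ltnNge; apply/negP => sD; move/negP: hy; apply.
by rewrite -ls; apply: (thicken_mono sD); exact: path_in_thicken.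
Qed.

Variables (q : nat) (t p : R).
Hypothesis deg : forall x, size (nb x) = q.+1.
Hypothesis q2 : (2 <= q)%N.
Hypothesis t01 : 9 / 10 <= t < 1.
Hypothesis Anorm : forall f : V -> R, fins f ->
  ip (adjop nb f) (adjop nb f) <= (t * q.+1%:R) ^+ 2 * ip f f.
Hypothesis p0 : 0 <= p.
Hypothesis ptq : t * q%:R * p < 1.

Context d (Omega : measurableType d).
Variables (P : probability Omega R) (X : V * V -> Omega -> bool).
Hypothesis perc : bernoulli_percolation nb p P X.

Let mX e : oriented_edge nb e -> measurable [set w | X e w].
Proof. by move=> _; case: perc. Qed.

Definition unique_event x := [set w | in_unique_infinite nb (X^~ w) x].

Lemma measurable_unique_event x : measurable (unique_event x).
Proof.
apply: measurable_conj; first exact: (measurable_has_unique G mX).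
exact: (measurable_infinite_cluster G mX).
Qed.

Lemma unique_event_const x y : pr P (unique_event x) = pr P (unique_event y).
Proof.
have [phi [bphi hphi <-]] := trans x y; case: bphi => psi K1 K2.
by congr (fine _); rewrite /unique_event (unique_infinite_invariant G K1 K2 hphi perc).
Qed.

Lemma exists_small (eta : R) : 0 < eta -> exists D,
  8 * (t * q%:R * p) ^+ D / (1 - t * q%:R * p) <= eta.
Proof.
move=> e0; set r := t * q%:R * p; have /andP[t9 t1] := t01.
have r1 : 0 < 1 - r by rewrite subr_gt0.
have r0 : 0 <= r by rewrite !mulr_ge0 //; lra.
have [D hD] : exists D, r ^+ D < eta * (1 - r) / 8.
  apply: expr_small; first by rewrite r0.
  by rewrite divr_gt0 // mulr_gt0.
exists D; rewrite ler_pdivrMr //.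
by move: hD; rewrite ltr_pdivlMr // mulrC => /ltW.
Qed.

(* Second Bonferroni inequality along a sequence of vertices that are pairwise
   connected with probability at most [eta]. *)
Lemma far_family (eta : R) x0 N : 0 < eta -> exists l : seq V, size l = N /\
  N%:R * pr P (unique_event x0) - N%:R ^+ 2 * eta <=
  pr P [set w | exists2 x, x \in l & unique_event x w].
Proof.
move=> e0; elim: N => [|N [l [sl IH]]].
  by exists [::]; split=> //; rewrite mul0r expr0n mul0r subr0 pr_ge0.
have [D hD] := exists_small e0; have [y hy] := exists_far l D.
exists (y :: l); split; first by rewrite /= sl.
have mA := measurable_unique_event.
have [mU _] := pr_union_le P l mA.
have -> : [set w | exists2 x, x \in y :: l & unique_event x w] =
    unique_event y `|` [set w | exists2 x, x \in l & unique_event x w].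
  apply/seteqP; split=> w /=.
    by move=> [x]; rewrite inE => /orP[/eqP -> ?|il ?]; [left|right; exists x].
  by move=> [Aa|[x il Ai]]; [exists y => //; exact: mem_head|exists x => //; rewrite inE il orbT].
rewrite pr_setU // (unique_event_const y x0).
have mI x : measurable (unique_event x `&` unique_event y) by exact: measurableI.
have [mUI pUI] := pr_union_le P l mI.
have : pr P ([set w | exists2 x, x \in l & unique_event x w] `&` unique_event y) <= N%:R * eta.
  rewrite (_ : _ `&` _ = [set w | exists2 x, x \in l & (unique_event x `&` unique_event y) w]); last first.
    apply/seteqP; split=> w /=; first by move=> [[x xl h1] h2]; exists x.
    by move=> [x xl [h1 h2]]; split=> //; exists x.
  apply: le_trans pUI _; rewrite -sl -sum1_size natr_sum mulr_suml big_seq [leRHS]big_seq.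
  apply: ler_sum => x xl; rewrite mul1r; apply: le_trans hD.
  apply: le_trans (open_conn_pr G deg q2 t01 Anorm p0 ptq perc (fun s => hy x s xl)).
  apply: pr_le => //; first exact: (measurable_open_conn G mX).
  by move=> w [[[_ hu] hx] [_ hy']]; exact: hu.
move=> h; have N0 : 0 <= N%:R :> R by [].
rewrite -natr1; set NN := N%:R in IH h N0 *.
by have := mulr_ge0 N0 (ltW e0); rewrite !expr2 in IH *; lra.
Qed.

Lemma unique_event_null x : pr P (unique_event x) = 0.
Proof.
apply/eqP; rewrite eq_le pr_ge0 andbT leNgt; apply/negP => dl0.
set dl := pr P (unique_event x) in dl0.
(* With [eta = N^-2], [far_family] gives [N dl - 1 <= 1], against [N dl > 2]. *)
pose N := (Num.truncn (2 / dl)).+1.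
have hN : 2 / dl < N%:R by exact: truncnS_gt.
have N0 : 0 < N%:R :> R by rewrite ltr0n.
have e0 : 0 < (N%:R ^+ 2)^-1 :> R by rewrite invr_gt0 exprn_gt0.
have [l [_]] := far_family x N e0.
rewrite divff; last by rewrite expf_neq0 // gt_eqF.
have [mU _] := pr_union_le P l measurable_unique_event.
move=> /le_trans /(_ (pr_le1 P mU)); rewrite -/dl.
by move: hN; rewrite ltr_pdivrMr // => h1 h2; lra.
Qed.

Lemma has_unique_null : P [set w | has_unique_infinite_cluster nb (X^~ w)] = 0%E.
Proof.
have mU : measurable [set w | has_unique_infinite_cluster nb (X^~ w)].
  exact: (measurable_has_unique G mX).
pose F k := if unpickle k is Some x then unique_event x else set0.
have nF k : P.-negligible (F k).
  rewrite /F; case: (unpickle k) => [x|]; last exact: negligible_set0.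
  apply/negligibleP; first exact: measurable_unique_event.
  by apply: etrans (prE P (measurable_unique_event x)) _; rewrite unique_event_null.
apply/negligibleP => //; apply: negligibleS (negligible_bigcup nF).
move=> w [[x hx] hu]; exists (pickle x) => //; rewrite /F pickleK; split=> //.
by split=> //; exists x.
Qed.

End NonUniqueness.

Section Thresholds.
Variables (V : countType) (nb : V -> seq V) (R : realType).
Hypothesis G : graph_ok nb.

(** This makes the set defining [p_u] nonempty; the infimum of the empty set would be [0]. *)
Lemma prob_pos1_unique : prob_pos nb (1 : R) (has_unique_infinite_cluster nb).
Proof.
move=> d Omega P X perc.
have mX e : oriented_edge nb e -> measurable [set w | X e w] by move=> _; case: perc.
pose A k := if unpickle k is Some e then
  (if oriented_edge nb e then [set w | X e w] else setT) else setT.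
have mA k : measurable (A k).
  by rewrite /A; case: (unpickle k) => [e|//]; case: ifP => // /mX.
have nA k : P.-negligible (~` A k).
  apply/negligibleP; first exact: measurableC.
  apply: etrans (probability_setC P (mA k)) _; rewrite /A; case: (unpickle k) => [e|]; last by rewrite probability_setT subee.
  case: ifP => oe; last by rewrite probability_setT subee.
  have h := proj2 perc [:: e] (fun=> true) isT; rewrite /= oe in h.
  rewrite (_ : [set w | X e w] = [set w | forall e', e' \in [:: e] -> X e' w = true]).
    by rewrite h // big_seq1 subee.
  apply/seteqP; split=> w /=; first by move=> ? e'; rewrite inE => /eqP ->.
  by apply; exact: mem_head.
have mI : measurable (\bigcap_k A k) by exact: bigcapT_measurable.
have PI : P (\bigcap_k A k) = 1%E.
  have : P (~` (\bigcap_k A k)) = 0%E.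
    apply/negligibleP; first exact: measurableC.
    by rewrite setC_bigcap; exact: negligible_bigcup.
  rewrite probability_setC // prE // -EFinB => -[/eqP].
  by rewrite subr_eq0 => /eqP <-.
apply: (@lt_le_trans _ _ (P (\bigcap_k A k))); first by rewrite PI lte01.
apply: le_measure; rewrite ?inE //; first exact: (measurable_has_unique G mX).
move=> w hw.
have hX e : oriented_edge nb e -> X e w.
  by move=> oe; have := hw (pickle e) I; rewrite /A pickleK oe.
have conn x y : open_conn nb (X^~ w) x y.
  case: G => _ _ _ /(_ x y) [s [ps ls]] _; exists s; split=> //.
  by rewrite (path_openE nb (X^~ w)) ps; apply/allP => e /(allP (path_edges_oriented G ps)) /hX.
split=> //; have [x _] := exists_notin G [::]; exists x.
by apply/infinite_setP => s; have [y ys] := exists_notin G s; exists y; split=> //; exact: conn.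
Qed.

End Thresholds.

Section Main.
Variable R : realType.

Lemma p_c_le (V : countType) (nb : V -> seq V) (a : R) : 0 <= a <= 1 ->
  prob_pos nb a (has_infinite_cluster nb) -> p_c nb R <= a.
Proof.
move=> a01 h; apply: ge_inf; last by split.
by exists 0 => x [/andP[]].
Qed.

Lemma p_u_ge (V : countType) (nb : V -> seq V) (b : R) : graph_ok nb ->
  (forall p, 0 <= p < b -> p < 1 /\ ~ prob_pos nb p (has_unique_infinite_cluster nb)) ->
  b <= p_u nb R.
Proof.
move=> G h; apply: lb_le_inf.
  by exists 1; split; [rewrite ler01 lexx|exact: prob_pos1_unique].
move=> p [/andP[p0 p1] hp]; rewrite leNgt; apply/negP => pb.
by have [|_] := h p; [rewrite p0|].
Qed.

End Main.

Theorem theorem1p1 (R : realType) (rho : R) :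
  rho < 1 ->
  exists L : nat, (0 < L)%N /\
    forall (V : countType) (nb : V -> seq V) (o : V),
      graph_ok nb -> transitive_graph nb ->
      spectral_radius nb R o <= rho ->
      girth_ge nb L ->
      p_c nb R < p_u nb R.
Proof.
move=> rho1.
(* The norm bound is monotone in the spectral bound, which may thus be raised to [9/10]. *)
pose t := Num.max rho (9 / 10).
have t01 : 9 / 10 <= t < 1.
  by rewrite le_max lexx orbT /= gt_max rho1; lra.
have /andP[t9 t1] := t01; have t0 : 0 < t by lra.
have [k hk] := infinite_cluster_large_girth t01.
exists (2 * k + 1)%N; split; first by rewrite addn1.
move=> V nb o G tr srho girth.
have deg x : size (nb x) = size (nb o) := degree_const G tr x o.
have d0 : (0 < size (nb o))%N.
  have [y [z [_ _ zy]]] := exists_boundary G (mem_head o [::]).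
  by rewrite -(deg y); case: (nb y) zy.
have norm := adjop_norm G tr deg srho d0.
have rho0 : 0 <= rho := rho_ge0 srho.
have rho01 : 0 <= rho < 1 by rewrite rho0.
have d3 := degree_ge3 G rho01 norm.
pose q := (size (nb o)).-1.
have dq : size (nb o) = q.+1 by rewrite prednK.
have degq x : size (nb x) = q.+1 by rewrite deg.
have q2 : (2 <= q)%N by rewrite -ltnS -dq.
have Anorm (f : V -> R) : fins f ->
    ip (adjop nb f) (adjop nb f) <= (t * q.+1%:R) ^+ 2 * ip f f.
  move=> hf; apply: le_trans (norm f hf) _; rewrite dq.
  apply: ler_wpM2r; first exact: ip_ge0.
  rewrite ler_pXn2r ?nnegrE ?mulr_ge0 ?(ltW t0) // ler_wpM2r //.
  by rewrite le_max lexx.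
have q2' : 2 <= q%:R :> R by rewrite ler_nat.
have q0 : 0 < q%:R :> R by lra.
have tq0 : 0 < t * q%:R by rewrite mulr_gt0.
have tV : t * t^-1 = 1 by rewrite divff // gt_eqF.
have tV1 : 1 < t^-1 by rewrite invf_gt1.
have tV2 : t^-1 <= 10 / 9 by rewrite -(ler_pM2l t0) tV; lra.
have sc01 : 0 <= supercritical t q <= 1.
  rewrite divr_ge0 ?(ltW q0) //=; last by lra.
  by rewrite ler_pdivrMr // mul1r; lra.
have pc := p_c_le sc01 (hk V nb q G degq q2 Anorm girth).
apply: (le_lt_trans pc); apply: (@lt_le_trans _ _ (t * q%:R)^-1).
  by rewrite /supercritical invfM ltr_pM2r ?invr_gt0 //; lra.
apply: p_u_ge => // p /andP[p0 pb].
have ptq : t * q%:R * p < 1 by rewrite mulrC -ltr_pdivlMr // mul1r.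
(* As [t q >= 9/5], the bound [1 / (t q)] is below [1], and [percolation_model] applies. *)
have p1 : p < 1 by nra.
split=> // hp.
have [|P [X perc]] := @percolation_model V nb R p; first by rewrite p0.
have := hp _ _ P X perc.
by rewrite (has_unique_null G tr degq q2 t01 Anorm p0 ptq perc) ltxx.
Qed.
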